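(* Let $X$ be a curve whose function field $F$ is a cyclic extension of degree $p^n$ of the rational function field $k(x)$ in which exactly $s\ge 2$ places ramify, all of them totally ramified, with corresponding points $P_1,\ldots,P_s$ of $X$. Let $\delta_i$ denote the different exponent at $P_i$. Fix $i\in\{1,\dots,s\}$. The Weierstrass semigroup at $P_i$ is symmetric if and only if $$\sum_{i'\ne i}\delta_{i'}=p^n\sum_{i'\neq i}\left\lfloor\frac{\delta_{i'}}{p^n}\right\rfloor .$$ Moreover, this equality holds if and only if $\lambda_{i',n}\equiv -1 \bmod p^n$ for all $i'\ne i$.
   Context: The constant field (also denoted $k$) is algebraically closed of characteristic $p>0$, and $X$ is a projective nonsingular curve of genus $g\ge 2$. There is a unique tower $k(x)=L_0\subset L_1\subset\cdots\subset L_n=F$ with $[L_j:L_{j-1}]=p$, and generators are chosen in standard form: $L_j=L_{j-1}(y_j)$, $y_j^p-y_j=B_j\in L_{j-1}$, $\mathrm{div}(B_j)=A-\sum_i\lambda_{i,j}P_{i,j-1}$, with $A$ effective and prime to the pole divisor of $B_j$, $P_{i,j}$ the place of $L_j$ below $P_i$, and $\lambda_{i,j}=-v_{P_{i,j-1}}(B_j)=-v_{P_{i,j}}(y_j)$ zero or a positive integer prime to $p$. The Weierstrass semigroup at a point $P$ is the set of integers $a\ge0$ such that some function on $X$ has pole divisor $aP$; the gaps are the positive integers not in it (there are $g$ of them). A semigroup with $g$ gaps is called symmetric if its $g$-th (largest) gap is $2g-1$. *)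

(* Defs.v *)
From HB Require Import structures.
From mathcomp Require Import all_boot all_order all_fingroup all_algebra.
From mathcomp Require Import all_solvable all_field.

Set Implicit Arguments.
Unset Strict Implicit.
Unset Printing Implicit Defensive.

Import Order.TTheory GRing.Theory Num.Theory.
Local Open Scope ring_scope.

(* A curve over k is handled through its function field F,                    *)
(* a finite extension of the rational function field k(x); its points are the *)
(* places of F / k.                                                           *)

Notation ratfun k := {fraction {poly k}}.

Definition cst0 (k : fieldType) (a : k) : ratfun k := tofrac a%:P.

Definition cst (k : fieldType) (E : fieldExtType (ratfun k)) (a : k) : E :=
  (cst0 a)%:A.

(* Places of E / k, represented by their normalized discrete valuations.      *)
(* Since v is int-valued, v 0 (mathematically +oo) gets the conventional      *)
(* value 0; this makes the representing function unique.                      *)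
Definition is_place (k E : fieldType) (c : k -> E) (v : E -> int) : Prop :=
  [/\ v 0 = 0,
      forall a b, a != 0 -> b != 0 -> v (a * b) = v a + v b,
      forall a b, a != 0 -> b != 0 -> a + b != 0 ->
        Num.min (v a) (v b) <= v (a + b),
      forall a : k, v (c a) = 0
    & exists2 t, t != 0 & v t = 1].

(* The place w of E' lies above the place v of E, with ramification index e,  *)
(* along the field embedding f : E -> E'.                                     *)
Definition lies_over (E E' : fieldType) (f : E -> E')
    (w : E' -> int) (v : E -> int) (e : nat) : Prop :=
  (0 < e)%N /\ forall z, w (f z) = e%:Z * v z.

Definition ramified (k : fieldType) (F : fieldExtType (ratfun k))
    (q : ratfun k -> int) : Prop :=
  exists w : F -> int, exists2 e : nat,
    is_place (@cst k F) w & lies_over (in_alg F) w q e /\ (1 < e)%N.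

Definition totally_ramified (k : fieldType) (F : fieldExtType (ratfun k))
    (w : F -> int) (q : ratfun k -> int) : Prop :=
  lies_over (in_alg F) w q (\dim {:F}).

(* By the convention v 0 = 0 this contains 0.                                 *)
Definition val_ring (E : fieldType) (v : E -> int) : {pred E} :=
  [pred z | 0 <= v z].

Definition integral_closure (k : fieldType) (F : fieldExtType (ratfun k))
    (q : ratfun k -> int) (z : F) : Prop :=
  exists m : {poly ratfun k},
    [/\ m \is monic, m \is a polyOver (val_ring q)
      & root (map_poly (in_alg F) m) z].

Definition complementary_module (k : fieldType)
    (F : splittingFieldType (ratfun k)) (q : ratfun k -> int) (z : F) : Prop :=
  forall y : F, integral_closure q y ->
    exists2 u, u \in val_ring q & galTrace 1 {:F} (z * y) = u%:A.

(* d = - w(t), where t generates the complementary module as a module over    *)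
(* the integral closure of the valuation ring of q; w is a place above q.     *)
(* The trace is the Galois trace: this is used for F Galois over k(x) only.   *)
Definition different_exponent (k : fieldType)
    (F : splittingFieldType (ratfun k))
    (w : F -> int) (q : ratfun k -> int) (d : nat) : Prop :=
  exists2 t : F,
    forall z, complementary_module q z <->
      exists2 u, integral_closure q u & z = t * u
    & d%:Z = - w t.

(* A divisor is a formal sum of m j times V j, for pairwise distinct places   *)
(* V j.  As k will be algebraically closed, every place has degree 1.         *)
Definition is_divisor (k : fieldType) (F : fieldExtType (ratfun k)) (r : nat)
    (V : 'I_r -> F -> int) : Prop :=
  (forall j, is_place (@cst k F) (V j)) /\
  (forall j j', V j =1 V j' -> j = j').

Definition deg_divisor (r : nat) (m : 'I_r -> int) : int := \sum_j m j.

Definition riemann_roch_space (k : fieldType) (F : fieldExtType (ratfun k))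
    (r : nat) (V : 'I_r -> F -> int) (m : 'I_r -> int) (z : F) : Prop :=
  z != 0 ->
  (forall j, - m j <= V j z) /\
  (forall u, is_place (@cst k F) u -> (forall j, ~ u =1 V j) -> 0 <= u z).

Definition has_kdim (k : fieldType) (F : fieldExtType (ratfun k))
    (S : F -> Prop) (d : nat) : Prop :=
  exists2 b : 'I_d -> F,
    (forall a : 'I_d -> k, \sum_j cst F (a j) * b j = 0 -> forall j, a j = 0)
    & (forall z, S z <-> exists a : 'I_d -> k, z = \sum_j cst F (a j) * b j).

(* The genus: the maximum of deg D - l(D) + 1 over all divisors D.            *)
Definition is_genus (k : fieldType) (F : fieldExtType (ratfun k)) (g : nat) :
    Prop :=
  (forall r (V : 'I_r -> F -> int) (m : 'I_r -> int) (d : nat),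
     is_divisor V -> has_kdim (riemann_roch_space V m) d ->
     deg_divisor m - d%:Z + 1 <= g%:Z) /\
  (exists r (V : 'I_r -> F -> int) (m : 'I_r -> int) (d : nat),
     [/\ is_divisor V, has_kdim (riemann_roch_space V m) d
       & deg_divisor m - d%:Z + 1 = g%:Z]).

Definition pole_order (E : fieldType) (v : E -> int) (z : E) : nat :=
  if v z < 0 then `|v z|%N else 0%N.

(* a is in the semigroup of w when some function has pole divisor a w.        *)
Definition weierstrass_semigroup (k : fieldType)
    (F : fieldExtType (ratfun k)) (w : F -> int) (a : nat) : Prop :=
  exists z : F,
    [/\ z != 0, pole_order w z = a
      & forall u, is_place (@cst k F) u -> ~ u =1 w -> pole_order u z = 0%N].

Definition gap (H : nat -> Prop) (a : nat) : Prop := (0 < a)%N /\ ~ H a.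

(* gs lists the gaps in increasing order, so that size gs is their number.    *)
Definition symmetric_semigroup (H : nat -> Prop) : Prop :=
  exists gs : seq nat,
    [/\ sorted ltn gs, forall a, a \in gs <-> gap H a
      & last 0%N gs = (2 * size gs - 1)%N].

(* The tower k(x) = L 0 < L 1 < ... < L n = F with Artin-Schreier generators  *)
(* in standard form.  Only indices up to n matter: y j, B j, lam i j are used *)
(* for 1 <= j <= n.  The last three fields say that                           *)
(* div (B j) = A - \sum_i lam i j * P_(i, j - 1) with A effective and prime   *)
(* to the pole divisor, P_(i, j - 1) being the place of L (j - 1) below P i,  *)
(* where lam i j = - v(B j) at P_(i, j - 1) is zero or prime to p.            *)
Record standard_form (k : fieldType) (p n s : nat)
    (F : fieldExtType (ratfun k)) (P : 'I_s -> F -> int)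
    (L : nat -> {subfield F}) (y B : nat -> F) (lam : 'I_s -> nat -> nat) :
    Prop := StandardForm {
  sf_bottom : L 0%N = 1%AS;
  sf_top : L n = {:F}%AS;
  sf_sub : forall j, (j < n)%N -> (L j <= L j.+1)%VS;
  sf_degree : forall j, (j < n)%N -> \dim_(L j) (L j.+1) = p;
  sf_gen : forall j, (j < n)%N -> <<L j; y j.+1>>%VS = L j.+1;
  sf_eq : forall j, (j < n)%N -> y j.+1 ^+ p - y j.+1 = B j.+1;
  sf_B : forall j, (j < n)%N -> B j.+1 \in L j;
  sf_lam : forall j i, (j < n)%N -> lam i j.+1 = 0%N \/ coprime (lam i j.+1) p;
  sf_pole : forall j i (u : subvs_of (L j) -> int) e, (j < n)%N ->
    is_place (@cst k (subvs_of (L j))) u -> lies_over vsval (P i) u e ->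
    u (vsproj (L j) (B j.+1)) = - (lam i j.+1)%:Z;
  sf_regular : forall j (u : subvs_of (L j) -> int), (j < n)%N ->
    is_place (@cst k (subvs_of (L j))) u ->
    (forall i e, ~ lies_over vsval (P i) u e) ->
    0 <= u (vsproj (L j) (B j.+1))
}.

(* Main.v *)
Require Import Defs.
From HB Require Import structures.
From mathcomp Require Import all_boot all_order all_fingroup all_algebra.
From mathcomp Require Import all_solvable all_field.
From mathcomp Require Import boolp classical_sets zify ring.

(** Write [N] for the degree [p ^ n] and [v] for the place [P i] of [F].

    The symmetry criterion. Call a function regular if it has no pole but [v], and
    coregular if it lies in the complementary module at every place of [k(x)]
    other than [Q i]; up to a fixed differential coming from [k(x)], coregular
    functions are the differentials with no pole but [v]. Duality for the trace
    form of [F] over [k(x)] plays the part of the Riemann-Roch theorem: there is a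
    constant [c] such that [b] is the valuation of a coregular function exactly
    when [c - b] is not that of a regular one ([coregular_gap]). One direction
    holds because a nonzero function of [k(x)] with poles at most at [Q i] cannot
    vanish there. For the other, a basis of regular functions of least pole order
    in each class modulo [N] has, for the trace form, a dual basis of coregular
    functions of known valuations.

    A semigroup is symmetric exactly when a reflection exchanges it with its
    complement ([symmetric_semigroup_iff]). So symmetry means that regular and
    coregular functions have the same valuations up to a translation. Away from
    the ramified places the complementary module is the integral closure, and at
    [P j] it consists of the elements of valuation at least [- delta j]. If [N]
    divides every [delta j] with [j != i], a function of [k(x)] can be found whose
    multiples by regular functions are the coregular functions, and the semigroup
    is symmetric ([divisible_symmetric]). Conversely, if it is symmetric, a
    coregular function [z0] of largest valuation generates the coregular functions
    over the regular ones. The conjugates of [z0] are generators too, so they are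
    constant multiples of [z0], and the constants, being roots of unity of order a
    power of the characteristic, are [1]. Hence [z0] lies in [k(x)], its valuation
    at [P j] is divisible by [N], and that valuation is [- delta j]
    ([symmetric_divisible]). The equality between the two sums says
    that [N] divides every [delta j] with [j != i].

    The congruence. By Hilbert's formula [delta j] is the sum of the ramification
    numbers plus one of the automorphisms other than the identity
    ([hilbert_different]). In a cyclic group of order [p ^ n] these take at most
    [n] values, the jumps, one for each [p]-adic valuation of the exponent, and
    Sen's theorem says that consecutive jumps agree modulo increasing powers of
    [p] ([sen]). It follows that [p ^ n] divides [delta j] if and only if it
    divides the last jump plus one ([different_dvd]). The last jump is the
    ramification number of an automorphism [tau] that fixes [L n.-1]; it moves the
    Artin-Schreier generator [y n] by an element of the prime field, and as the
    pole order [lam j n] of [y n] at [P j] is prime to [p], this order is the jump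
    ([last_ram_num]). *)

Set Implicit Arguments.
Unset Strict Implicit.
Unset Printing Implicit Defensive.

Import Order.TTheory GRing.Theory Num.Theory.
Local Open Scope ring_scope.

(** * Discrete valuations *)

Definition valuation (E : fieldType) (v : E -> int) : Prop :=
  [/\ v 0 = 0,
      forall a b, a != 0 -> b != 0 -> v (a * b) = v a + v b
    & forall a b, a != 0 -> b != 0 -> a + b != 0 ->
        Num.min (v a) (v b) <= v (a + b)].

(** The bound [m <= v z] under the convention that [v 0] is infinite. *)
Definition vge (E : fieldType) (v : E -> int) (m : int) (z : E) : bool :=
  (z == 0) || (m <= v z).

Section Valuation.

Variables (E : fieldType) (v : E -> int).
Hypothesis val_v : valuation v.

Lemma dval0 : v 0 = 0. Proof. by case: val_v. Qed.

Lemma dvalM a b : a != 0 -> b != 0 -> v (a * b) = v a + v b.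
Proof. by case: val_v => _ + _; apply. Qed.

Lemma dval1 : v 1 = 0.
Proof.
have nz1 : (1 : E) != 0 by exact: oner_neq0.
by have := dvalM nz1 nz1; rewrite mulr1; lia.
Qed.

Lemma dvalN a : v (- a) = v a.
Proof.
have N1 : (-1 : E) != 0 by rewrite oppr_eq0 oner_eq0.
have vN1 : v (-1) = 0 by have := dvalM N1 N1; rewrite mulrNN mulr1 dval1; lia.
have [->|nz] := eqVneq a 0; first by rewrite oppr0.
by rewrite -mulN1r dvalM // vN1 add0r.
Qed.

Lemma dvalV a : v a^-1 = - v a.
Proof.
have [->|nz] := eqVneq a 0; first by rewrite invr0 dval0.
by have := dvalM nz (invr_neq0 nz); rewrite divff // dval1; lia.
Qed.

Lemma dvalX a n : v (a ^+ n) = n%:Z * v a.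
Proof.
have [->|nz] := eqVneq a 0; first by rewrite expr0n dval0 mulr0; case: n => [|n]; rewrite ?dval1 ?dval0.
elim: n => [|n IH]; first by rewrite expr0 dval1 mul0r.
by rewrite exprS dvalM ?expf_neq0 // IH; lia.
Qed.

Lemma dvalD a b : a != 0 -> b != 0 -> a + b != 0 ->
  Num.min (v a) (v b) <= v (a + b).
Proof. by case: val_v => _ _; apply. Qed.

Lemma vge0 m : vge v m 0. Proof. by rewrite /vge eqxx. Qed.

Lemma vgeE m z : z != 0 -> vge v m z = (m <= v z).
Proof. by rewrite /vge => /negPf->. Qed.

Lemma vgeP m z : reflect (z != 0 -> m <= v z) (vge v m z).
Proof.
rewrite /vge; case: eqP => [->|]; first by left=> /negP[].
by move=> _ /=; apply: (iffP idP) => // /(_ isT).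
Qed.

Lemma vgeN_lt m z : ~~ vge v m z = (z != 0) && (v z < m).
Proof. by rewrite /vge negb_or ltNge. Qed.

Lemma vge_val z : vge v (v z) z.
Proof. by rewrite /vge lexx orbT. Qed.

Lemma vge_le m m' z : m' <= m -> vge v m z -> vge v m' z.
Proof. by move=> le /vgeP H; apply/vgeP => /H; apply: le_trans. Qed.

Lemma vgeD m a b : vge v m a -> vge v m b -> vge v m (a + b).
Proof.
have [->|nza] := eqVneq a 0; first by rewrite add0r.
have [->|nzb] := eqVneq b 0; first by rewrite addr0.
have [->|nz] := eqVneq (a + b) 0; first by rewrite vge0.
rewrite !vgeE // => la lb; apply: le_trans (dvalD nza nzb nz).
by rewrite le_min la.
Qed.

Lemma vgeN m a : vge v m (- a) = vge v m a.
Proof. by rewrite /vge oppr_eq0 dvalN. Qed.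

Lemma vgeB m a b : vge v m a -> vge v m b -> vge v m (a - b).
Proof. by move=> Ha Hb; rewrite vgeD ?vgeN. Qed.

Lemma vgeM m m' a b : vge v m a -> vge v m' b -> vge v (m + m') (a * b).
Proof.
have [->|nza] := eqVneq a 0; first by rewrite mul0r => _ _; exact: vge0.
have [->|nzb] := eqVneq b 0; first by rewrite mulr0 => _ _; exact: vge0.
by rewrite !vgeE ?mulf_neq0 // dvalM //; apply: lerD.
Qed.

Lemma vge_mull m a b : a != 0 -> vge v m (a * b) = vge v (m - v a) b.
Proof.
move=> nza; rewrite /vge mulf_eq0 (negPf nza) /=.
by case: eqP => //= /eqP nzb; rewrite dvalM //; lia.
Qed.

Lemma vgeX m a n : vge v m a -> vge v (n%:Z * m) (a ^+ n).
Proof.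
move=> H; elim: n => [|n IH]; first by rewrite expr0 vgeE ?oner_eq0 // dval1 mul0r.
by rewrite exprS (_ : n.+1%:Z * m = m + n%:Z * m); [exact: vgeM | lia].
Qed.

Lemma vge_sum m (I : Type) (r : seq I) (P : pred I) (G : I -> E) :
  (forall i, P i -> vge v m (G i)) -> vge v m (\sum_(i <- r | P i) G i).
Proof.
by move=> H; apply: (big_ind (vge v m)) => //; [exact: vge0 | exact: vgeD].
Qed.

Lemma vge_prod (I : Type) (r : seq I) (P : pred I) (G : I -> E) :
  (forall i, P i -> vge v 0 (G i)) -> vge v 0 (\prod_(i <- r | P i) G i).
Proof.
move=> H; apply: (big_ind (vge v 0)) => //.
  by rewrite vgeE ?oner_eq0 // dval1.
by move=> a b Ha Hb; rewrite -[0](addr0 0) vgeM.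
Qed.

Lemma dval_prod (I : eqType) (r : seq I) (G : I -> E) :
  (forall i, i \in r -> G i != 0) ->
  v (\prod_(i <- r) G i) = \sum_(i <- r) v (G i).
Proof.
elim: r => [|i r IH] H; first by rewrite !big_nil dval1.
have nzi : G i != 0 by apply: H; rewrite mem_head.
have nzr j : j \in r -> G j != 0 by move=> jr; apply: H; rewrite inE jr orbT.
rewrite !big_cons dvalM ?IH //; rewrite prodf_seq_neq0; apply/allP => j /nzr.
by [].
Qed.

Lemma val_ringE z : (z \in val_ring v) = vge v 0 z.
Proof. by rewrite inE /vge; case: eqP => // ->; rewrite dval0. Qed.

Lemma vge_add_dom a b : a != 0 -> vge v (v a + 1) b ->
  a + b != 0 /\ v (a + b) = v a.
Proof.
move=> nza Hb.
have [->|nzb] := eqVneq b 0; first by rewrite addr0.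
move: Hb; rewrite vgeE // => Hb.
have nz : a + b != 0.
  rewrite addr_eq0; apply/eqP => E0.
  by move: Hb; rewrite E0 dvalN; lia.
split=> //; have h1 := dvalD nza nzb nz.
have : a + b - b != 0 by rewrite addrK.
by move=> h; have := dvalD nz (_ : - b != 0) h; rewrite addrK dvalN oppr_eq0 => /(_ nzb); lia.
Qed.

(** No cancellation can occur between terms of distinct valuations. *)
Lemma dval_sum_distinct (I : finType) (G : I -> E) :
  (forall i j, G i != 0 -> G j != 0 -> v (G i) = v (G j) -> i = j) ->
  forall i, G i != 0 -> \sum_j G j != 0 /\ v (\sum_j G j) <= v (G i).
Proof.
move=> inj i0 nz0.
have [i nzi imin] :
    exists2 i, G i != 0 & forall j, G j != 0 -> v (G i) <= v (G j).
  by case: (@arg_minP _ _ _ i0 (fun i => G i != 0) (fun i => v (G i)) nz0) => i nzi H; exists i.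
rewrite (bigD1 i) //=.
have /vge_add_dom-/(_ nzi)[-> ->] : vge v (v (G i) + 1) (\sum_(j | j != i) G j).
  apply: vge_sum => j ji; apply/vgeP => nzj.
  rewrite lezD1 lt_neqAle imin // andbT; apply: contra ji => /eqP eqv.
  by apply/eqP; rewrite (inj i j).
by split=> //; exact: imin.
Qed.

End Valuation.

Lemma valuation_comp (E E' : fieldType) (f : {rmorphism E -> E'})
    (v : E' -> int) : valuation v -> valuation (fun z => v (f z)).
Proof.
move=> Hv; split=> [|a b nza nzb|a b nza nzb nz]; first by rewrite rmorph0 (dval0 Hv).
  by rewrite rmorphM (dvalM Hv) ?fmorph_eq0.
by rewrite rmorphD (dvalD Hv) -?rmorphD ?fmorph_eq0.
Qed.

(** * Places *)

Section Place.

Variables (k E : fieldType) (c : k -> E).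

Lemma place_val v : is_place c v -> valuation v.
Proof. by case. Qed.

Lemma place_cst v a : is_place c v -> v (c a) = 0.
Proof. by case. Qed.

Lemma place_unif v : is_place c v -> exists2 t, t != 0 & v t = 1.
Proof. by case. Qed.

Lemma place_attains v m : is_place c v -> exists2 z, z != 0 & v z = m.
Proof.
move=> pv; have vv := place_val pv; have [t nzt vt] := place_unif pv.
case: m => m; first by exists (t ^+ m); rewrite ?expf_neq0 // (dvalX vv) vt mulr1.
exists (t ^+ m.+1)^-1; first by rewrite invr_neq0 ?expf_neq0.
by rewrite (dvalV vv) (dvalX vv) vt mulr1 NegzE.
Qed.

(** Units of the first valuation ring are units of the second, so the two
    valuations are proportional, and both being normalized makes the factor
    [1]. *)
Lemma place_le_eq v v' : is_place c v -> is_place c v' ->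
  (forall z, vge v 0 z -> vge v' 0 z) -> v =1 v'.
Proof.
move=> pv pv' le z; have vv := place_val pv; have vv' := place_val pv'.
have [t nzt vt] := place_unif pv; have [t' nzt' vt'] := place_unif pv'.
have unit0 y : y != 0 -> v y = 0 -> v' y = 0.
  move=> nzy vy; have h1 : vge v 0 y by rewrite vgeE // vy.
  have h2 : vge v 0 y^-1 by rewrite vgeE ?invr_neq0 // dvalV // vy.
  move: (le _ h1) (le _ h2); rewrite !vgeE ?invr_neq0 // dvalV //; lia.
have proportional y : y != 0 -> v' y = v y * v' t.
  move=> nzy; have [h nzh vh] : exists2 h, h != 0 & v h = v y /\ v' h = v y * v' t.
    case: (v y) => m.
      by exists (t ^+ m); rewrite ?expf_neq0 // !dvalX // vt; split; lia.
    exists (t ^+ m.+1)^-1; first by rewrite invr_neq0 ?expf_neq0.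
    by rewrite !dvalV // !dvalX // vt NegzE; split; lia.
  case: vh => vh vh'; have := unit0 (y / h).
  rewrite !dvalM ?invr_neq0 // !dvalV // mulf_neq0 ?invr_neq0 // => /(_ isT); lia.
have t'E := proportional _ nzt'; rewrite vt' in t'E.
have vt0 : vge v' 0 t by apply: le; rewrite vgeE // vt.
rewrite vgeE // in vt0.
have vt0' : 0 < v' t by rewrite lt_neqAle vt0 andbT; apply/eqP => E0; rewrite -E0 mulr0 in t'E.
have vt1 : v' t = 1 by have h : 0 < v t' by [nia]; nia.
have [->|nz] := eqVneq z 0; first by rewrite !dval0.
by rewrite (proportional _ nz) vt1 mulr1.
Qed.

Lemma place_neq_wit v v' : is_place c v -> is_place c v' -> ~ v =1 v' ->
  exists2 z, vge v 0 z & ~~ vge v' 0 z.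
Proof.
move=> pv pv' ne; apply: contrapT => H; apply: ne; apply: place_le_eq => // z Hz.
by apply: contrapT => H'; apply: H; exists z => //; apply/negP.
Qed.

(** Divide by the positive generator of the value group. *)
Lemma normalize_valuation v : valuation v -> (forall a, v (c a) = 0) ->
  (exists2 z, z != 0 & v z != 0) ->
  exists d u, [/\ (0 < d)%N, is_place c u & forall z, v z = d%:Z * u z].
Proof.
move=> vv vc [z0 nz0 vz0].
pose Q d := (0 < d)%N && `[< exists2 z, z != 0 & v z = d%:Z >].
have exQ : exists d, Q d.
  exists `|v z0|%N; apply/andP; split; first by lia.
  apply/asboolP; case: (lerP 0 (v z0)) => h; first by exists z0; lia.
  by exists z0^-1; rewrite ?invr_neq0 // dvalV //; lia.
case: (ex_minnP exQ) => d /andP[d0 /asboolP[t nzt vt]] dmin.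
have dvd z : (v z = (v z %/ d%:Z)%Z * d%:Z).
  have [->|nzz] := eqVneq z 0; first by rewrite dval0 // div0z mul0r.
  have := divz_eq (v z) d; set m := (v z %/ d)%Z => Ediv.
  suff : (v z %% d)%Z = 0 by lia.
  have [r nzr vr] : exists2 r, r != 0 & v r = (v z %% d)%Z.
    have [h nzh vh] : exists2 h, h != 0 & v h = m * d.
      case: m {Ediv} => m; first by exists (t ^+ m); rewrite ?expf_neq0 // dvalX // vt.
      exists (t ^+ m.+1)^-1; first by rewrite invr_neq0 ?expf_neq0.
      by rewrite dvalV // dvalX // vt NegzE; lia.
    exists (z / h); first by rewrite mulf_neq0 ?invr_neq0.
    by rewrite dvalM ?invr_neq0 // dvalV // vh; lia.
  have ge0 : 0 <= (v z %% d)%Z by apply: modz_ge0; lia.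
  have ltd : (v z %% d)%Z < d by apply: ltz_pmod; lia.
  case: (eqVneq (v z %% d)%Z 0) => // ne0.
  have : Q `|(v z %% d)%Z|%N.
    apply/andP; split; first by lia.
    by apply/asboolP; exists r => //; rewrite vr; lia.
  by move/dmin; lia.
exists d, (fun z => (v z %/ d)%Z); split=> //; last by move=> z; rewrite mulrC -dvd.
have d0' : 0 < d%:Z by lia.
split=> [|a b nza nzb|a b nza nzb nz|a|].
- by rewrite dval0 // div0z.
- by apply: (mulIf (_ : d%:Z != 0)); [lia | rewrite mulrDl -!dvd dvalM].
- by have := dvalD vv nza nzb nz; rewrite !ge_min => /orP[] h; apply/orP; [left | right]; rewrite -(ler_pM2r d0') -!dvd.
- by rewrite vc div0z.
- by exists t => //; rewrite vt divzz; lia.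
Qed.

(** Weak approximation. If [y] has a pole at [v] and zeros at the places already
    treated, and [z] has a pole at [v] and a zero at the next one, then
    [y ^+ r * z] does for large [r], unless [y] has a pole at the next place
    too; there the factor [(1 + y ^+ r)^-1] cancels the power of [y]. *)
Lemma place_approx v (I : eqType) (u : I -> E -> int) (s : seq I) : is_place c v ->
  (forall i, i \in s -> is_place c (u i) /\ ~ v =1 u i) ->
  exists2 y, y != 0 /\ v y < 0 & forall i, i \in s -> 0 < u i y.
Proof.
move=> pv; have vv := place_val pv.
elim: s => [|i s IH] H.
  by have [y nzy vy] := place_attains (-1) pv; exists y => //; rewrite vy.
have Hs j : j \in s -> is_place c (u j) /\ ~ v =1 u j.
  by move=> js; apply: H; rewrite inE js orbT.
have [y [nzy vy] Hy] := IH Hs.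
have [pu neu] := H i (mem_head _ _); have vu := place_val pu.
have [z [nzz vz] uz] : exists2 z, z != 0 /\ v z < 0 & 0 < u i z.
  have [a va ua] := place_neq_wit pv pu neu.
  have [b ub vb] := place_neq_wit pu pv (fun E => neu (fun x => esym (E x))).
  have nza : a != 0 by apply: contra ua => /eqP->; apply: vge0.
  have nzb : b != 0 by apply: contra vb => /eqP->; apply: vge0.
  move: va ua ub vb; rewrite !vgeE // => va ua ub vb.
  exists (b / a); first by split; rewrite ?mulf_neq0 ?invr_neq0 // dvalM ?invr_neq0 // dvalV //; lia.
  by rewrite dvalM ?invr_neq0 // dvalV //; lia.
have [r r0 Hr] : exists2 r, (0 < r)%N & forall j, j \in s -> 0 < r%:Z * u j y + u j z.
  elim: s {IH H Hs} Hy => [|j s IH] Hy; first by exists 1%N.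
  have [|r r0 Hr] := IH; first by move=> j' j's; apply: Hy; rewrite inE j's orbT.
  exists (r + `|u j z|)%N; first by lia.
  move=> j'; rewrite inE => /predU1P[->|j's].
    by have := Hy j (mem_head _ _); nia.
  by have := Hr _ j's; have := Hy j'; rewrite inE j's orbT => /(_ isT); nia.
case: (lerP 0 (u i y)) => uy.
  exists (y ^+ r * z).
    by rewrite mulf_neq0 ?expf_neq0 // dvalM ?expf_neq0 // dvalX //; split=> //; nia.
  move=> j; rewrite inE => /predU1P[->|js]; first by rewrite dvalM ?expf_neq0 // dvalX //; nia.
  have vj := place_val (proj1 (Hs _ js)).
  by rewrite dvalM ?expf_neq0 // dvalX //; apply: Hr.
have dom u' : valuation u' -> u' y < 0 -> 1 + y ^+ r != 0 /\ u' (1 + y ^+ r) = r%:Z * u' y.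
  move=> vu' Hu'; rewrite addrC -dvalX //; apply: vge_add_dom; rewrite ?expf_neq0 //.
  by rewrite vgeE ?oner_neq0 // dval1 // dvalX //; nia.
have [nz1 v1] := dom v vv vy; have [_ u1] := dom (u i) vu uy.
exists (y ^+ r * z / (1 + y ^+ r)).
  rewrite !mulf_neq0 ?invr_neq0 ?expf_neq0 // !dvalM ?mulf_neq0 ?invr_neq0 ?expf_neq0 //.
  by rewrite dvalV // v1 dvalX //; split=> //; lia.
move=> j; rewrite inE => /predU1P[->|js].
  by rewrite !dvalM ?mulf_neq0 ?invr_neq0 ?expf_neq0 // dvalV // u1 dvalX //; lia.
have vj := place_val (proj1 (Hs _ js)).
have [_ uj1] : 1 + y ^+ r != 0 /\ u j (1 + y ^+ r) = u j 1.
  apply: vge_add_dom; rewrite ?oner_neq0 // dval1 // vgeE ?expf_neq0 // dvalX //.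
  by have := Hy _ js; nia.
rewrite !dvalM ?mulf_neq0 ?invr_neq0 ?expf_neq0 // dvalV // uj1 dval1 // dvalX //.
by rewrite oppr0 addr0; apply: Hr.
Qed.

End Place.

(** * Places of the rational function field *)

Lemma divf_mulr (E : fieldType) (a b c : E) : c != 0 -> (a * c) / (b * c) = a / b.
Proof. by move=> nz; rewrite -mulf_div divff // mulr1. Qed.

Section RationalPlaces.

Variable k : closedFieldType.
Local Notation K := (ratfun k).
Local Notation "P %:F" := (tofrac P).

Lemma ratfun_repr (f : K) : let r := generic_quotient.repr f in
  \d_r != 0 /\ f = (\n_r)%:F / (\d_r)%:F.
Proof.
set r := generic_quotient.repr f; have nzd := denom_ratioP r; split=> //.
apply: (canRL (mulfK _)); first by rewrite tofrac_eq0.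
rewrite -[f]generic_quotient.reprK -/r -[in LHS](Ratio_numden r) !piE; apply/eqmodP.
rewrite /= FracField.equivfE /FracField.mulf !numden_Ratio ?mulr1 ?oner_eq0 //.
by rewrite mulrC.
Qed.

Lemma ratfun_quot (f : K) : exists P S : {poly k}, S != 0 /\ f = P%:F / S%:F.
Proof. by have H := ratfun_repr f; do 2!eexists; exact: H. Qed.

Section Extension.

Variable nu : {poly k} -> int.
Hypothesis nuM : forall P S : {poly k}, P != 0 -> S != 0 -> nu (P * S) = nu P + nu S.
Hypothesis nuD : forall P S : {poly k}, P != 0 -> S != 0 -> P + S != 0 ->
  Num.min (nu P) (nu S) <= nu (P + S).

(** The value is read off a chosen fraction; by multiplicativity every other
    fraction gives the same. *)
Definition ratfun_ext (f : K) : int :=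
  if f == 0 then 0 else nu (\n_(generic_quotient.repr f)) - nu (\d_(generic_quotient.repr f)).

Lemma ratfun_ext_repr (f : K) : exists n d : {poly k},
  [/\ d != 0, f = n%:F / d%:F & ratfun_ext f = if f == 0 then 0 else nu n - nu d].
Proof.
have [nzd fE] := ratfun_repr f.
by exists (\n_(generic_quotient.repr f)), (\d_(generic_quotient.repr f)).
Qed.

Lemma ratfun_extE (P S : {poly k}) :
  P != 0 -> S != 0 -> ratfun_ext (P%:F / S%:F) = nu P - nu S.
Proof.
move=> nzP nzS; have [n [d [nzd fE ->]]] := ratfun_ext_repr (P%:F / S%:F).
have nzf : P%:F / S%:F != 0 by rewrite mulf_neq0 ?invr_neq0 ?tofrac_eq0.
have nzn : n != 0 by apply: contra nzf => /eqP n0; rewrite fE n0 tofrac0 mul0r.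
have : P * d = n * S.
  by apply/eqP; rewrite -tofrac_eq !tofracM -eqr_div ?tofrac_eq0 //; apply/eqP.
by rewrite (negPf nzf) => /(congr1 nu); rewrite !nuM //; lia.
Qed.

Lemma ratfun_ext_poly (P : {poly k}) : P != 0 -> ratfun_ext P%:F = nu P.
Proof.
have nz1 : (1 : {poly k}) != 0 by exact: oner_neq0.
have n1 : nu 1 = 0 by apply: (addrI (nu 1)); rewrite -nuM // mulr1 addr0.
by move=> nzP; rewrite -[P%:F]divr1 -tofrac1 ratfun_extE // n1 subr0.
Qed.

Lemma ratfun_ext_place : (forall c, c != 0 -> nu c%:P = 0) ->
  (exists2 t, t != 0 & ratfun_ext t = 1) -> is_place (@cst0 k) ratfun_ext.
Proof.
move=> nuC ext1; split=> //; first by rewrite /ratfun_ext eqxx.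
- move=> f g; have [P [S [nzS ->]]] := ratfun_quot f.
  have [P' [S' [nzS' ->]]] := ratfun_quot g.
  rewrite !mulf_eq0 !invr_eq0 !tofrac_eq0 !negb_or => /andP[nzP _] /andP[nzP' _].
  by rewrite mulf_div -!tofracM !ratfun_extE ?mulf_neq0 // !nuM //; lia.
- move=> f g; have [P [S [nzS ->]]] := ratfun_quot f.
  have [P' [S' [nzS' ->]]] := ratfun_quot g.
  rewrite !mulf_eq0 !invr_eq0 !tofrac_eq0 !negb_or => /andP[nzP _] /andP[nzP' _].
  rewrite addf_div ?tofrac_eq0 // -!tofracM -tofracD.
  rewrite mulf_eq0 invr_eq0 !tofrac_eq0 negb_or => /andP[nz _].
  rewrite !ratfun_extE ?mulf_neq0 //.
  have h := nuD (mulf_neq0 nzP nzS') (mulf_neq0 nzP' nzS) nz.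
  apply: le_trans (lerB h (lexx (nu (S * S')))); rewrite !nuM //; lia.
- move=> a; rewrite /cst0; have [->|nza] := eqVneq a 0.
    by rewrite /ratfun_ext tofrac0 eqxx.
  by rewrite ratfun_ext_poly ?polyC_eq0 // nuC.
Qed.

End Extension.

Definition finite_place (a : k) : K -> int := ratfun_ext (fun P => (mup a P)%:Z).
Definition infinite_place : K -> int := ratfun_ext (fun P => - (size P).-1%:Z).

Definition linear (a : k) : K := ('X - a%:P)%:F.

Lemma linear_neq0 a : linear a != 0.
Proof. by rewrite tofrac_eq0 polyXsubC_eq0. Qed.

Lemma mup_valM a (P S : {poly k}) : P != 0 -> S != 0 ->
  (mup a (P * S))%:Z = (mup a P)%:Z + (mup a S)%:Z.
Proof. by move=> nzP nzS; rewrite mupM. Qed.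

Lemma finite_placeE a (P S : {poly k}) : P != 0 -> S != 0 ->
  finite_place a (P%:F / S%:F) = (mup a P)%:Z - (mup a S)%:Z.
Proof. by move=> nzP nzS; apply: ratfun_extE => // *; apply: mup_valM. Qed.

Lemma finite_place_poly a (P : {poly k}) : P != 0 -> finite_place a P%:F = (mup a P)%:Z.
Proof. by move=> nzP; apply: (@ratfun_ext_poly (fun P => (mup a P)%:Z)) => // *; apply: mup_valM. Qed.

Lemma poly_size_gt0 (P : {poly k}) : P != 0 -> (0 < size P)%N.
Proof. by rewrite size_poly_gt0. Qed.

Lemma size_valM (P S : {poly k}) : P != 0 -> S != 0 ->
  - (size (P * S)).-1%:Z = - (size P).-1%:Z + - (size S).-1%:Z.
Proof.
move=> nzP nzS; have -> : size (P * S) = (size P + size S).-1 by exact: size_mul.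
by have := poly_size_gt0 nzP; have := poly_size_gt0 nzS; lia.
Qed.

Lemma infinite_placeE (P S : {poly k}) : P != 0 -> S != 0 ->
  infinite_place (P%:F / S%:F) = (size S)%:Z - (size P)%:Z.
Proof.
move=> nzP nzS; rewrite /infinite_place ratfun_extE //; last exact: size_valM.
by have := poly_size_gt0 nzP; have := poly_size_gt0 nzS; lia.
Qed.

Lemma infinite_place_poly (P : {poly k}) : P != 0 -> infinite_place P%:F = - (size P).-1%:Z.
Proof. by move=> nzP; apply: (@ratfun_ext_poly (fun P => - (size P).-1%:Z)) => // *; apply: size_valM. Qed.

Lemma finite_place_linear a b : finite_place a (linear b) = (b == a)%:Z.
Proof.
rewrite finite_place_poly ?polyXsubC_eq0 // -['X - b%:P]expr1 mup_XsubCX.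
by case: eqP.
Qed.

Lemma infinite_place_linear b : infinite_place (linear b) = -1.
Proof. by rewrite infinite_place_poly ?polyXsubC_eq0 // size_XsubC. Qed.

Lemma finite_place_place a : is_place (@cst0 k) (finite_place a).
Proof.
apply: ratfun_ext_place => [P S|P S|c nzc|]; first exact: mup_valM.
- move=> nzP nzS nz; set m := minn (mup a P) (mup a S).
  have : (m <= mup a (P + S))%N.
    by rewrite mup_geq // dvdp_add // -mup_geq // /m; lia.
  by rewrite /m; lia.
- by rewrite mupNroot // rootC.
- by exists (linear a); [exact: linear_neq0 | rewrite -/(finite_place a) finite_place_linear eqxx].
Qed.

Lemma infinite_place_place : is_place (@cst0 k) infinite_place.
Proof.
apply: ratfun_ext_place => [P S|P S|c nzc|]; first exact: size_valM.
- move=> nzP nzS nz; have := size_polyD P S.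
  by have := poly_size_gt0 nzP; have := poly_size_gt0 nzS; have := poly_size_gt0 nz; lia.
- by rewrite size_polyC nzc.
- exists (linear 0)^-1; first by rewrite invr_neq0 ?linear_neq0.
  rewrite -/infinite_place /linear -[_^-1]mul1r -tofrac1 infinite_placeE ?polyXsubC_eq0 ?oner_eq0 //.
  by rewrite size_XsubC size_poly1.
Qed.

Lemma linear_factors (P : {poly k}) : P != 0 ->
  exists2 rs : seq k, P%:F = cst0 (lead_coef P) * \prod_(z <- rs) linear z
    & forall a, mup a P = count_mem a rs.
Proof.
move=> nzP; have [rs PE] := closed_field_poly_normal P; exists rs.
  by rewrite {1}PE -mul_polyC tofracM rmorph_prod.
move=> a; rewrite PE -mul_polyC mupMr ?mu_prod_XsubC //.
by rewrite rootC lead_coef_eq0.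
Qed.

Section Place.

Variable q : K -> int.
Hypothesis pq : is_place (@cst0 k) q.
Let vq := place_val pq.

Lemma cst0_neq0 a : a != 0 -> @cst0 k a != 0.
Proof. by rewrite tofrac_eq0 polyC_eq0. Qed.

Lemma vge_cst0 a : vge q 0 (cst0 a).
Proof. by rewrite /vge (place_cst a pq) lexx orbT. Qed.

Lemma vge_poly (P : {poly k}) : vge q 0 'X%:F -> vge q 0 P%:F.
Proof.
move=> HX; elim/poly_ind: P => [|P c IH]; first by rewrite tofrac0 vge0.
rewrite tofracD tofracM; apply: (vgeD vq); last exact: vge_cst0.
by rewrite -[0](addr0 0); apply: (vgeM vq).
Qed.

Lemma vge_linear a : vge q 0 'X%:F -> vge q 0 (linear a).
Proof. exact: vge_poly. Qed.

Lemma place_nonroot a (P : {poly k}) : 0 < q (linear a) -> vge q 0 'X%:F -> ~~ root P a ->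
  q P%:F = 0.
Proof.
move=> qa HX nr; have := dvdp_XsubCl (P - P.[a]%:P) a; rewrite /root !hornerE subrr eqxx.
case/dvdpP => T PE.
have -> : P%:F = cst0 P.[a] + T%:F * linear a by rewrite -tofracM -PE tofracB addrC subrK.
have nzc : @cst0 k P.[a] != 0 by apply: cst0_neq0.
have [] := @vge_add_dom _ _ vq (cst0 P.[a]) (T%:F * linear a) nzc; last first.
  by move=> _ ->; rewrite (place_cst _ pq).
rewrite (place_cst _ pq) add0r -[1]add0r; apply: (vgeM vq); first exact: vge_poly.
by rewrite vgeE ?linear_neq0.
Qed.

(** A place that is positive at [x - a] sees a polynomial only through its
    multiplicity at [a]. *)
Lemma place_factor a (P : {poly k}) : P != 0 -> 0 < q (linear a) -> vge q 0 'X%:F ->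
  q P%:F = (mup a P)%:Z * q (linear a).
Proof.
move=> nzP qa HX; have [m [T nr PE]] := multiplicity_XsubC P a.
rewrite nzP /= in nr; have nzT : T != 0 by apply: contraNneq nzP => T0; rewrite PE T0 mul0r.
have -> : mup a P = m by rewrite PE mupMr // mup_XsubCX eqxx.
rewrite PE tofracM tofracXn (dvalM vq) ?expf_neq0 ?linear_neq0 ?tofrac_eq0 //.
by rewrite (dvalX vq) (place_nonroot qa HX nr) add0r.
Qed.

(** At a pole of [x] the leading term dominates. *)
Lemma place_degree (P : {poly k}) : P != 0 -> q 'X%:F < 0 -> q P%:F = (size P).-1%:Z * q 'X%:F.
Proof.
move=> + qX; have nzX : ('X%:F : K) != 0 by rewrite tofrac_eq0 polyX_eq0.
elim/poly_ind: P => [|P c IH]; first by rewrite eqxx.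
have [->|nzP] := eqVneq P 0.
  rewrite mul0r add0r => nzc; rewrite (_ : q _ = 0) ?(place_cst c pq) //.
  by rewrite size_polyC; case: (c != 0); rewrite mul0r.
move=> _; rewrite size_MXaddC (negPf nzP) /= tofracD tofracM.
have [] := @vge_add_dom _ _ vq (P%:F * 'X%:F) (cst0 c).
- by apply: mulf_neq0; rewrite tofrac_eq0 ?polyX_eq0.
- have [->|nzc] := eqVneq c 0; first by rewrite /cst0 tofrac0 vge0.
  rewrite (vgeE _ _ (cst0_neq0 nzc)) (place_cst c pq) (dvalM vq) ?tofrac_eq0 ?polyX_eq0 // IH //.
  by have := poly_size_gt0 nzP; nia.
move=> _ ->; rewrite (dvalM vq) ?tofrac_eq0 ?polyX_eq0 // IH //.
by rewrite -[in RHS](prednK (poly_size_gt0 nzP)) intS mulrDl mul1r addrC.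
Qed.

(** The places of [k(x)] are the points of the projective line: where [x] is
    integral, some linear polynomial must vanish, since polynomials split. *)
Lemma place_cases : q =1 infinite_place \/ exists a, q =1 finite_place a.
Proof.
have nzX : ('X%:F : K) != 0 by rewrite tofrac_eq0 polyX_eq0.
case: (boolP (vge q 0 'X%:F)) => HX; last first.
  left=> z; apply/esym; move: z; apply: (place_le_eq infinite_place_place pq) => f.
  have [P [S [nzS ->]]] := ratfun_quot f.
  have [->|nzP] := eqVneq P 0; first by rewrite tofrac0 mul0r !vge0.
  have nz : P%:F / S%:F != 0 by rewrite mulf_neq0 ?invr_neq0 ?tofrac_eq0.
  move: HX; rewrite vgeN_lt => /andP[_ HX].
  rewrite !(@vgeE _ _ _ _ nz) infinite_placeE // (dvalM vq) ?invr_neq0 ?tofrac_eq0 // (dvalV vq).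
  rewrite (place_degree nzP HX) (place_degree nzS HX).
  by have := poly_size_gt0 nzP; have := poly_size_gt0 nzS; nia.
right; have [t nzt qt] := place_unif pq.
have [P nzP qP] : exists2 P : {poly k}, P != 0 & q P%:F != 0.
  have [P [S [nzS tE]]] := ratfun_quot t.
  have nzP : P != 0 by apply: contraNneq nzt => P0; rewrite tE P0 tofrac0 mul0r.
  move: qt; rewrite tE (dvalM vq) ?invr_neq0 ?tofrac_eq0 // (dvalV vq) => qt.
  have [q0|] := eqVneq (q P%:F) 0; last by exists P.
  by exists S => //; apply/eqP; lia.
have [a qa] : exists a, 0 < q (linear a).
  apply: contrapT => H; case/eqP: qP.
  have qlin a : q (linear a) = 0.
    have := vge_linear a HX; rewrite vgeE ?linear_neq0 // => h.
    apply/eqP; rewrite eq_le h andbT leNgt; apply/negP => ?; apply: H.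
    by exists a.
  have [rs PE _] := linear_factors nzP.
  have nzl : @cst0 k (lead_coef P) != 0 by apply: cst0_neq0; rewrite lead_coef_eq0.
  have nzp : \prod_(z <- rs) linear z != 0.
    by rewrite prodf_seq_neq0; apply/allP => z _; apply: linear_neq0.
  rewrite PE (dvalM vq nzl nzp) (place_cst (lead_coef P) pq) add0r (dval_prod vq).
    by apply: big1 => z _; apply: qlin.
  by move=> z _; apply: linear_neq0.
exists a => z; apply/esym; move: z.
apply: (place_le_eq (finite_place_place a) pq) => f.
have [P' [S [nzS ->]]] := ratfun_quot f.
have [->|nzP'] := eqVneq P' 0; first by rewrite tofrac0 mul0r !vge0.
have nz : P'%:F / S%:F != 0 by rewrite mulf_neq0 ?invr_neq0 ?tofrac_eq0.
rewrite !(@vgeE _ _ _ _ nz) finite_placeE // (dvalM vq) ?invr_neq0 ?tofrac_eq0 // (dvalV vq).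
by rewrite (place_factor nzP' qa HX) (place_factor nzS qa HX); nia.
Qed.

End Place.

(** On the projective line every divisor of degree zero is principal: [h] has
    divisor [q1 - q2]. *)
Lemma place_sep q1 q2 : is_place (@cst0 k) q1 -> is_place (@cst0 k) q2 ->
  ~ q1 =1 q2 -> exists h, [/\ h != 0, q1 h = 1, q2 h = -1
    & forall q, is_place (@cst0 k) q -> ~ q =1 q1 -> ~ q =1 q2 -> q h = 0].
Proof.
move=> p1 p2 ne.
have [E1|[a E1]] := place_cases p1; have [E2|[b E2]] := place_cases p2.
- by case: ne => z; rewrite E1 E2.
- exists (linear b)^-1; have v1 := place_val p1; have v2 := place_val p2.
  split; first by rewrite invr_neq0 ?linear_neq0.
  + by rewrite (dvalV v1) E1 infinite_place_linear.
  + by rewrite (dvalV v2) E2 finite_place_linear eqxx.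
  move=> q pq n1 n2; rewrite (dvalV (place_val pq)).
  have [E|[c E]] := place_cases pq; first by case: n1 => z; rewrite E E1.
  rewrite E finite_place_linear; case: eqP => // bc.
  by case: n2 => z; rewrite E E2 bc.
- exists (linear a); split; first exact: linear_neq0.
  + by rewrite E1 finite_place_linear eqxx.
  + by rewrite E2 infinite_place_linear.
  move=> q pq n1 n2; have [E|[c E]] := place_cases pq; first by case: n2 => z; rewrite E E2.
  rewrite E finite_place_linear; case: eqP => // bc.
  by case: n1 => z; rewrite E E1 bc.
- have nab : a != b by apply/eqP => ab; case: ne => z; rewrite E1 E2 ab.
  exists (linear a / linear b); split; first by rewrite mulf_neq0 ?invr_neq0 ?linear_neq0.
  + rewrite (dvalM (place_val p1)) ?invr_neq0 ?linear_neq0 // (dvalV (place_val p1)) !E1.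
    by rewrite !finite_place_linear eqxx eq_sym (negPf nab).
  + rewrite (dvalM (place_val p2)) ?invr_neq0 ?linear_neq0 // (dvalV (place_val p2)) !E2.
    by rewrite !finite_place_linear eqxx (negPf nab).
  move=> q pq n1 n2.
  rewrite (dvalM (place_val pq)) ?invr_neq0 ?linear_neq0 // (dvalV (place_val pq)).
  have [E|[c E]] := place_cases pq; first by rewrite !E !infinite_place_linear.
  rewrite !E !finite_place_linear; case: eqP => [ac|_].
    by case: n1 => z; rewrite E E1 ac.
  by case: eqP => // bc; case: n2 => z; rewrite E E2 bc.
Qed.

Lemma mup_dvdp (P S : {poly k}) : P != 0 -> S != 0 ->
  (forall a, mup a S <= mup a P)%N -> S %| P.
Proof.
move=> nzP nzS le; have [rs SE] := closed_field_poly_normal S.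
have lS : lead_coef S != 0 by rewrite lead_coef_eq0.
have {}le a : (count_mem a rs <= mup a P)%N.
  by have := le a; rewrite {1}SE -mul_polyC mupMr ?mu_prod_XsubC // rootC.
rewrite SE dvdpZl //; elim: rs P nzP le {SE} => [|z rs IH] P nzP le.
  by rewrite big_nil dvd1p.
have : 'X - z%:P %| P by rewrite XsubC_dvd //; have := le z; rewrite /= eqxx; lia.
case/dvdpP => T PE; have nzT : T != 0 by apply: contraNneq nzP => T0; rewrite PE T0 mul0r.
rewrite big_cons PE mulrC dvdp_mul2r ?polyXsubC_eq0 //; apply: IH => // a.
have := le a; rewrite PE mupM ?polyXsubC_eq0 // -['X - _]expr1 mup_XsubCX /=.
by rewrite eq_sym; case: eqP => /=; lia.
Qed.

(** The finite places force the denominator to divide the numerator, and the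
    infinite one bounds the degree of the quotient. *)
Lemma regular_const (f : K) :
  (forall q, is_place (@cst0 k) q -> vge q 0 f) -> exists c, f = cst0 c.
Proof.
have [P [S [nzS ->]]] := ratfun_quot f.
have [->|nzP] := eqVneq P 0 => reg; first by exists 0; rewrite /cst0 tofrac0 mul0r.
have nz : P%:F / S%:F != 0 by rewrite mulf_neq0 ?invr_neq0 ?tofrac_eq0.
have /dvdpP[T PE] : S %| P.
  apply: mup_dvdp => // a; have := reg _ (finite_place_place a).
  by rewrite (@vgeE _ _ _ _ nz) finite_placeE //; lia.
have := reg _ infinite_place_place; rewrite (@vgeE _ _ _ _ nz) infinite_placeE //.
have nzT : T != 0 by apply: contraNneq nzP => T0; rewrite PE T0 mul0r.
move=> le; have /size1_polyC TE : (size T <= 1)%N.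
  by have sE : size (T * S) = (size T + size S).-1 by [exact: size_mul]; move: le; rewrite PE sE; have := poly_size_gt0 nzT; have := poly_size_gt0 nzS; lia.
by exists T`_0; rewrite /cst0 -TE PE tofracM mulfK ?tofrac_eq0.
Qed.

Lemma regular_vanishing q0 (f : K) : is_place (@cst0 k) q0 ->
  (forall q, is_place (@cst0 k) q -> ~ q =1 q0 -> vge q 0 f) -> vge q0 1 f -> f = 0.
Proof.
move=> p0 reg f1; have [c fE] : exists c, f = cst0 c.
  apply: regular_const => q pq; have [E|] := pselect (q =1 q0); last exact: reg.
  by apply: vge_le (_ : vge q 1 f) => //; rewrite (funext E).
by move/vgeP: f1 => f1; apply: contrapT => /eqP/f1; rewrite fE (place_cst _ p0).
Qed.

(** Every function is a quotient of functions that are regular away from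
    [q0]. The denominator [S] of [f] serves when [q0] is at infinity; elsewhere
    a power of [linear b] moves its poles from infinity to [q0]. *)
Lemma place_denominator q0 (f : K) : is_place (@cst0 k) q0 ->
  exists2 a, a != 0 & forall q, is_place (@cst0 k) q -> ~ q =1 q0 ->
    vge q 0 a /\ vge q 0 (a * f).
Proof.
move=> p0; have [P [S [nzS ->]]] := ratfun_quot f.
have regP q (T : {poly k}) : is_place (@cst0 k) q -> ~ q =1 infinite_place -> vge q 0 T%:F.
  move=> pq nq; have [//|[b E]] := place_cases pq.
  have [->|nzT] := eqVneq T 0; first by rewrite tofrac0 vge0.
  by rewrite vgeE ?tofrac_eq0 // E finite_place_poly.
have [E0|[b E0]] := place_cases p0.
  exists S%:F => [|q pq nq]; first by rewrite tofrac_eq0.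
  have nq' : ~ q =1 infinite_place by move=> E; apply: nq => z; rewrite E E0.
  by rewrite mulrC divfK ?tofrac_eq0 //; split; apply: regP.
pose D := (size P + size S)%N.
have reg (T : {poly k}) : (size T <= D.+1)%N -> forall q, is_place (@cst0 k) q -> ~ q =1 q0 ->
    vge q 0 (T%:F / linear b ^+ D).
  move=> sT q pq nq; have [->|nzT] := eqVneq T 0; first by rewrite tofrac0 mul0r vge0.
  rewrite vgeE ?mulf_neq0 ?invr_neq0 ?expf_neq0 ?linear_neq0 ?tofrac_eq0 //.
  have vq := place_val pq.
  rewrite (dvalM vq) ?invr_neq0 ?expf_neq0 ?linear_neq0 ?tofrac_eq0 // (dvalV vq) (dvalX vq).
  have [E|[c E]] := place_cases pq.
    by rewrite !E infinite_place_linear infinite_place_poly //; lia.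
  rewrite !E finite_place_linear finite_place_poly //.
  by case: eqP => [bc|]; [case: nq => z; rewrite E E0 bc | lia].
exists (S%:F / linear b ^+ D) => [|q pq nq].
  by rewrite mulf_neq0 ?invr_neq0 ?expf_neq0 ?linear_neq0 ?tofrac_eq0.
split; first by apply: reg => //; rewrite /D; lia.
have -> : S%:F / linear b ^+ D * (P%:F / S%:F) = P%:F / linear b ^+ D.
  by rewrite mulrC mulrA divfK ?tofrac_eq0.
by apply: reg => //; rewrite /D; lia.
Qed.

(** At infinity the residue is the ratio of the leading coefficients; at a finite
    place, the ratio of the values once common linear factors are cancelled. *)
Lemma place_residue0 q (f : K) : is_place (@cst0 k) q -> vge q 0 f ->
  exists c, vge q 1 (f - cst0 c).
Proof.
move=> pq f0; have vq := place_val pq.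
case: (boolP (vge q 1 f)) => [f1|]; first by exists 0; rewrite /cst0 tofrac0 subr0.
have [->|nzf] := eqVneq f 0; first by rewrite vge0.
rewrite vgeE // => f1; rewrite vgeE // in f0; have {f1} qf : q f = 0 by lia.
have [P [S [nzS fE]]] := ratfun_quot f.
have nzP : P != 0 by apply: contraNneq nzf => P0; rewrite fE P0 tofrac0 mul0r.
have main (c : k) (P' S' : {poly k}) : P' != 0 -> S' != 0 -> f = P'%:F / S'%:F ->
    (P' - c *: S' != 0 -> 0 < q (P' - c *: S')%:F - q S'%:F) -> vge q 1 (f - cst0 c).
  move=> nzP' nzS' ->; have -> : P'%:F / S'%:F - cst0 c = (P' - c *: S')%:F / S'%:F.
    by rewrite tofracB -mul_polyC tofracM mulrBl mulfK ?tofrac_eq0.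
  have [->|nz] := eqVneq (P' - c *: S') 0; first by rewrite tofrac0 mul0r vge0.
  move=> /(_ isT) lt; rewrite vgeE ?mulf_neq0 ?invr_neq0 ?tofrac_eq0 //.
  by rewrite (dvalM vq) ?invr_neq0 ?tofrac_eq0 // (dvalV vq).
have [E|[a E]] := place_cases pq.
  have sz := qf; rewrite E fE infinite_placeE // in sz; exists (lead_coef P / lead_coef S).
  apply: (main _ P S) => // nz; rewrite !E !infinite_place_poly //.
  have sE : size S = size P by lia.
  have : (size (P - (lead_coef P / lead_coef S) *: S)%R < size P)%N.
    rewrite (leq_ltn_trans (n := (size P).-1)) ?prednK ?size_poly_gt0 //.
    apply/leq_sizeP => j; rewrite leq_eqVlt => /predU1P[<-|lt].
      rewrite coefB coefZ {2}/lead_coef -sE -/(lead_coef S) sE -/(lead_coef P).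
      by rewrite divfK ?subrr ?lead_coef_eq0.
    have lt' : (size P <= j)%N by rewrite -(prednK (poly_size_gt0 nzP)).
    by rewrite coefB coefZ !nth_default ?sE ?mulr0 ?subr0.
  have := poly_size_gt0 nz; rewrite sE; set D : {poly k} := (P - _)%R; clearbody D.
  by have := poly_size_gt0 nzP; lia.
have [m [P' nrP PE]] := multiplicity_XsubC P a; rewrite nzP /= in nrP.
have [m' [S' nrS SE]] := multiplicity_XsubC S a; rewrite nzS /= in nrS.
have nzP' : P' != 0 by apply: contraNneq nzP => T0; rewrite PE T0 mul0r.
have nzS' : S' != 0 by apply: contraNneq nzS => T0; rewrite SE T0 mul0r.
have mm := qf; rewrite E fE finite_placeE // PE SE !mupMr // !mup_XsubCX eqxx in mm.
exists (P'.[a] / S'.[a]); apply: (main _ P' S') => // [|nz].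
  rewrite fE PE SE (_ : m' = m); last by lia.
  rewrite !tofracM; apply: divf_mulr; rewrite tofrac_eq0 expf_neq0 //.
  by rewrite polyXsubC_eq0.
rewrite !E !finite_place_poly // [mup a S']mupNroot // subr0 ltz_nat -XsubC_dvd //.
by rewrite dvdp_XsubCl /root !hornerE divfK ?subrr.
Qed.

End RationalPlaces.

(** * Extension of places *)

Section PlaceExtension.

Variables (k K : fieldType) (c0 : k -> K) (F : fieldExtType K) (q : K -> int).
Hypothesis pq : is_place c0 q.
Let vq := place_val pq.

Variable pi : K.
Hypotheses (nzpi : pi != 0) (qpi : q pi = 1).

(** A maximal subring of [F] among those that contain the valuation ring of [q]
    and in which the uniformizer [pi] stays noninvertible is a valuation ring;
    Zorn's lemma provides it. *)
Definition dominating (V : F -> Prop) : Prop :=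
  [/\ V 1, forall a b, V a -> V b -> V (a - b), forall a b, V a -> V b -> V (a * b),
      forall f, vge q 0 f -> V f%:A & ~ V (pi^-1)%:A].

Lemma dominating_exists : dominating (fun z => exists2 f, vge q 0 f & z = f%:A).
Proof.
split.
- by exists 1; rewrite ?scale1r // vgeE ?oner_eq0 // dval1.
- move=> _ _ [f f0 ->] [g g0 ->]; exists (f - g); first exact: vgeB.
  by rewrite scalerBl.
- move=> _ _ [f f0 ->] [g g0 ->]; exists (f * g).
    by rewrite -[0](addr0 0) vgeM.
  by rewrite -scalerAl mul1r scalerA.
- by move=> f f0; exists f.
- case=> f f0 /(@fmorph_inj _ _ (in_alg F)) E; move: f0; rewrite -E vgeE ?invr_neq0 // dvalV // qpi; lia.
Qed.

Lemma dominating_max : exists2 V, dominating V &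
  forall W : F -> Prop, dominating W -> (forall z, V z -> W z) -> forall z, W z -> V z.
Proof.
pose P (V : set F) := dominating V \/ V = set0.
have [C CP tot|V [PV Vmax]] := @Zorn_bigcup F P.
  case: (pselect (exists2 X, C X & dominating X)) => [[X0 CX0 dX0]|none]; last first.
    right; rewrite -subset0 => z [X CX Xz]; case: (CP _ CX) => [dX|X0].
      by case: none; exists X.
    by move: Xz; rewrite X0.
  have dC X z : C X -> X z -> dominating X.
    by move=> /CP[//|->].
  left; case: (dX0) => X1 _ _ Xq _; split.
  - by exists X0.
  - move=> a b [X CX Xa] [Y CY Yb]; have [le|le] := tot _ _ CX CY.
      by exists Y => //; case: (dC _ _ CY Yb) => _ + _ _ _; apply=> //; apply: le.
    by exists X => //; case: (dC _ _ CX Xa) => _ + _ _ _; apply=> //; apply: le.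
  - move=> a b [X CX Xa] [Y CY Yb]; have [le|le] := tot _ _ CX CY.
      by exists Y => //; case: (dC _ _ CY Yb) => _ _ + _ _; apply=> //; apply: le.
    by exists X => //; case: (dC _ _ CX Xa) => _ _ + _ _; apply=> //; apply: le.
  - by move=> f f0; exists X0 => //; apply: Xq.
  - by case=> X CX Xpi; case: (dC _ _ CX Xpi) => _ _ _ _; apply.
have dV : dominating V.
  case: PV => // V0; have := Vmax _ _ (or_introl dominating_exists).
  case; rewrite V0; split => // /(_ 1); apply.
  by case: dominating_exists.
exists V => // W dW le z Wz; apply: contrapT => nVz.
by apply: (Vmax W _ (or_introl dW)); split=> // le'; apply: nVz; apply: le'.
Qed.

Section MaximalDominating.

Variable V : F -> Prop.
Hypothesis domV : dominating V.
Hypothesis maxV : forall W : F -> Prop,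
  dominating W -> (forall z, V z -> W z) -> forall z, W z -> V z.

Let V1 : V 1. Proof. by case: domV. Qed.
Let VB a b : V a -> V b -> V (a - b). Proof. by case: domV => _ + _ _ _; apply. Qed.
Let VM a b : V a -> V b -> V (a * b). Proof. by case: domV => _ _ + _ _; apply. Qed.
Let Vq f : vge q 0 f -> V f%:A. Proof. by case: domV => _ _ _ + _; apply. Qed.
Let nVpi : ~ V (pi^-1)%:A. Proof. by case: domV. Qed.
Let V0 : V 0. Proof. by rewrite -(subrr 1); apply: VB. Qed.
Let VD a b : V a -> V b -> V (a + b).
Proof. by move=> Va Vb; rewrite -[b]opprK; apply: VB => //; rewrite -sub0r; apply: VB. Qed.
Let VX a n : V a -> V (a ^+ n).
Proof. by move=> Va; elim: n => [|n IH]; rewrite ?expr0 // exprS; apply: VM. Qed.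
Let Vsum (I : Type) (r : seq I) (Q : pred I) (G : I -> F) :
  (forall i, Q i -> V (G i)) -> V (\sum_(i <- r | Q i) G i).
Proof. by move=> H; apply: big_ind. Qed.

Local Notation varpi := (pi%:A : F).

Let nzvarpi : varpi != 0. Proof. by rewrite scaler_eq0 oner_eq0 orbF. Qed.
Let Vvarpi : V varpi. Proof. by apply: Vq; rewrite vgeE // qpi. Qed.
Let nVvarpi : ~ V varpi^-1.
Proof. by move=> H; apply: nVpi; rewrite -[_%:A]/(in_alg F _) fmorphV. Qed.

(** By maximality, adjoining a new element to [V] makes [varpi] invertible. *)
Lemma adjoin_dominating f : ~ V f ->
  exists2 p : {poly F}, forall i, V p`_i & p.[f] = varpi^-1.
Proof.
move=> nVf; pose W z := exists2 p : {poly F}, forall i, V p`_i & z = p.[f].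
apply: contrapT => H; apply: nVf.
have VC a : V a -> forall i, V (a%:P)`_i by move=> Va i; rewrite coefC; case: eqP.
apply: (maxV (W := W)).
- split.
  + by exists 1%:P; [apply: VC | rewrite hornerC].
  + move=> _ _ [p Vp ->] [r Vr ->]; exists (p - r) => [i|]; first by rewrite coefB; apply: VB.
    by rewrite hornerD hornerN.
  + move=> _ _ [p Vp ->] [r Vr ->]; exists (p * r) => [i|]; last by rewrite hornerM.
    by rewrite coefM; apply: Vsum => j _; apply: VM.
  + by move=> a a0; exists (a%:A)%:P; [apply: VC; apply: Vq | rewrite hornerC].
  + case=> p Vp pE; apply: H; exists p => //.
    by rewrite -pE -[_%:A]/(in_alg F _) fmorphV.
- by move=> z Vz; exists z%:P; [apply: VC | rewrite hornerC].
- by exists 'X => [i|]; rewrite ?hornerX // coefX; case: (_ == _).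
Qed.

(** The maximal ring is local: [varpi] lies in every maximal ideal. Indeed if
    the inverse of [u] were missing from [V], a polynomial in it would equal the
    inverse of [varpi], and clearing denominators would make a power of [u],
    which is [1] modulo [varpi], divisible by [varpi]. *)
Lemma dominating_unit a : V a -> V (1 - varpi * a)^-1 /\ 1 - varpi * a != 0.
Proof.
move=> Va; set u := 1 - varpi * a.
have Vu : V u by apply: VB => //; apply: VM.
have nzu : u != 0.
  apply/eqP => /eqP; rewrite subr_eq0 => /eqP E; apply: nVvarpi.
  by have <- : a = varpi^-1 by apply: (mulfI nzvarpi); rewrite mulfV.
split=> //; apply: contrapT => /adjoin_dominating[p Vp pE].
have uX n : exists2 a', V a' & u ^+ n = 1 - varpi * a'.
  elim: n => [|n [a' Va' IH]]; first by exists 0; rewrite ?expr0 ?mulr0 ?subr0.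
  exists (a + a' * u); first by apply: VD => //; apply: VM.
  by rewrite exprSr IH /u; ring.
have [a' Va' uE] := uX (size p).
pose z := \sum_(i < size p) p`_i * u ^+ (size p - i).
have Vz : V z by apply: Vsum => i _; apply: VM => //; apply: VX.
have zE : varpi * z = u ^+ size p.
  have -> : z = p.[u^-1] * u ^+ size p.
    rewrite horner_coef mulr_suml; apply: eq_bigr => i _.
    rewrite exprVn -mulrA; congr (_ * _).
    rewrite (_ : u ^+ size p = u ^+ i * u ^+ (size p - i)) ?mulKf ?expf_neq0 //.
    by rewrite -exprD subnKC // ltnW.
  by rewrite pE mulrA divff // mul1r.
apply: nVvarpi; have E1 : varpi * (z + a') = 1 by rewrite mulrDr zE uE subrK.
have <- : z + a' = varpi^-1 by apply: (mulfI nzvarpi); rewrite mulfV.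
exact: VD.
Qed.

(** If both [f] and its inverse make [varpi] invertible, the relation for the
    inverse, multiplied by [varpi * f ^+ n], expresses [f ^+ n] by lower powers of
    [f], its coefficient being a unit of [V] by [dominating_unit]; so the first
    relation can be shortened. *)
Lemma dominating_reduce n (p r : {poly F}) f : f != 0 ->
  (forall i, V p`_i) -> (forall i, V r`_i) -> p.[f] = varpi^-1 -> r.[f^-1] = varpi^-1 ->
  (size p <= n.+1)%N -> (size r <= n.+1)%N ->
  exists2 p' : {poly F}, forall i, V p'`_i & p'.[f] = varpi^-1 /\ (size p' <= n)%N.
Proof.
move=> nzf Vp Vr pE rE sp sr; have [Vu nzu] := dominating_unit (Vr 0%N).
set u := 1 - _ in Vu nzu.
exists (\poly_(i < n) (p`_i + p`_n * varpi * u^-1 * r`_(n - i))) => [i|].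
  by rewrite coef_poly; case: ifP => // _; apply: VD => //; do !apply: VM.
split; last exact: size_poly.
have rsum : \sum_(i < n) r`_(n - i) * f ^+ i = f ^+ n * (u / varpi).
  have : r.[f^-1] * f ^+ n = \sum_(i < n.+1) r`_(n - i) * f ^+ i.
    rewrite (horner_coef_wide _ sr) mulr_suml (reindex_inj rev_ord_inj) /=.
    apply: eq_bigr => i _; rewrite subSS exprVn -mulrA; congr (_ * _).
    have le : (i <= n)%N by have := ltn_ord i; lia.
    rewrite (_ : f ^+ n = f ^+ (n - i) * f ^+ i) ?mulKf ?expf_neq0 //.
    by rewrite -exprD subnK.
  rewrite big_ord_recr /= subnn rE => E; apply: (addIr (r`_0 * f ^+ n)).
  by rewrite -E /u mulrBl mul1r (mulrC varpi) mulfK // mulrBr (mulrC _ (f ^+ n)) (mulrC r`_0) subrK.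
rewrite horner_poly -pE (horner_coef_wide _ sp) big_ord_recr /=.
rewrite -[p`_n * f ^+ n](_ : p`_n * varpi * u^-1 * (f ^+ n * (u / varpi)) = _); last first.
  by rewrite -!mulrA (mulrCA u^-1) (mulrA u^-1) mulVf // mul1r (mulrCA varpi) mulfV // mulr1.
rewrite -rsum mulr_sumr -big_split /=; apply: eq_bigr => i _.
by rewrite mulrDl !mulrA.
Qed.

Lemma dominating_total f : V f \/ V f^-1.
Proof.
have [->|nzf] := eqVneq f 0; first by left.
apply: contrapT => /not_orP[nf nfi].
have [p Vp pE] := adjoin_dominating nf; have [r Vr rE] := adjoin_dominating nfi.
have [n] : exists n, (size p + size r <= n)%N by exists (size p + size r)%N.
elim: n p r f Vp Vr pE rE nzf {nf nfi} => [|n IH] p r f Vp Vr pE rE nzf sz.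
  have p0 : p = 0 by apply/eqP; rewrite -size_poly_leq0; lia.
  by move/eqP: pE; rewrite p0 horner0 eq_sym invr_eq0 (negPf nzvarpi).
have [le|lt] := leqP (size r) (size p).
  have sp0 : (0 < size p)%N.
    rewrite size_poly_gt0; apply: contraPneq pE => ->.
    by rewrite horner0 => /eqP; rewrite eq_sym invr_eq0 (negPf nzvarpi).
  have [||p' Vp' [p'E sp']] := @dominating_reduce (size p).-1 p r f nzf Vp Vr pE rE _ _.
  - by rewrite prednK.
  - by rewrite prednK.
  by apply: (IH p' r f) => //; lia.
have pE' : p.[f^-1^-1] = varpi^-1 by rewrite invrK.
have sr0 : (0 < size r)%N by lia.
have [||r' Vr' [r'E sr']] :=
    @dominating_reduce (size r).-1 r p f^-1 (invr_neq0 nzf) Vr Vp rE pE' _ _.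
- by rewrite prednK.
- by rewrite prednK // ltnW.
by apply: (IH p r' f) => //; lia.
Qed.

Let U y := V y /\ V y^-1.

Let UM a b : U a -> U b -> U (a * b).
Proof. by move=> [? ?] [? ?]; split; rewrite ?invfM; apply: VM. Qed.

Let UV a : U a -> U a^-1. Proof. by move=> [? ?]; split; rewrite ?invrK. Qed.

Let UX a n : U a -> U (a ^+ n).
Proof. by move=> [? ?]; split; rewrite -?exprVn; apply: VX. Qed.

Let VK f : V f%:A -> vge q 0 f.
Proof.
move=> Vf; apply/vgeP => nzf; rewrite leNgt; apply/negP => lt; apply: nVpi.
have -> : (pi^-1)%:A = f%:A * (pi^-1 / f)%:A :> F.
  by rewrite -scalerAl mul1r scalerA mulrC divfK.
apply: VM => //; apply: Vq; rewrite vgeE ?mulf_neq0 ?invr_neq0 //.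
by rewrite dvalM ?invr_neq0 // !dvalV // qpi; lia.
Qed.

Let maximal_ideal z := z = 0 \/ (V z /\ ~ V z^-1).

Let maximal_idealD a b : maximal_ideal a -> maximal_ideal b -> maximal_ideal (a + b).
Proof.
wlog Vba : a b / a != 0 /\ V (b / a) => [IH ma mb|].
  have [->|nza] := eqVneq a 0; first by rewrite add0r.
  have [->|nzb] := eqVneq b 0; first by rewrite addr0.
  have [H|H] := dominating_total (b / a); first exact: IH.
  by rewrite addrC; apply: IH => //; split=> //; rewrite invf_div in H.
case: Vba => nza Vba [a0|[Va nVa]] mb; first by rewrite a0 eqxx in nza.
have abE : a + b = a * (1 + b / a) by rewrite mulrDr mulr1 mulrC divfK.
have [->|nz] := eqVneq (a + b) 0; first by left.
right; split; first by rewrite abE; apply: VM => //; apply: VD.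
move=> H; apply: nVa; have -> : a^-1 = (a + b)^-1 * (1 + b / a).
  rewrite abE invfM -mulrA mulVf ?mulr1 //.
  by apply: contraNneq nz => z0; rewrite abE z0 mulr0.
by apply: VM => //; apply: VD.
Qed.

Lemma max_total (I : eqType) (T : I -> F) (r : seq I) : r != [::] ->
  (forall i, i \in r -> T i != 0) ->
  exists2 i, i \in r & forall j, j \in r -> V (T j / T i).
Proof.
elim: r => // i r IH _ nz; case: (eqVneq r [::]) => [->|nr].
  exists i; rewrite ?mem_head // => j; rewrite inE => /eqP->.
  by rewrite divff // nz ?mem_head.
have nzi : T i != 0 by apply: nz; rewrite mem_head.
have [|i' i'r H] := IH nr; first by move=> j jr; apply: nz; rewrite inE jr orbT.
have nzi' : T i' != 0 by apply: nz; rewrite inE i'r orbT.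
have [Vii|] := dominating_total (T i / T i').
  exists i'; first by rewrite inE i'r orbT.
  by move=> j; rewrite inE => /predU1P[->|/H].
rewrite invf_div => Vii; exists i; rewrite ?mem_head // => j; rewrite inE => /predU1P[->|jr].
  by rewrite divff.
rewrite (_ : T j / T i = T j / T i' * (T i' / T i)); last by rewrite mulrA divfK.
by apply: VM => //; apply: H.
Qed.

Let e := (\dim {:F})`!.

(** The value group of [V] has finite index over that of [q]: two terms of an
    algebraic equation of [z] have the same value. *)
Lemma dominating_power z : z != 0 -> exists2 a, a != 0 & U (z ^+ e / a%:A).
Proof.
move=> nzz; have /polyOver1P[m mE] := minPolyOver 1%AS z.
have mz : \sum_(j < size m) (m`_j)%:A * z ^+ j = 0.
  have /eqP h := root_minPoly 1%AS z; rewrite mE horner_coef size_map_poly in h.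
  by rewrite -[RHS]h; apply: eq_bigr => j _; rewrite coef_map.
have sm : (size m <= (\dim {:F}).+1)%N.
  rewrite -(size_map_poly (in_alg F)) -mE size_minPoly ltnS.
  have := dim_Fadjoin 1%AS z; rewrite dimv1 muln1 => <-.
  by apply: dimvS; apply: subvf.
have nzm : m != 0.
  have := monic_neq0 (monic_minPoly 1%AS z); rewrite mE.
  by apply: contra => /eqP->; rewrite rmorph0.
pose T (j : 'I_(size m)) : F := (m`_j)%:A * z ^+ j.
pose r := [seq j <- enum 'I_(size m) | T j != 0].
have nzT j : j \in r -> T j != 0 by rewrite mem_filter => /andP[].
have nzmj j : T j != 0 -> m`_j != 0.
  by apply: contra => /eqP mj; rewrite /T mj scale0r mul0r.
have nr : r != [::].
  have lt : ((size m).-1 < size m)%N by rewrite ltn_predL size_poly_gt0.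
  have : Ordinal lt \in r.
    rewrite mem_filter mem_enum andbT mulf_neq0 ?expf_neq0 //.
    by rewrite scaler_eq0 oner_eq0 orbF; rewrite -[m`__]/(lead_coef m) lead_coef_eq0.
  by apply: contraTneq => ->.
have [i ir imax] := max_total nr nzT; have nzi := nzT _ ir.
have [j [jr ji Uji]] : exists j, [/\ j \in r, j != i & U (T j / T i)].
  apply: contrapT => H; have : maximal_ideal (\sum_(j | j != i) T j / T i).
    apply: (big_ind maximal_ideal) => [||j ji]; first by left.
      exact: maximal_idealD.
    have [->|nzj] := eqVneq (T j) 0; first by rewrite mul0r; left.
    have jr : j \in r by rewrite mem_filter nzj mem_enum.
    right; split; first exact: imax.
    by move=> H'; apply: H; exists j; split=> //; split=> //; apply: imax.
  have -> : \sum_(j | j != i) T j / T i = -1.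
    have h : \sum_j T j / T i = 0 by rewrite -mulr_suml [X in X / _]mz mul0r.
    by rewrite (bigD1 i) //= divff // in h; apply: (addrI 1); rewrite h subrr.
  case=> [/eqP|[_]]; first by rewrite oppr_eq0 oner_eq0.
  by rewrite invrN1; apply; rewrite -sub0r; apply: VB.
have nzj := nzT _ jr.
have [d [b [d0 dle nzb Ud]]] : exists d b, [/\ (0 < d)%N, (d <= \dim {:F})%N, b != 0 & U (z ^+ d / b%:A)].
  have gen (i' j' : 'I_(size m)) : (i' < j')%N -> T i' != 0 -> T j' != 0 -> U (T j' / T i') ->
      exists d b, [/\ (0 < d)%N, (d <= \dim {:F})%N, b != 0 & U (z ^+ d / b%:A)].
    move=> lt nzi' nzj' Uij; exists (j' - i')%N, (m`_i' / m`_j'); split.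
    - by rewrite subn_gt0.
    - by apply: leq_trans (leq_subr _ _) _; rewrite -ltnS; apply: leq_trans (ltn_ord j') sm.
    - by rewrite mulf_neq0 ?invr_neq0 ?nzmj.
    move: Uij; rewrite /T -(subnK (ltnW lt)) exprD !subnK ?(ltnW lt) //.
    suff -> : (m`_j')%:A * (z ^+ (j' - i') * z ^+ i') / ((m`_i')%:A * z ^+ i') = z ^+ (j' - i') / (m`_i' / m`_j')%:A by [].
    rewrite mulrA -mulf_div divff ?expf_neq0 // mulr1 -[in RHS]/(in_alg F _) fmorph_div /= invf_div.
    by rewrite mulrA (mulrC (z ^+ _)).
  have [lt|lt|E] := ltngtP i j.
  - exact: (gen i j).
  - by apply: (gen j i) => //; rewrite -invf_div; apply: UV.
  - by rewrite (val_inj E) eqxx in ji.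
have dvd : (d %| e)%N by apply: dvdn_fact; rewrite d0.
exists (b ^+ (e %/ d)); first by rewrite expf_neq0.
have -> : z ^+ e / (b ^+ (e %/ d))%:A = (z ^+ d / b%:A) ^+ (e %/ d).
  rewrite expr_div_n -exprM (mulnC d) divnK //; congr (_ / _).
  by rewrite -[LHS]/(in_alg F _) rmorphXn.
exact: UX.
Qed.

(** A power of each [z] being a unit multiple of some [a] in the base field, the
    valuation attached to [V] can be computed as [q a]; it then only has to be
    normalized. *)
Lemma dominating_place : exists w f, is_place (fun a => (c0 a)%:A) w /\
  lies_over (in_alg F) w q f.
Proof.
have e0 : (0 < e)%N by apply: fact_gt0.
have in_alg_neq0 f : (f%:A != 0 :> F) = (f != 0).
  by rewrite scaler_eq0 oner_eq0 orbF.
have /boolp.choice[v Hv] : forall z : F, exists n : int, (z == 0 -> n = 0) /\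
    (z != 0 -> exists a, [/\ a != 0, n = q a & U (z ^+ e / a%:A)]).
  move=> z; have [->|nz] := eqVneq z 0; first by exists 0.
  by have [a nza Ua] := dominating_power nz; exists (q a); split=> // _; exists a.
have vE z a : z != 0 -> a != 0 -> U (z ^+ e / a%:A) -> v z = q a.
  move=> nz nza Ua; have [b [nzb -> Ub]] := (Hv z).2 nz.
  have [/VK h1 h2] : U ((b / a)%:A : F).
    have -> : (b / a)%:A = (z ^+ e / a%:A) / (z ^+ e / b%:A) :> F.
      rewrite -[LHS]/(in_alg F _) fmorph_div /= invf_div mulrA.
      by rewrite -(mulrA (z ^+ e)) (mulrC (z ^+ e)) mulfK ?expf_neq0 // mulrC.
    by apply: UM => //; apply: UV.
  have {h2} /VK h2 : V ((b / a)^-1%:A).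
    by rewrite -[_%:A]/(in_alg F _) fmorphV.
  move: h1 h2; rewrite !vgeE ?invr_neq0 ?mulf_neq0 ?invr_neq0 //.
  by rewrite (dvalV vq) dvalM ?invr_neq0 // (dvalV vq); lia.
have v0 : v 0 = 0 by apply: (Hv 0).1.
have vM a b : a != 0 -> b != 0 -> v (a * b) = v a + v b.
  move=> nza nzb; have [a' [nza' -> Ua]] := (Hv a).2 nza.
  have [b' [nzb' -> Ub]] := (Hv b).2 nzb.
  rewrite (vE _ (a' * b')) ?mulf_neq0 // ?dvalM //.
  rewrite -[_%:A]/(in_alg F _) rmorphM exprMn -mulf_div; exact: UM.
have v_ge0 z : z != 0 -> V z <-> 0 <= v z.
  move=> nz; have [a [nza -> [Ua Ua']]] := (Hv z).2 nz.
  have nzae : z ^+ e / a%:A != 0 by rewrite mulf_neq0 ?invr_neq0 ?expf_neq0 ?in_alg_neq0.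
  split=> [Vz|a0].
    rewrite -vgeE //; apply: VK; rewrite invf_div in Ua'.
    by rewrite -[_%:A](divfK (expf_neq0 e nz)); apply: VM => //; apply: VX.
  have Vze : V (z ^+ e).
    rewrite -[_ ^+ _](@divfK _ a%:A) ?in_alg_neq0 //; apply: VM => //.
    by apply: Vq; rewrite vgeE.
  have [//|Vzi] := dominating_total z.
  have -> : z = z ^+ e * z^-1 ^+ e.-1.
    have -> : z ^+ e = z * z ^+ e.-1 by rewrite -exprS prednK.
    by rewrite -mulrA -exprMn divff // expr1n mulr1.
  by apply: VM => //; apply: VX.
have vK f : v f%:A = e%:Z * q f.
  have [->|nzf] := eqVneq f 0; first by rewrite scale0r v0 dval0 // mulr0.
  rewrite (vE _ (f ^+ e)) ?in_alg_neq0 ?expf_neq0 ?dvalX //.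
  rewrite -![_%:A]/(in_alg F _) rmorphXn divff ?expf_neq0 ?fmorph_eq0 //.
  by split; rewrite ?invr1.
have vv : valuation v.
  split=> // a b nza nzb nz.
  wlog le : a b nza nzb nz / v a <= v b => [IH|].
    case/orP: (le_total (v a) (v b)) => le; first exact: IH.
    by rewrite minC addrC; apply: IH => //; rewrite addrC.
  have nzba : b / a != 0 by rewrite mulf_neq0 ?invr_neq0.
  have abE : a + b = a * (1 + b / a) by rewrite mulrDr mulr1 mulrC divfK.
  have nz1 : 1 + b / a != 0 by apply: contraNneq nz => z0; rewrite abE z0 mulr0.
  have vba : v b = v (b / a) + v a by rewrite -vM // divfK.
  have : V (1 + b / a) by apply: VD => //; apply/v_ge0 => //; lia.
  move/(v_ge0 _ nz1); rewrite abE vM //.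
  by rewrite ge_min => h; rewrite lerDl h.
have vc a : v (c0 a)%:A = 0 by rewrite vK (place_cst _ pq) mulr0.
have [|d [w [d0 pw vw]]] := normalize_valuation vv vc.
  exists varpi => //; rewrite vK qpi mulr1; lia.
have epi : e%:Z = d%:Z * w varpi by rewrite -vw vK qpi mulr1.
have wpi : 0 < w varpi by nia.
exists w, `|w varpi|%N; split=> //; split; first by lia.
move=> f; apply: (mulfI (_ : d%:Z != 0)); first by lia.
rewrite -vw vK epi -mulrA; congr (_ * (_ * _)); lia.
Qed.

End MaximalDominating.

End PlaceExtension.

(** Chevalley's extension theorem, for a place and a finite extension. *)
Lemma place_extension (k K : fieldType) (c0 : k -> K) (F : fieldExtType K)
    (q : K -> int) : is_place c0 q ->
  exists w e, is_place (fun a => (c0 a)%:A) w /\ lies_over (in_alg F) w q e.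
Proof.
move=> pq; have [pi nzpi qpi] := place_unif pq.
have [V domV maxV] := dominating_max F pq nzpi qpi.
exact: (dominating_place pq nzpi qpi domV maxV).
Qed.

(** * Places of a Galois extension of the rational function field *)

(** Residue fields do not grow in algebraic extensions, [k] being algebraically
    closed: reduce an equation whose coefficients are integral and do not all
    vanish at the place. *)
Lemma algebraic_residue (k : closedFieldType) (K E : fieldType)
    (c0 : {rmorphism k -> K}) (f : {rmorphism K -> E}) (q : K -> int) (w : E -> int)
    (m : {poly K}) (z : E) : valuation q -> valuation w ->
  (forall a, w (f (c0 a)) = 0) -> (forall a, vge q 1 a -> vge w 1 (f a)) ->
  (forall a, vge q 0 a -> exists c, vge q 1 (a - c0 c)) ->
  m != 0 -> root (map_poly f m) z -> vge w 0 z -> exists c, vge w 1 (z - f (c0 c)).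
Proof.
move=> vq vw wc qw res nzm /eqP mz wz.
rewrite horner_coef size_map_poly in mz.
have sm : (0 < size m)%N by rewrite size_poly_gt0.
have [j0 nzj0 minj0] : exists2 j0 : 'I_(size m), m`_j0 != 0 &
    forall j : 'I_(size m), m`_j != 0 -> q m`_j0 <= q m`_j.
  have lt : ((size m).-1 < size m)%N by rewrite ltn_predL.
  have nzl : m`_(Ordinal lt) != 0 by rewrite -/(lead_coef m) lead_coef_eq0.
  by case: (@arg_minP _ _ _ _ (fun j : 'I_(size m) => m`_j != 0) (fun j => q m`_j) nzl) => j nzj H; exists j.
pose a (j : 'I_(size m)) := m`_j / m`_j0.
have qa j : vge q 0 (a j).
  have [E0|nz] := eqVneq m`_j 0; first by rewrite /a E0 mul0r vge0.
  rewrite /a vgeE ?mulf_neq0 ?invr_neq0 // (dvalM vq) ?invr_neq0 // (dvalV vq).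
  by have := minj0 _ nz; lia.
have az : \sum_j f (a j) * z ^+ j = 0.
  apply: (mulfI (_ : f m`_j0 != 0)); first by rewrite fmorph_eq0.
  rewrite mulr0 -[RHS]mz mulr_sumr; apply: eq_bigr => j _.
  by rewrite coef_map mulrA -rmorphM /a mulrC (mulrC m`_j0) divfK // mulrC.
have /boolp.choice[c Hc] : forall j, exists c, vge q 1 (a j - c0 c).
  by move=> j; apply: res.
pose g := \poly_(j < size m) (if insub j is Some i then c i else 0).
have gj (j : 'I_(size m)) : g`_j = c j by rewrite coef_poly ltn_ord valK.
have nzg : g != 0.
  apply/eqP => g0; have := Hc j0; rewrite -gj g0 coef0 rmorph0 subr0 /a divff //.
  by rewrite vgeE ?oner_eq0 // dval1.
pose h : {rmorphism k -> E} := f \o c0.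
have gz : vge w 1 (map_poly h g).[z].
  rewrite (@horner_coef_wide _ (size m)); last by rewrite size_map_poly size_poly.
  rewrite -[\sum_(i < _) _]subr0 -[X in _ - X]az -sumrB; apply: vge_sum => // j _.
  rewrite coef_map /= gj -mulrBl -[1]addr0; apply: vgeM => //.
    by rewrite -vgeN // opprB -rmorphB; apply: qw.
  by rewrite -[0](mulr0 j%:Z) vgeX.
have [rs gE] := closed_field_poly_normal g.
have nzl : h (lead_coef g) != 0 by rewrite fmorph_eq0 lead_coef_eq0.
apply: contrapT => H; have Hr r : z - h r != 0 /\ w (z - h r) = 0.
  have : ~~ vge w 1 (z - h r) by apply/negP => h1; apply: H; exists r.
  rewrite vgeN_lt => /andP[nz lt]; split=> //.
  have : vge w 0 (z - h r) by apply: vgeB => //; rewrite /vge wc lexx orbT.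
  by rewrite vgeE //; lia.
have gzE : (map_poly h g).[z] = h (lead_coef g) * \prod_(i <- rs) (z - h i).
  rewrite {1}gE -mul_polyC rmorphM /= map_polyC hornerM hornerC rmorph_prod horner_prod.
  by congr (_ * _); apply: eq_bigr => r _; rewrite /= map_polyXsubC hornerXsubC.
have nzp : \prod_(i <- rs) (z - h i) != 0.
  by rewrite prodf_seq_neq0; apply/allP => r _; case: (Hr r).
move: gz; rewrite gzE vgeE ?mulf_neq0 // dvalM // wc dval_prod // => [|r _]; last by case: (Hr r).
by rewrite big1 // => r _; case: (Hr r).
Qed.

Lemma polyOver_val_ring (E : fieldType) (v : E -> int) (m : {poly E}) : valuation v ->
  reflect (forall i, vge v 0 m`_i) (m \is a polyOver (val_ring v)).
Proof.
move=> vv; apply: (iffP (all_nthP 0)) => H i; last first.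
  by move=> _; rewrite -[mem _ _]/(m`_i \in val_ring v) val_ringE.
have [lt|le] := ltnP i (size m); last by rewrite nth_default ?vge0.
by rewrite -(val_ringE vv); apply: H.
Qed.

HB.instance Definition _ (k : closedFieldType) :=
  GRing.RMorphism.copy (@cst0 k) (@FracField.tofrac {poly k} \o @polyC k).
HB.instance Definition _ (k : closedFieldType) (F : splittingFieldType (ratfun k)) :=
  GRing.RMorphism.copy (@cst k F) (GRing.in_alg F \o @cst0 k).

Section GaloisPlaces.

Variables (k : closedFieldType) (F : splittingFieldType (ratfun k)).
Local Notation K := (ratfun k).
Local Notation G := 'Gal({:F} / 1%AS)%g.

Lemma alg_neq0 (f : K) : (f%:A != 0 :> F) = (f != 0).
Proof. by rewrite scaler_eq0 oner_eq0 orbF. Qed.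

Lemma scale_neq0 (f : K) (z : F) : f != 0 -> z != 0 -> f *: z != 0.
Proof. by move=> nzf nzz; rewrite scaler_eq0 negb_or nzf nzz. Qed.

Lemma alg_inj (f g : K) : f%:A = g%:A :> F -> f = g.
Proof. exact: (@fmorph_inj _ _ (in_alg F)). Qed.

Lemma gal_alg (s : gal_of {:F}) f : s f%:A = f%:A.
Proof. by rewrite linearZ rmorph1. Qed.

Lemma gal_cst (s : gal_of {:F}) c : s (cst F c) = cst F c.
Proof. exact: gal_alg. Qed.

Lemma mem_gal1 (s : gal_of {:F}) : s \in G.
Proof.
rewrite gal_kHom ?sub1v //; apply/kAHomP => _ /vlineP[f ->]; exact: gal_alg.
Qed.

Lemma galMv (s t : gal_of {:F}) a : (s * t)%g a = t (s a).
Proof. by rewrite galM ?memvf. Qed.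

Lemma galVK (s : gal_of {:F}) : cancel s (s^-1)%g.
Proof. by move=> a; rewrite -galMv mulgV gal_id. Qed.

Lemma galKV (s : gal_of {:F}) : cancel (s^-1)%g s.
Proof. by move=> a; rewrite -galMv mulVg gal_id. Qed.

Lemma gal_neq0 (s : gal_of {:F}) a : (s a != 0) = (a != 0).
Proof. by rewrite fmorph_eq0. Qed.

Lemma gal_vge (s : gal_of {:F}) (w : F -> int) m z :
  vge (fun z => w (s z)) m z = vge w m (s z).
Proof. by rewrite /vge fmorph_eq0. Qed.

Lemma gal_place (s : gal_of {:F}) w :
  is_place (@cst k F) w -> is_place (@cst k F) (fun z => w (s z)).
Proof.
move=> pw; have vw := place_val pw; split=> [|a b nza nzb|a b nza nzb nz|c|].
- by rewrite rmorph0 dval0.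
- by rewrite rmorphM dvalM ?gal_neq0.
- by rewrite rmorphD dvalD -?rmorphD ?gal_neq0.
- by rewrite gal_cst (place_cst _ pw).
have [t nzt wt] := place_unif pw; exists (s^-1%g t); first by rewrite gal_neq0.
by rewrite galKV.
Qed.

Lemma gal_lies_over (s : gal_of {:F}) w q e :
  lies_over (in_alg F) w q e -> lies_over (in_alg F) (fun z => w (s z)) q e.
Proof. by case=> e0 wq; split=> // f; rewrite -wq /= gal_alg. Qed.

Section OverPlace.

Variables (w : F -> int) (q : K -> int) (e : nat).
Hypotheses (pw : is_place (@cst k F) w) (wq : lies_over (in_alg F) w q e).
Let vw := place_val pw.

Lemma lies_over_vge f m : vge w (e%:Z * m) f%:A = vge q m f.
Proof.
case: wq => e0 /(_ f) /= wf; rewrite /vge wf scaler_eq0 oner_eq0 orbF.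
by congr orb; nia.
Qed.

Lemma lies_over_vge0 f : vge w 0 f%:A = vge q 0 f.
Proof. by rewrite -lies_over_vge mulr0. Qed.

Lemma lies_over_vge1 f : vge q 1 f -> vge w 1 f%:A.
Proof.
rewrite -lies_over_vge; apply: vge_le; case: wq; lia.
Qed.

Lemma lies_over_val : valuation q.
Proof.
case: wq => e0 wqE; split=> [|a b nza nzb|a b nza nzb nz].
- move: (wqE 0); rewrite /= scale0r (dval0 vw) => /esym/eqP; rewrite mulf_eq0.
  by case/orP=> [|/eqP//]; lia.
- have := dvalM vw (_ : in_alg F a != 0) (_ : in_alg F b != 0).
  rewrite -rmorphM !wqE !fmorph_eq0 => /(_ nza nzb) h.
  by apply: (mulfI (_ : e%:Z != 0)); [lia | rewrite mulrDr].
- have := dvalD vw (_ : in_alg F a != 0) (_ : in_alg F b != 0) (_ : in_alg F a + in_alg F b != 0).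
  rewrite -rmorphD !wqE !fmorph_eq0 => /(_ nza nzb nz).
  have e0' : 0 < e%:Z by lia.
  by rewrite !ge_min => /orP[] h; apply/orP; [left | right]; rewrite -(ler_pM2l e0').
Qed.

End OverPlace.

(** At an element of negative valuation the leading term of a monic equation
    with integral coefficients would dominate. *)
Lemma root_vge0 (w : F -> int) (p : {poly F}) z : valuation w -> p \is monic ->
  (forall i, vge w 0 p`_i) -> root p z -> vge w 0 z.
Proof.
move=> vw mp wp rz; apply: contrapT => /negP; rewrite vgeN_lt => /andP[nzz wz].
have sp : (size p).-1.+1 = size p by rewrite prednK // size_poly_gt0 monic_neq0.
have : z ^+ (size p).-1 = - \sum_(i < (size p).-1) p`_i * z ^+ i.
  apply/eqP; rewrite -addr_eq0; move: rz; rewrite /root horner_coef -sp big_ord_recr /=.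
  by rewrite -/(lead_coef p) (monicP mp) mul1r addrC.
move: (size p).-1 => n E.
have : vge w (n%:Z * w z + 1) (z ^+ n).
  rewrite E vgeN //; apply: vge_sum => // i _.
  apply: (@vge_le _ _ (0 + i%:Z * w z)); first by have := ltn_ord i; nia.
  by apply: vgeM => //; apply: vgeX => //; apply: vge_val.
by rewrite vgeE ?expf_neq0 // dvalX //; lia.
Qed.

Lemma map_coef_vge0 w q e (m : {poly K}) : is_place (@cst k F) w ->
  lies_over (in_alg F) w q e -> m \is a polyOver (val_ring q) ->
  forall i, vge w 0 (map_poly (in_alg F) m)`_i.
Proof.
move=> pw wq qm i; rewrite coef_map /= (lies_over_vge0 wq).
exact: (elimT (polyOver_val_ring m (lies_over_val pw wq)) qm i).
Qed.

Lemma icl_vge w q e z : is_place (@cst k F) w -> lies_over (in_alg F) w q e ->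
  integral_closure q z -> vge w 0 z.
Proof.
move=> pw wq [m [mm qm rz]].
have mm' : map_poly (in_alg F) m \is monic by rewrite map_monic.
exact: (root_vge0 (place_val pw) mm' (map_coef_vge0 pw wq qm) rz).
Qed.

(** The restriction of [w] is not trivial, for otherwise the inverse of a
    uniformizer of [w], being algebraic, would be integral. *)
Lemma place_restrict w : is_place (@cst k F) w ->
  exists q e, is_place (@cst0 k) q /\ lies_over (in_alg F) w q e.
Proof.
move=> pw; have vw := place_val pw.
have vq : valuation (fun f : K => w (in_alg F f)) by apply: valuation_comp.
have wc a : w (in_alg F (cst0 a)) = 0 by rewrite -[RHS](place_cst a pw) /cst.
have [|d [q [d0 pq wq]]] := @normalize_valuation k K (@cst0 k) _ vq wc.
  apply: contrapT => H; have [t nzt wt] := place_unif pw.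
  have /polyOver1P[m mE] := minPolyOver 1%AS t^-1.
  have : vge w 0 t^-1.
    apply: (root_vge0 vw (monic_minPoly _ _) _ (root_minPoly 1%AS _)) => i.
    rewrite mE coef_map; apply/vgeP => _; case: (eqVneq (w (in_alg F m`_i)) 0) => [->//|ne].
    case: H; exists m`_i => //; apply: contra ne => /eqP->.
    by rewrite rmorph0 dval0.
  by rewrite vgeE ?invr_neq0 // dvalV // wt.
by exists q, d; split.
Qed.

Lemma place_residue w z : is_place (@cst k F) w -> vge w 0 z ->
  exists c, vge w 1 (z - cst F c).
Proof.
move=> pw wz; have [q [e [pq wq]]] := place_restrict pw.
have /polyOver1P[m mE] := minPolyOver 1%AS z.
apply: (@algebraic_residue k K F (@cst0 k) (in_alg F) q w m z (place_val pq) (place_val pw)) => //.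
- by move=> a; apply: (place_cst a pw).
- by move=> a; apply: (lies_over_vge1 wq).
- by move=> a; apply: place_residue0.
- have := monic_neq0 (monic_minPoly 1%AS z); rewrite mE.
  by apply: contra => /eqP->; rewrite rmorph0.
- by rewrite -mE root_minPoly.
Qed.

Lemma vge0_polyM (w : F -> int) (p r : {poly F}) : valuation w ->
  (forall i, vge w 0 p`_i) -> (forall i, vge w 0 r`_i) -> forall i, vge w 0 (p * r)`_i.
Proof.
move=> vw wp wr i; rewrite coefM; apply: vge_sum => // j _.
by rewrite -[0](addr0 0) vgeM.
Qed.

Lemma place_over q : is_place (@cst0 k) q ->
  exists w e, is_place (@cst k F) w /\ lies_over (in_alg F) w q e.
Proof. exact: place_extension. Qed.

Hypothesis galF : galois 1%AS {:F}.

Lemma fixed_alg (z : F) : (forall s : gal_of {:F}, s z = z) -> exists f : K, z = f%:A.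
Proof.
move=> fixz; apply/vlineP; rewrite -(galois_fixedField galF).
by apply/fixedFieldP => [|s _]; rewrite ?memvf.
Qed.

Definition charpoly (z : F) : {poly F} := \prod_(s in G) ('X - (s z)%:P).

Lemma charpoly_alg z : exists m : {poly K}, charpoly z = map_poly (in_alg F) m.
Proof.
apply/polyOver1P/polyOverP => i; apply/vlineP; apply: fixed_alg => t.
suff E : map_poly t (charpoly z) = charpoly z by rewrite -coef_map E.
rewrite /charpoly rmorph_prod /= [RHS](reindex_inj (mulIg t)) /=.
apply: eq_big => s; first by rewrite !mem_gal1.
by move=> _; rewrite map_polyXsubC galMv.
Qed.

(** Integrality over [q] can be tested at one place above [q], on all conjugates:
    the characteristic polynomial is then an integral equation. *)
Lemma icl_iff w q e z : is_place (@cst k F) w -> lies_over (in_alg F) w q e ->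
  (forall s : gal_of {:F}, vge w 0 (s z)) <-> integral_closure q z.
Proof.
move=> pw wq; have vw := place_val pw; split=> [wz|iz s]; last first.
  rewrite -gal_vge; exact: (icl_vge (gal_place s pw) (gal_lies_over s wq) iz).
have [m mE] := charpoly_alg z; exists m; split.
- rewrite -(map_monic (in_alg F)) -mE; apply: monic_prod => s _; exact: monicXsubC.
- have wc : forall i, vge w 0 (charpoly z)`_i.
    rewrite /charpoly; apply: (big_ind (fun p : {poly F} => forall i, vge w 0 p`_i)).
    + move=> i; rewrite coef1; case: (i == 0%N); last exact: vge0.
      by rewrite vgeE ?oner_eq0 // dval1.
    + by move=> p r; apply: vge0_polyM.
    + move=> s _ i; rewrite coefB coefX coefC; apply: vgeB => //.
        case: (i == 1%N); last exact: vge0.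
        by rewrite vgeE ?oner_eq0 // dval1.
      by case: (i == 0%N); [exact: wz | exact: vge0].
  apply/(polyOver_val_ring _ (lies_over_val pw wq)) => i.
  by have := wc i; rewrite mE coef_map (lies_over_vge0 wq).
- rewrite -mE /charpoly /root horner_prod (bigD1 1%g) ?group1 //=.
  by rewrite !hornerE gal_id subrr mul0r.
Qed.

(** * The trace *)

Lemma trace_ex (z : F) : exists f : K, galTrace 1%AS {:F} z == f%:A.
Proof.
have /vlineP[f ->] : galTrace 1%AS {:F} z \in 1%AS by apply: mem_galTrace; rewrite ?memvf.
by exists f.
Qed.

Definition trace (z : F) : K := xchoose (trace_ex z).

Lemma traceE z : (trace z)%:A = galTrace 1%AS {:F} z.
Proof. by rewrite (eqP (xchooseP (trace_ex z))). Qed.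

Lemma trace_sum z : (trace z)%:A = \sum_(s : gal_of {:F}) s z.
Proof. by rewrite traceE; apply: eq_bigl => s; rewrite mem_gal1. Qed.

Lemma traceD a b : trace (a + b) = trace a + trace b.
Proof.
apply: alg_inj; rewrite scalerDl !trace_sum -big_split /=.
by apply: eq_bigr => s _; rewrite rmorphD.
Qed.

Lemma traceZ f a : trace (f *: a) = f * trace a.
Proof.
apply: alg_inj; rewrite -scalerA !trace_sum scaler_sumr.
by apply: eq_bigr => s _; rewrite linearZ.
Qed.

Lemma trace0 : trace 0 = 0.
Proof. by rewrite -(scale0r 0) traceZ mul0r. Qed.

Lemma trace_lsum (I : Type) (r : seq I) (P : pred I) (E : I -> F) :
  trace (\sum_(i <- r | P i) E i) = \sum_(i <- r | P i) trace (E i).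
Proof. exact: (big_morph _ traceD trace0). Qed.

Lemma trace_gal (s : gal_of {:F}) a : trace (s a) = trace a.
Proof. by apply: alg_inj; rewrite !traceE (galTrace_gal (memvf a) (mem_gal1 s)). Qed.

(** By the linear independence of automorphisms. *)
Lemma trace_nondeg a : a != 0 -> exists b, trace (a * b) != 0.
Proof.
move=> nza; have [|b _] := @gal_independent_contra _ _ {:F} predT (fun=> 1) 1%g erefl.
  exact: oner_neq0.
move=> nz; exists (a^-1 * b); rewrite mulVKf // -(alg_neq0 (trace b)) trace_sum.
apply: contra nz => /eqP E0; rewrite -[X in _ == X]E0; apply/eqP.
by apply: eq_bigr => s _; rewrite mul1r.
Qed.

Section OverPlaceTrace.

Variable q : K -> int.
Hypothesis pq : is_place (@cst0 k) q.

Lemma icl_trace z : integral_closure q z -> vge q 0 (trace z).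
Proof.
have [w [e [pw wq]]] := place_over pq => /(icl_iff z pw wq) wz.
rewrite -(lies_over_vge0 wq) trace_sum; apply: (vge_sum (place_val pw)) => s _.
exact: wz.
Qed.

Lemma complementaryP z : complementary_module q z <->
  (forall y, integral_closure q y -> vge q 0 (trace (z * y))).
Proof.
have vq := place_val pq; split=> H y /H.
  by case=> u; rewrite (val_ringE vq) => qu; rewrite -traceE => /alg_inj ->.
by move=> qu; exists (trace (z * y)); rewrite ?val_ringE // traceE.
Qed.

Lemma iclM (a b : F) : integral_closure q a -> integral_closure q b -> integral_closure q (a * b).
Proof.
have [w [e [pw wq]]] := place_over pq; rewrite -!(icl_iff _ pw wq) => wa wb s.
by rewrite rmorphM; have := vgeM (place_val pw) (wa s) (wb s); rewrite addr0.
Qed.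

Lemma iclB (a b : F) : integral_closure q a -> integral_closure q b -> integral_closure q (a - b).
Proof.
have [w [e [pw wq]]] := place_over pq; rewrite -!(icl_iff _ pw wq) => wa wb s.
by rewrite rmorphB; exact: (vgeB (place_val pw) (wa s) (wb s)).
Qed.

Lemma icl_alg f : vge q 0 f -> integral_closure q (f%:A : F).
Proof.
have [w [e [pw wq]]] := place_over pq; rewrite -!(icl_iff _ pw wq) => qf s.
by rewrite gal_alg (lies_over_vge0 wq).
Qed.

Lemma icl_unitZ f (z : F) : f != 0 -> q f = 0 ->
  integral_closure q (f *: z) <-> integral_closure q z.
Proof.
move=> nzf qf; have vq := place_val pq.
have scale g y : vge q 0 g -> integral_closure q y -> integral_closure q (g *: y : F).
  by move=> qg iy; rewrite -[y]mul1r scalerAl; apply: iclM => //; apply: icl_alg.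
split=> iz; last by apply: scale => //; rewrite vgeE // qf.
rewrite -[z]scale1r -(mulVf nzf) -scalerA; apply: scale => //.
by rewrite (vgeE _ _ (invr_neq0 nzf)) (dvalV vq) qf.
Qed.

Lemma icl_gal (s : gal_of {:F}) (a : F) : integral_closure q a -> integral_closure q (s a : F).
Proof.
have [w [e [pw wq]]] := place_over pq; rewrite -!(icl_iff _ pw wq) => wa t.
by rewrite -galMv.
Qed.

End OverPlaceTrace.

End GaloisPlaces.

(** * Totally ramified places *)

Lemma eq_mod_lt (N i j : nat) (m : int) : (i < N)%N -> (j < N)%N ->
  i%:Z - j%:Z = N%:Z * m -> i = j.
Proof. by case: (ltrgt0P m) => [m0|m0|->]; nia. Qed.

Section Ramification.

Variables (k : closedFieldType) (F : splittingFieldType (ratfun k)).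
Local Notation K := (ratfun k).
Local Notation N := (\dim {:F}).

Section TotallyRamified.

Variables (w : F -> int) (q : K -> int).
Hypotheses (pw : is_place (@cst k F) w) (tot : totally_ramified w q).
Let vw := place_val pw.
Let vq := lies_over_val pw tot.

Lemma dim_gt0 : (0 < N)%N. Proof. by case: tot. Qed.

Lemma tot_alg f : w f%:A = N%:Z * q f. Proof. by case: tot => _ /(_ f) /= ->. Qed.

Lemma tot_valZ f z : f != 0 -> z != 0 -> w (f *: z) = N%:Z * q f + w z.
Proof.
by move=> nzf nzz; rewrite -[z in LHS]mul1r scalerAl dvalM ?alg_neq0 // tot_alg.
Qed.

Lemma tot_vgeZ m f z : vge w m z -> vge w (N%:Z * q f + m) (f *: z).
Proof.
by move=> wz; rewrite -[z]mul1r scalerAl; apply: vgeM => //; rewrite -tot_alg vge_val.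
Qed.

Lemma tot_vgeZE m f z : f != 0 -> vge w m (f *: z) = vge w (m - N%:Z * q f) z.
Proof.
by move=> nzf; rewrite -[z in LHS]mul1r scalerAl vge_mull ?alg_neq0 // tot_alg.
Qed.

Section Adapted.

Variable b : 'I_N -> F.
Hypothesis nzb : forall i, b i != 0.
Hypothesis b_distinct : forall i j m, w (b i) - w (b j) = N%:Z * m -> i = j.

(** The valuations of [k(x)] are multiples of [N], so that the terms of a
    combination of the [b j] have distinct valuations. *)
Lemma tot_comb (a : 'I_N -> K) i : a i != 0 ->
  \sum_j a j *: b j != 0 /\ w (\sum_j a j *: b j) <= N%:Z * q (a i) + w (b i).
Proof.
move=> nza; have wZ j : a j != 0 -> w (a j *: b j) = N%:Z * q (a j) + w (b j).
  by move=> nz; apply: tot_valZ.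
have nzZ j : (a j *: b j != 0) = (a j != 0).
  by rewrite scaler_eq0 negb_or nzb andbT.
rewrite -wZ //; apply: dval_sum_distinct => // [j j'|]; rewrite ?nzZ // => nzj nzj'.
by rewrite !wZ // => E; apply: (b_distinct (m := q (a j') - q (a j))); nia.
Qed.

(** Elements with distinct valuations modulo [N] are independent, and there are
    enough of them. *)
Lemma tot_basis z : exists a : 'I_N -> K, z = \sum_j a j *: b j.
Proof.
pose X := [tuple b i | i < N].
have freeX : free X.
  apply/freeP => a a0 i; apply/eqP; apply: contraT => nzi.
  have [/eqP[]] := tot_comb nzi; rewrite -[RHS]a0; apply: eq_bigr => j _.
  by rewrite -tnth_nth tnth_mktuple.
have bX : basis_of fullv X.
  by rewrite basisEfree freeX subvf size_tuple /=.
exists (fun j => coord X j z); rewrite {1}(coord_basis bX (memvf z)).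
by apply: eq_bigr => j _; rewrite -tnth_nth tnth_mktuple.
Qed.

End Adapted.

Variable t : F.
Hypotheses (nzt : t != 0) (wt : w t = 1).

Lemma tot_powers z : exists2 a : 'I_N -> K, z = \sum_(j < N) a j *: t ^+ j &
  forall m, vge w m z -> forall j, a j != 0 -> m <= N%:Z * q (a j) + j%:Z.
Proof.
have nzX (j : 'I_N) : t ^+ j != 0 by rewrite expf_neq0.
have dX (i j : 'I_N) m : w (t ^+ i) - w (t ^+ j) = N%:Z * m -> i = j.
  rewrite !dvalX // wt !mulr1 => E; apply: val_inj => /=.
  exact: eq_mod_lt (ltn_ord i) (ltn_ord j) E.
have [a zE] := tot_basis nzX dX z; exists a => // m wz j nzj.
have [nz le] := tot_comb nzX dX nzj; rewrite -zE in nz le.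
by move: wz; rewrite vgeE // => /le_trans/(_ le); rewrite dvalX // wt mulr1.
Qed.

(** The expansion of [t ^+ N] in lower powers of [t] is an Eisenstein equation;
    the conjugates of [t] satisfy it too. *)
Lemma tot_unif_conj (s : gal_of {:F}) : vge w 0 (s t).
Proof.
have [a tE Ha] := tot_powers (t ^+ N).
pose r : {poly K} := \poly_(j < N) (if insub j is Some i then a i else 0).
have rj (j : 'I_N) : r`_j = a j by rewrite coef_poly ltn_ord valK.
have sr : (size (- r) <= N)%N by rewrite size_polyN size_poly.
have mp : 'X^N - r \is monic.
  by rewrite monicE lead_coefDl ?lead_coefXn // size_polyXn ltnS.
have rt : root (map_poly (in_alg F) ('X^N - r)) t.
  rewrite rmorphB /= map_polyXn /root !hornerE tE.
  rewrite (@horner_coef_wide _ N) ?size_map_poly ?size_poly // -sumrB big1 // => j _.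
  by rewrite coef_map /= rj -scalerAl mul1r subrr.
apply: (@root_vge0 k F w (map_poly (in_alg F) ('X^N - r))) => //.
- by rewrite map_monic.
- move=> i; rewrite coef_map (lies_over_vge0 tot) coefB coefXn.
  have v1 : vge q 0 (1 : K) by rewrite vgeE ?oner_eq0 // dval1.
  apply: (vgeB vq); first by case: (_ == _); rewrite ?vge0.
  rewrite coef_poly; case: ifP => [lt|_]; last exact: vge0.
  rewrite insubT; set j := Sub i lt; apply/vgeP => nz.
  have wtN : vge w N%:Z (t ^+ N) by rewrite -[X in vge w X]mulr1 -wt vgeX // vge_val.
  have /= := Ha _ wtN j nz; nia.
have -> : map_poly (in_alg F) ('X^N - r) = map_poly s (map_poly (in_alg F) ('X^N - r)).
  by apply/polyP => i; rewrite !coef_map /= gal_alg.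
by rewrite /root horner_map fmorph_eq0.
Qed.

Lemma tot_gal_vge0 (s : gal_of {:F}) z : vge w 0 z -> vge w 0 (s z).
Proof.
move=> wz; have [a zE Ha] := tot_powers z; rewrite {1}zE rmorph_sum; apply: vge_sum => // j _.
have [->|nz] := eqVneq (a j) 0; first by rewrite scale0r rmorph0 vge0.
rewrite /= linearZ /= -[s (t ^+ j)]mul1r scalerAl -[0](addr0 0); apply: vgeM => //.
  have := Ha _ wz _ nz; rewrite -/(vge _ _ _) (lies_over_vge0 tot) vgeE //.
  by have := ltn_ord j; nia.
by rewrite rmorphXn -(mulr0 j%:Z) vgeX // tot_unif_conj.
Qed.

End TotallyRamified.

Lemma tot_gal w q (s : gal_of {:F}) z : is_place (@cst k F) w ->
  totally_ramified w q -> w (s z) = w z.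
Proof.
move=> pw tot; have [t nzt wt] := place_unif pw; apply/esym; move: z.
apply: (place_le_eq pw (gal_place s pw)) => z wz.
by rewrite gal_vge; apply: (tot_gal_vge0 pw tot nzt wt).
Qed.

Hypothesis galF : galois 1%AS {:F}.

Section TotallyRamifiedConsequences.

Variables (w : F -> int) (q : K -> int).
Hypotheses (pw : is_place (@cst k F) w) (pq : is_place (@cst0 k) q).
Hypothesis (tot : totally_ramified w q).
Let vw := place_val pw.
Let vq := place_val pq.

Lemma tot_icl z : integral_closure q z <-> vge w 0 z.
Proof.
rewrite -(icl_iff galF z pw tot); split=> [/(_ 1%g)|wz s]; first by rewrite gal_id.
by move: wz; rewrite /vge fmorph_eq0 (tot_gal s z pw tot).
Qed.

Lemma tot_unique w' e : is_place (@cst k F) w' -> lies_over (in_alg F) w' q e -> w =1 w'.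
Proof.
move=> pw' wq'; apply: (place_le_eq pw pw') => z /tot_icl iz; exact: (icl_vge pw' wq' iz).
Qed.

Variable d : nat.
Hypothesis diff : different_exponent w q d.

(** The integral closure is the valuation ring of [w], so its multiples by [t] are
    the elements of valuation at least that of [t]. *)
Lemma diff_complementary z : complementary_module q z <-> vge w (- d%:Z) z.
Proof.
case: diff => t Ht dE.
have nzt : t != 0.
  apply/eqP => t0; have : complementary_module q (1 : F).
    by apply/(complementaryP galF) => // y iy; rewrite mul1r; apply: icl_trace.
  case/Ht => u _; rewrite t0 mul0r => /eqP; by rewrite oner_eq0.
rewrite Ht; split=> [[u /tot_icl wu ->]|wz].
  by rewrite -[- d%:Z]addr0; apply: vgeM => //; rewrite dE opprK vge_val.
exists (z / t); last by rewrite mulrC divfK.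
apply/tot_icl; rewrite mulrC vge_mull ?invr_neq0 // dvalV //.
by rewrite dE in wz; apply: vge_le wz; lia.
Qed.

Lemma diff_trace z : vge w (- d%:Z) z -> vge q 0 (trace galF z).
Proof.
move/diff_complementary/(complementaryP galF pq _)/(_ 1); rewrite mulr1; apply.
by apply/tot_icl; rewrite vgeE ?oner_eq0 // dval1.
Qed.

Lemma diff_traceX m z : vge w (N%:Z * m - d%:Z) z -> vge q m (trace galF z).
Proof.
have [f nzf qf] := place_attains (- m) pq => wz.
have : vge q 0 (trace galF (f *: z)).
  apply: diff_trace; have := tot_vgeZ pw tot f wz; rewrite qf.
  by rewrite (_ : N%:Z * - m + (N%:Z * m - d%:Z) = - d%:Z) //; nia.
rewrite traceZ vge_mull // qf; by apply: vge_le; lia.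
Qed.

(** The exponent is the largest possible. An integral [y] is a constant up to
    an element of positive valuation; so if the trace of [z] were integral, that
    of every [z * y] would be, and [z] would lie in the complementary module. *)
Lemma diff_trace_sharp z : z != 0 -> w z = - d%:Z - 1 -> ~~ vge q 0 (trace galF z).
Proof.
move=> nzz wz; apply/negP => qz.
have : complementary_module q z.
  apply/(complementaryP galF pq) => y /tot_icl wy.
  have [c wc] := place_residue pw wy.
  have -> : z * y = cst0 c *: z + z * (y - cst F c).
    by rewrite mulrBr (mulrC z (cst F c)) -[X in X * z]/((cst0 c)%:A) -scalerAl mul1r subrKC.
  rewrite traceD traceZ; apply: vgeD => //.
    by rewrite -[0](addr0 0); apply: vgeM => //; apply: vge_cst0.
  apply: diff_trace; rewrite (_ : - d%:Z = w z + 1); last by lia.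
  by apply: vgeM => //; apply: vge_val.
by move/diff_complementary; rewrite vgeE // wz; lia.
Qed.

Lemma diff_trace_neq0 m z : z != 0 -> w z = N%:Z * m - d%:Z - 1 -> trace galF z != 0.
Proof.
move=> nzz wz; have [f nzf qf] := place_attains (- m) pq.
have nzfz : f *: z != 0 by rewrite scaler_eq0 negb_or nzf.
have wfz : w (f *: z) = - d%:Z - 1 by rewrite (tot_valZ pw tot nzf nzz) qf wz; nia.
have := diff_trace_sharp nzfz wfz; rewrite traceZ; apply: contraNneq => ->.
by rewrite mulr0 vge0.
Qed.

End TotallyRamifiedConsequences.

(** * Unramified places *)

Lemma complementary_gal q z (s : gal_of {:F}) : is_place (@cst0 k) q ->
  complementary_module q z -> complementary_module q (s z).
Proof.
move=> pq /(complementaryP galF pq) Hz; apply/(complementaryP galF pq) => y iy.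
rewrite -(galKV s y) -rmorphM trace_gal; apply: Hz; exact: icl_gal.
Qed.

Lemma complementaryM q z y : is_place (@cst0 k) q ->
  complementary_module q z -> integral_closure q y -> complementary_module q (z * y : F).
Proof.
move=> pq /(complementaryP galF pq) Hz iy; apply/(complementaryP galF pq) => y' iy'.
by rewrite -mulrA; apply: Hz; apply: iclM.
Qed.

Lemma icl_complementary q z : is_place (@cst0 k) q ->
  integral_closure q z -> complementary_module q (z : F).
Proof.
move=> pq iz; apply/(complementaryP galF pq) => y iy.
by apply: icl_trace => //; apply: iclM.
Qed.

Section Unramified.

Variable q : K -> int.
Hypotheses (pq : is_place (@cst0 k) q) (unr : ~ ramified F q).
Let vq := place_val pq.

(** The decomposition group is trivial: elements of [F] have expansions in
    powers of a uniformizer of [q], with coefficients in [k], and an automorphism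
    that preserves [w] fixes every partial sum. *)
Lemma unr_decomposition w (s : gal_of {:F}) : is_place (@cst k F) w ->
  lies_over (in_alg F) w q 1 -> w =1 (fun z => w (s z)) -> s = 1%g.
Proof.
move=> pw wq ws; have vw := place_val pw.
have [f nzf qf] := place_unif pq.
have wf : w f%:A = 1 by case: wq => _ /(_ f) /= ->; rewrite qf.
have nzfA : f%:A != 0 :> F by rewrite alg_neq0.
have approx (r : nat) : forall z, vge w 0 z -> vge w r%:Z (s z - z).
  elim: r => [|r IH] z wz.
    by apply: vgeB => //; rewrite -gal_vge -(funext ws).
  have [c wc] := place_residue pw wz.
  have sc : s (z - cst F c) = s z - cst F c by rewrite rmorphB /= gal_cst.
  have -> : s z - z = f%:A * (s ((z - cst F c) / f%:A) - (z - cst F c) / f%:A).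
    rewrite mulrBr -{1}(gal_alg s f) -rmorphM ![f%:A * _]mulrC !divfK //.
    by rewrite /= sc; ring.
  rewrite vge_mull // wf (_ : r.+1%:Z - 1 = r%:Z); last by lia.
  by apply: IH; rewrite mulrC vge_mull ?invr_neq0 // dvalV // wf opprK add0r.
have int_fix z : vge w 0 z -> s z = z.
  move=> /approx H; apply/eqP; rewrite -subr_eq0; apply: contraT => nz.
  have := H `|w (s z - z)%R|.+1; rewrite vgeE //; lia.
apply/eqP/gal_eqP => z _; rewrite gal_id.
have [r wr] : exists r, vge w 0 (f%:A ^+ r * z).
  exists `|w z|%N; rewrite vge_mull ?expf_neq0 // dvalX // wf.
  by apply: vge_le (vge_val w z); lia.
by move: (int_fix _ wr); rewrite rmorphM rmorphXn /= gal_alg => /mulfI; apply; rewrite expf_neq0.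
Qed.

(** Suppose that [z] has a pole at [w]. Since the conjugates of [w] are distinct,
    some [b] is a unit at [w] and has zeros at all of them but [w]. For large
    [r], multiplying by [b ^+ r] and by a suitable function of [k(x)] leaves a
    simple pole at [w] and none at its other conjugates, so the trace has a pole,
    although the product is still in the complementary module. *)
Lemma unr_complementary z : complementary_module q z -> integral_closure q (z : F).
Proof.
have [w [e [pw wq]]] := place_over F pq; have vw := place_val pw.
have e1 : e = 1%N.
  case: wq => e0 H; apply/eqP; rewrite eqn_leq e0 andbT leqNgt.
  by apply/negP => lt; apply: unr; exists w, e.
rewrite {}e1 in wq => Cz; apply/(icl_iff galF z pw wq) => s0.
have := complementary_gal s0 pq Cz; move: (s0 z) => {Cz s0}z Cz.
apply: contrapT => /negP; rewrite vgeN_lt => /andP[nzz wz].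
have [f nzf qf] := place_attains (- w z - 1) pq.
have wf : w f%:A = - w z - 1 by case: wq => _ /(_ f) /= ->; rewrite qf mul1r.
pose x := z * f%:A.
have nzx : x != 0 by rewrite mulf_neq0 ?alg_neq0.
have wx : w x = -1 by rewrite dvalM ?alg_neq0 // wf; lia.
have Cx : complementary_module q x.
  apply: complementaryM => //; apply: icl_alg => //; rewrite vgeE // qf; lia.
have [y [nzy wy] Hy] : exists2 y, y != 0 /\ w y < 0 &
    forall s : gal_of {:F}, s \in enum [pred s | s != 1%g] -> 0 < w (s y).
  apply: (@place_approx _ _ _ w _ (fun (s : gal_of {:F}) z => w (s z)) _ pw) => s.
  rewrite mem_enum inE => ne; split; first exact: gal_place.
  by move=> E; case/eqP: ne; apply: (unr_decomposition pw wq).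
have {}Hy (s : gal_of {:F}) : s != 1%g -> 0 < w (s y) by move=> ne; apply: Hy; rewrite mem_enum.
have [nz1 w1] : y + 1 != 0 /\ w (y + 1) = w y.
  by apply: vge_add_dom; rewrite // vgeE ?oner_eq0 // dval1 //; lia.
pose b := y / (y + 1).
have wb : w b = 0 by rewrite dvalM ?invr_neq0 // dvalV // w1; lia.
have wsb (s : gal_of {:F}) : s != 1%g -> w (s b) = w (s y).
  move=> ne; rewrite /b rmorphM fmorphV rmorphD rmorph1.
  have [nz' w'] : 1 + s y != 0 /\ w (1 + s y) = w 1.
    apply: vge_add_dom; rewrite ?oner_eq0 // dval1 // vgeE ?gal_neq0 //.
    by rewrite add0r -gtz0_ge1 Hy.
  by rewrite addrC dvalM ?invr_neq0 ?gal_neq0 // dvalV // w' dval1 // subr0.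
have nzb : b != 0 by rewrite mulf_neq0 ?invr_neq0.
have [r Hr] : exists r : nat, forall s : gal_of {:F}, s != 1%g -> 0 <= r%:Z * w (s b) + w (s x).
  have [r Hr] : exists r, forall s : gal_of {:F}, (`|w (s x)%R| <= r)%N.
    exists (\max_(s : gal_of {:F}) `|w (s x)%R|)%N => s.
    exact: (@leq_bigmax _ (fun s : gal_of {:F} => `|w (s x)%R|%N)).
  exists r => s ne; rewrite wsb //; have := Hy _ ne; have := Hr s.
  by move: (w (s x)) (w (s y)) => a a'; clear; nia.
have : vge q 0 (trace galF (x * b ^+ r)).
  have := (complementaryP galF pq x).1 Cx (b ^+ r); apply.
  apply/(icl_iff galF _ pw wq) => s; rewrite vgeE ?gal_neq0 ?expf_neq0 //.
  rewrite rmorphXn /= dvalX //; have [->|ne] := eqVneq s 1%g; first by rewrite gal_id wb mulr0.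
  by rewrite wsb // mulr_ge0 // ltW // Hy.
rewrite -(lies_over_vge0 wq) trace_sum (bigD1 1%g) //= gal_id.
have nzxb : x * b ^+ r != 0 by rewrite mulf_neq0 ?expf_neq0.
have wxb : w (x * b ^+ r) = -1 by rewrite dvalM ?expf_neq0 // dvalX // wb wx mulr0 addr0.
have [nz wE] : x * b ^+ r + \sum_(s : gal_of {:F} | s != 1%g) s (x * b ^+ r) != 0 /\
    w (x * b ^+ r + \sum_(s : gal_of {:F} | s != 1%g) s (x * b ^+ r)) = w (x * b ^+ r).
  apply: vge_add_dom => //; rewrite wxb addNr; apply: vge_sum => // s ne.
  rewrite vgeE ?gal_neq0 // rmorphM rmorphXn /= dvalM ?expf_neq0 ?gal_neq0 // dvalX //.
  by rewrite addrC; apply: Hr.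
by rewrite vgeE // wE wxb.
Qed.

End Unramified.

End Ramification.

(** * Functions regular away from a totally ramified place *)

Lemma le0_opp_abs (u : int) : u <= 0 -> u = - `|u|%N%:Z.
Proof. lia. Qed.

(** The roots of a polynomial are multiplied by [a] when its coefficients are
    multiplied by powers of [a]. *)
Lemma root_scale (K : fieldType) (F : fieldExtType K) (m : {poly K}) n (a : K) (z : F) :
  (size m <= n.+1)%N -> root (map_poly (in_alg F) m) z ->
  root (map_poly (in_alg F) (\poly_(j < n.+1) (m`_j * a ^+ (n - j)))) (a *: z).
Proof.
move=> sm /eqP; rewrite (@horner_coef_wide _ n.+1) ?size_map_poly // => mz.
rewrite /root (@horner_coef_wide _ n.+1) ?size_map_poly ?size_poly //; apply/eqP.
transitivity ((a ^+ n)%:A * \sum_(i < n.+1) (map_poly (in_alg F) m)`_i * z ^+ i); last first.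
  by rewrite mz mulr0.
rewrite mulr_sumr; apply: eq_bigr => j _; rewrite !coef_map coef_poly ltn_ord exprZn /=.
have le : (j <= n)%N by rewrite -ltnS.
by rewrite -!scalerAl !mul1r !scalerA -mulrA -exprD subnK // mulrC.
Qed.

Section Regular.

Variables (k : closedFieldType) (F : splittingFieldType (ratfun k)).
Local Notation K := (ratfun k).
Local Notation N := (\dim {:F}).
Hypothesis galF : galois 1%AS {:F}.

Variables (v : F -> int) (q0 : K -> int) (d : nat).
Hypotheses (pv : is_place (@cst k F) v) (p0 : is_place (@cst0 k) q0).
Hypothesis tot : totally_ramified v q0.
Hypothesis diff : different_exponent v q0 d.
Let vv := place_val pv.

Definition regular0 (f : K) : Prop :=
  forall q, is_place (@cst0 k) q -> ~ q =1 q0 -> vge q 0 f.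

Definition regular (z : F) : Prop :=
  forall q, is_place (@cst0 k) q -> ~ q =1 q0 -> integral_closure q z.

(** Multiplied by the differential of a function on the line whose only pole is a
    simple one at [q0], these are the differentials regular away from [v]. *)
Definition coregular (z : F) : Prop :=
  forall q, is_place (@cst0 k) q -> ~ q =1 q0 -> complementary_module q z.

Lemma regular0M f g : regular0 f -> regular0 g -> regular0 (f * g).
Proof.
by move=> Rf Rg q pq nq; rewrite -[0](addr0 0); apply: (vgeM (place_val pq)); [apply: Rf | apply: Rg].
Qed.

Lemma regular0X f n : regular0 f -> regular0 (f ^+ n).
Proof.
by move=> Rf q pq nq; rewrite -(mulr0 n%:Z); apply: (vgeX (place_val pq)); apply: Rf.
Qed.

Lemma regular_alg f : regular0 f -> regular f%:A.
Proof. by move=> Rf q pq nq; apply: icl_alg => //; apply: Rf. Qed.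

Lemma regularM a b : regular a -> regular b -> regular (a * b).
Proof. by move=> Ra Rb q pq nq; apply: iclM => //; [apply: Ra | apply: Rb]. Qed.

Lemma regularB a b : regular a -> regular b -> regular (a - b).
Proof. by move=> Ra Rb q pq nq; apply: iclB => //; [apply: Ra | apply: Rb]. Qed.

Lemma regularZ f a : regular0 f -> regular a -> regular (f *: a).
Proof.
by move=> Rf Ra; rewrite -[a]mul1r scalerAl; apply: regularM => //; apply: regular_alg.
Qed.

Lemma regular_cst c : regular (cst F c).
Proof. by apply: regular_alg => q pq _; apply: vge_cst0. Qed.

Lemma coregularM a b : coregular a -> regular b -> coregular (a * b).
Proof. by move=> Ca Rb q pq nq; apply: complementaryM => //; [apply: Ca | apply: Rb]. Qed.

Lemma coregularB a b : coregular a -> coregular b -> coregular (a - b).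
Proof.
move=> Ca Cb q pq nq; apply/(complementaryP galF pq) => y iy.
rewrite mulrBl -scaleN1r traceD traceZ mulN1r; apply: (vgeB (place_val pq)).
  exact: (complementaryP galF pq a).1 (Ca _ pq nq) _ iy.
exact: (complementaryP galF pq b).1 (Cb _ pq nq) _ iy.
Qed.

Lemma coregular_gal (s : gal_of {:F}) a : coregular a -> coregular (s a).
Proof. by move=> Ca q pq nq; apply: complementary_gal => //; apply: Ca. Qed.

(** The norm of [z] is a function of [k(x)] that is regular away from [q0] and
    vanishes there. *)
Lemma regular_vanish z : regular z -> vge v 1 z -> z = 0.
Proof.
move=> Rz vz; apply/eqP; apply: contraT => nzz; rewrite vgeE // in vz.
have [f fE] : exists f : K, \prod_(s : gal_of {:F}) s z = f%:A.
  apply: fixed_alg => // t; rewrite rmorph_prod [RHS](reindex_inj (mulIg t)) /=.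
  by apply: eq_bigr => s _; rewrite galMv.
have nzp : \prod_(s : gal_of {:F}) s z != 0.
  by rewrite prodf_seq_neq0; apply/allP => s _; rewrite gal_neq0.
have card_gal : #|[set: gal_of {:F}]| = N.
  have := galois_dim galF; rewrite dimv1 divn1 => ->; apply: eq_card => s.
  by rewrite mem_gal1 inE.
have f0 : f = 0.
  apply: (regular_vanishing p0) => [q pq nq|].
    have [w [e [pw wq]]] := place_over F pq; rewrite -(lies_over_vge0 wq) -fE.
    apply: (vge_prod (place_val pw)) => s _.
    by have /(icl_iff galF z pw wq) := Rz _ pq nq.
  have vf : v f%:A = N%:Z * v z.
    rewrite -fE (dval_prod vv) => [|s _]; last by rewrite gal_neq0.
    under eq_bigr => s _ do rewrite (tot_gal s z pv tot).
    rewrite (eq_bigl (fun s => s \in [set: gal_of {:F}])); last by move=> s; rewrite inE.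
    by rewrite sumr_const card_gal -mulr_natl natz.
  apply/vgeP => _; have := tot_alg tot f; rewrite vf.
  by have := dim_gt0 tot; nia.
by rewrite fE f0 scale0r eqxx in nzp.
Qed.

Lemma regular_le0 z : regular z -> z != 0 -> v z <= 0.
Proof.
move=> Rz nzz; case: (lerP (v z) 0) => // lt; case/eqP: nzz.
by apply: regular_vanish => //; apply/vgeP => _; lia.
Qed.

Lemma regular_const_cst z : regular z -> vge v 0 z -> exists c, z = cst F c.
Proof.
move=> Rz vz; have [c vc] := place_residue pv vz; exists c.
apply/eqP; rewrite -subr_eq0; apply/eqP; apply: regular_vanish => //.
by apply: regularB => //; apply: regular_cst.
Qed.

Lemma regular_denominator z : exists2 a : K, a != 0 & regular0 a /\ regular (a *: z).
Proof.
have /polyOver1P[m mE] := minPolyOver 1%AS z.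
have mm : m \is monic by rewrite -(map_monic (in_alg F)) -mE monic_minPoly.
have [a nza [Ra Ram]] : exists2 a : K, a != 0 & regular0 a /\
    forall j, (j < size m)%N -> regular0 (a * m`_j).
  elim: (size m) => [|n [a nza [Ra Ram]]].
    exists 1; [exact: oner_neq0 | split=> // q pq _].
    by rewrite vgeE ?oner_eq0 // (dval1 (place_val pq)).
  have [b nzb Rb] := place_denominator m`_n p0.
  have Rb0 : regular0 b by move=> q pq nq; case: (Rb q pq nq).
  exists (a * b); first exact: (mulf_neq0 nza nzb).
  split=> [|j]; first exact: regular0M.
  rewrite ltnS leq_eqVlt => /predU1P[->|/Ram Raj].
    by rewrite -mulrA; apply: regular0M => // q pq nq; case: (Rb q pq nq).
  by rewrite mulrAC; apply: regular0M.
exists a => //; split=> // q pq nq.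
have sm : (size m).-1.+1 = size m by rewrite prednK // size_poly_gt0 monic_neq0.
set n := (size m).-1 in sm.
(* The coefficients of [r] other than the leading one have a factor [a]. *)
pose r : {poly K} := \poly_(j < n.+1) (m`_j * a ^+ (n - j)).
have rn : r`_n = 1 by rewrite coef_poly ltnSn subnn expr0 mulr1 -[m`_n]/(lead_coef m) (monicP mm).
have sr : size r = n.+1.
  apply/eqP; rewrite eqn_leq size_poly; apply: contraT; rewrite -ltnNge ltnS => le.
  by move/eqP: rn; rewrite nth_default // eq_sym oner_eq0.
exists r; split.
- by rewrite monicE /lead_coef sr /= rn eqxx.
- apply/(polyOver_val_ring _ (place_val pq)) => j; rewrite coef_poly.
  case: ltnP => [lt|_]; last exact: vge0.
  have [->|ne] := eqVneq j n.
    rewrite subnn expr0 mulr1 -[m`_n]/(lead_coef m) (monicP mm) vgeE ?oner_eq0 //.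
    by rewrite (dval1 (place_val pq)).
  have -> : (n - j = (n - j).-1.+1)%N by lia.
  rewrite exprS mulrCA mulrA; move: q pq nq; apply: regular0M; last exact: regular0X.
  by apply: Ram; rewrite -sm.
by apply: root_scale; [rewrite sm | rewrite -mE root_minPoly].
Qed.

(** A denominator of [z] may vanish at [q1]; dividing it by a power of a function
    with divisor [q1 - q0] removes this zero and affects no place but [q0]. *)
Lemma regular_localize q1 (z : F) : is_place (@cst0 k) q1 -> ~ q1 =1 q0 ->
  exists a : K, [/\ a != 0, q1 a = 0 &
    forall q, is_place (@cst0 k) q -> ~ q =1 q0 -> ~ q =1 q1 -> integral_closure q (a *: z)].
Proof.
move=> p1 n1; have [h [nzh h1 h0 hq]] := place_sep p1 p0 n1.
have [a nza [Ra Raz]] := regular_denominator z.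
have qa : 0 <= q1 a by have := Ra _ p1 n1; rewrite vgeE.
pose r := `|q1 a|%N; pose u := (h ^+ r)^-1; exists (u * a).
have nzu : u != 0 by exact: (invr_neq0 (expf_neq0 _ nzh)).
split; first exact: (mulf_neq0 nzu nza).
  rewrite (dvalM (place_val p1) nzu nza) (dvalV (place_val p1)) (dvalX (place_val p1)) h1.
  by rewrite /r; lia.
move=> q pq nq0 nq1; have -> : (u * a) *: z = u%:A * (a *: z) by rewrite -scalerAl mul1r scalerA.
apply: iclM => //; last exact: Raz.
apply: icl_alg => //; rewrite (vgeE _ _ nzu) (dvalV (place_val pq)) (dvalX (place_val pq)).
by rewrite (hq _ pq nq1 nq0) mulr0 oppr0.
Qed.

(** * Duality *)

Lemma regular_trace z y : coregular z -> regular y -> regular0 (trace galF (z * y)).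
Proof.
move=> Cz Ry q pq nq; exact: (complementaryP galF pq z).1 (Cz _ pq nq) _ (Ry _ pq nq).
Qed.

(** The half of duality that corresponds to the residue theorem: otherwise the
    trace of [z * y] would be nonzero, regular away from [q0], and zero at [q0]. *)
Lemma coregular_exclusion z y : coregular z -> z != 0 -> regular y -> y != 0 ->
  v z + v y <> 2 * N%:Z - 1 - d%:Z.
Proof.
move=> Cz nzz Ry nzy E.
have nz : z * y != 0 by rewrite mulf_neq0.
have vzy : v (z * y) = N%:Z * 2 - d%:Z - 1 by rewrite dvalM // E; lia.
case/eqP: (diff_trace_neq0 galF pv p0 tot diff nz vzy).
apply: (regular_vanishing p0); first exact: regular_trace.
apply: (diff_traceX galF pv p0 tot diff); rewrite vgeE // vzy.
by have := dim_gt0 tot; lia.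
Qed.

Variable q1 : K -> int.
Hypotheses (p1 : is_place (@cst0 k) q1) (ne1 : ~ q1 =1 q0).

Lemma simple_pole : exists2 x : K, x != 0 & regular0 x /\ q0 x = -1.
Proof.
have [h [nzh h1 h0 hq]] := place_sep p1 p0 ne1; exists h => //; split=> // q pq nq.
have [E|ne] := pselect (q =1 q1); first by rewrite (funext E) vgeE // h1.
by rewrite vgeE // hq.
Qed.

(** An Apery basis: a regular function of least pole order in each residue
    class modulo [N]. *)
Lemma apery_ex : exists f : 'I_N -> F, forall c,
  [/\ f c != 0, regular (f c), exists m, v (f c) = N%:Z * m - c%:Z &
    forall g m, g != 0 -> regular g -> v g = v (f c) + N%:Z * m -> m <= 0].
Proof.
suff /boolp.choice[f Hf] : forall c : 'I_N, exists f,
  [/\ f != 0, regular f, exists m, v f = N%:Z * m - c%:Z &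
    forall g m, g != 0 -> regular g -> v g = v f + N%:Z * m -> m <= 0] by exists f.
move=> c; pose Q a := `[< exists f, [/\ f != 0, regular f, v f = - a%:Z &
    exists m, v f = N%:Z * m - c%:Z] >].
have exQ : exists a, Q a.
  have [z nzz vz] := place_attains (- c%:Z) pv.
  have [a nza [Ra Raz]] := regular_denominator z.
  have nzaz : a *: z != 0 by exact: scale_neq0.
  have le := regular_le0 Raz nzaz.
  exists `|v (a *: z)|%N; apply/asboolP; exists (a *: z); split=> //; first exact: le0_opp_abs.
  by exists (q0 a); rewrite (tot_valZ pv tot nza nzz) vz.
case: (ex_minnP exQ) => a /asboolP[f [nzf Rf vf [m vm]]] amin.
exists f; split=> //; first by exists m.
move=> g m' nzg Rg vg; have le := regular_le0 Rg nzg.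
have : Q `|v g|%N.
  apply/asboolP; exists g; split=> //; first exact: le0_opp_abs.
  by exists (m + m'); rewrite vg vm; lia.
by move/amin; rewrite leNgt => le'; apply/negP => m0; have := dim_gt0 tot; nia.
Qed.

Section Apery.

Variable f : 'I_N -> F.
Hypothesis Hf : forall c,
  [/\ f c != 0, regular (f c), exists m, v (f c) = N%:Z * m - c%:Z &
    forall g m, g != 0 -> regular g -> v g = v (f c) + N%:Z * m -> m <= 0].

Lemma apery_neq0 c : f c != 0. Proof. by case: (Hf c). Qed.

Lemma apery_distinct i j m : v (f i) - v (f j) = N%:Z * m -> i = j.
Proof.
have [_ _ [mi ->] _] := Hf i; have [_ _ [mj ->] _] := Hf j => E; apply: val_inj.
apply: (eq_mod_lt (m := mi - mj - m) (ltn_ord i) (ltn_ord j)); lia.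
Qed.

Lemma apery_class b : exists c m, v (f c) = b + N%:Z * m.
Proof.
have N0 : N%:Z != 0 by have := dim_gt0 tot; lia.
have lt : (`|(- b %% N%:Z)%Z| < N)%N.
  by have := ltz_mod (- b) N0; have := modz_ge0 (- b) N0; lia.
have [_ _ [m vE] _] := Hf (Ordinal lt); exists (Ordinal lt).
exists (m + (- b %/ N%:Z)%Z); rewrite vE /=.
by have := divz_eq (- b) N%:Z; have := modz_ge0 (- b) N0; nia.
Qed.

(** The Apery basis generates the regular functions over those of [k(x)]: in its
    residue class the pole order of [z] is that of a basis element times a power
    of [x], whose multiple by a constant can be subtracted to lower the pole. *)
Lemma apery_generate z : regular z ->
  exists2 a : 'I_N -> K, forall c, regular0 (a c) & z = \sum_c a c *: f c.
Proof.
have [x nzx [Rx qx]] := simple_pole.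
move=> Rz; have [n] : exists n : nat, vge v (1 - n%:Z) z.
  by exists `|1 - v z|%N; apply: vge_le (vge_val v z); lia.
elim: n z Rz => [|n IH] z Rz vz.
  exists (fun=> 0) => [c q pq _|]; first exact: vge0.
  rewrite (regular_vanish Rz); last by move: vz; rewrite subr0.
  by rewrite big1 // => c _; rewrite scale0r.
have [->|nzz] := eqVneq z 0.
  exists (fun=> 0) => [c q pq _|]; first exact: vge0.
  by rewrite big1 // => c _; rewrite scale0r.
rewrite vgeE // in vz.
have [c [m vE]] := apery_class (v z).
have [nzf Rf _ fmin] := Hf c.
have m0 : - m <= 0 by apply: (fmin z) => //; rewrite vE; lia.
pose y := x ^+ `|m|%N *: f c.
have nzxm : x ^+ `|m|%N != 0 by exact: expf_neq0.
have nzy : y != 0 by exact: scale_neq0.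
have Ry : regular y by apply: regularZ => //; apply: regular0X.
have vy : v y = v z.
  rewrite (tot_valZ pv tot nzxm nzf) (dvalX (place_val p0)) qx vE; nia.
have [|e ve] := @place_residue _ _ _ (z / y) pv.
  by rewrite vgeE ?mulf_neq0 ?invr_neq0 // dvalM ?invr_neq0 // dvalV // vy subrr.
have [||a Ra aE] := IH (z - cst F e * y).
- by apply: regularB => //; apply: regularM => //; apply: regular_cst.
- rewrite -{1}(divfK nzy z) -mulrBl mulrC vge_mull //.
  by apply: vge_le ve; rewrite vy; lia.
exists (fun j => a j + (if j == c then cst0 e * x ^+ `|m|%N else 0)) => [j|].
  move=> q pq nq; apply: (vgeD (place_val pq)); first exact: Ra.
  case: eqP => _; last exact: vge0.
  rewrite -[0](addr0 0); apply: (vgeM (place_val pq)); first exact: vge_cst0.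
  exact: regular0X.
rewrite (eq_bigr (fun j => a j *: f j + (if j == c then cst F e * y else 0))).
  by rewrite big_split /= -big_mkcond big_pred1_eq -aE subrK.
move=> j _; rewrite scalerDl; congr (_ + _).
case: eqP => [->|_]; last by rewrite scale0r.
by rewrite /y -scalerA -[RHS]scalerAl mul1r.
Qed.

(** The trace form is nondegenerate, so its matrix in the Apery basis is
    invertible. *)
Lemma apery_dual : exists g : 'I_N -> F, forall c (a : 'I_N -> K),
  trace galF (g c * \sum_e a e *: f e) = a c.
Proof.
pose T : 'M[K]_N := \matrix_(c, e) trace galF (f c * f e).
have Tunit : T \in unitmx.
  rewrite -row_free_unit -kermx_eq0; apply/eqP/row_matrixP => i; rewrite row0.
  set u := row i (kermx T).
  have uT : u *m T = 0 by rewrite /u -row_mul mulmx_ker row0.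
  clearbody u.
  pose y := \sum_c u 0 c *: f c.
  have trace_y e : trace galF (y * f e) = 0.
    have /rowP/(_ e) := uT; rewrite !mxE => E; rewrite -[RHS]E mulr_suml trace_lsum.
    by apply: eq_bigr => c _; rewrite -scalerAl traceZ /T mxE.
  have y0 : y = 0.
    apply/eqP; apply: contraT => /(trace_nondeg galF)[b].
    have [a ->] := tot_basis pv tot apery_neq0 apery_distinct b.
    rewrite mulr_sumr trace_lsum big1 ?eqxx // => e _.
    by rewrite -scalerAr traceZ trace_y mulr0.
  apply/rowP => c; rewrite [RHS]mxE; apply/eqP; apply: contraT => nzu.
  have [] := tot_comb pv tot apery_neq0 apery_distinct (a := fun c => u 0 c) nzu.
  by rewrite -/y y0 eqxx.
have key c e : trace galF ((\sum_d (invmx T) c d *: f d) * f e) = (c == e)%:R.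
  have /matrixP/(_ c e) := mulVmx Tunit; rewrite !mxE => E.
  rewrite -E mulr_suml trace_lsum; apply: eq_bigr => j _.
  by rewrite -scalerAl traceZ /T ?mxE.
exists (fun c => \sum_e (invmx T) c e *: f e) => c a.
rewrite mulr_sumr trace_lsum (bigD1 c) //=.
have -> : trace galF ((\sum_e (invmx T) c e *: f e) * (a c *: f c)) = a c.
  by rewrite -scalerAr traceZ key eqxx mulr1.
rewrite big1 ?addr0 // => e ne.
by rewrite -scalerAr traceZ key eq_sym (negPf ne) mulr0.
Qed.

Variable g : 'I_N -> F.
Hypothesis Hg : forall c (a : 'I_N -> K), trace galF (g c * \sum_e a e *: f e) = a c.

Lemma dual_trace c : trace galF (g c * f c) = 1.
Proof.
have := Hg c (fun e => (e == c)%:R); rewrite /= eqxx => E; rewrite -[RHS]E; congr (trace _ (_ * _)).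
rewrite (bigD1 c) //= eqxx scale1r big1 ?addr0 // => e /negPf->.
by rewrite scale0r.
Qed.

Lemma dual_neq0 c : g c != 0.
Proof.
apply/eqP => g0; have := dual_trace c; rewrite g0 mul0r trace0 => /eqP.
by rewrite eq_sym oner_eq0.
Qed.

(** The trace of [g c] times a regular function is one of its coordinates, a
    regular function; and by [regular_localize] regular functions account for all
    functions that are integral at a given place. *)
Lemma dual_coregular c : coregular (g c).
Proof.
move=> q pq nq; apply/(complementaryP galF pq) => y iy.
have [a [nza qa Ha]] := regular_localize y pq nq.
have Ray : regular (a *: y).
  move=> q' pq' nq'; have [E|ne] := pselect (q' =1 q); last exact: Ha.
  rewrite (funext E) -[y]mul1r scalerAl; apply: iclM => //.
  by apply: icl_alg => //; rewrite vgeE // qa.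
have [b Rb bE] := apery_generate Ray.
have : vge q 0 (trace galF (g c * (a *: y))) by rewrite bE Hg; apply: Rb.
by rewrite -scalerAr traceZ (vge_mull (place_val pq)) // qa subr0.
Qed.

(** If the valuation were larger, the trace [1] of [g c * f c] would vanish at
    [q0]; it is not smaller, since the coordinates of an element in the Apery
    basis are bounded by its valuation. *)
Lemma dual_val c : v (g c) = N%:Z - 1 - d%:Z - v (f c).
Proof.
have nzf := apery_neq0 c; have nzg := dual_neq0 c; have N0 := dim_gt0 tot.
have up : v (g c) + v (f c) < N%:Z - d%:Z.
  rewrite ltNge; apply/negP => le.
  have : vge q0 1 (trace galF (g c * f c)).
    apply: (diff_traceX galF pv p0 tot diff).
    by rewrite vgeE ?mulf_neq0 // dvalM // mulr1.
  by rewrite dual_trace vgeE ?oner_eq0 // (dval1 (place_val p0)).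
suff : N%:Z - 1 - d%:Z - v (f c) <= v (g c) by lia.
pose M := v (f c) - N%:Z + 1.
have [y0 nzy0 vy0] := place_attains M pv.
have : complementary_module q0 (g c * y0).
  apply/(complementaryP galF p0) => y /(tot_icl galF pv tot) vy.
  rewrite -mulrA; have [a aE] := tot_basis pv tot apery_neq0 apery_distinct (y0 * y).
  rewrite aE Hg; apply/vgeP => nza.
  have [nz le] := tot_comb pv tot apery_neq0 apery_distinct nza.
  rewrite -aE in nz le; have : vge v M (y0 * y).
    by rewrite -[M]addr0; apply: vgeM => //; rewrite -vy0 vge_val.
  by rewrite vgeE // /M => le'; nia.
move/(diff_complementary galF pv p0 tot diff).
by rewrite vgeE ?mulf_neq0 // dvalM // vy0 /M; lia.
Qed.

End Apery.

(** Riemann-Roch for the multiples of one point: an integer is the valuation of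
    a coregular function exactly when its reflection is not that of a regular one.
    In one direction this is [coregular_exclusion]; in the other, a missing pole
    order lies below that of the Apery element of its class, and a multiple of the
    dual element by a power of [x] has the required valuation. *)
Lemma coregular_gap b : (exists z, [/\ z != 0, coregular z & v z = b]) <->
  ~ (exists y, [/\ y != 0, regular y & v y = 2 * N%:Z - 1 - d%:Z - b]).
Proof.
split=> [[z [nzz Cz vz]] [y [nzy Ry vy]]|none].
  by apply: (coregular_exclusion Cz nzz Ry nzy); rewrite vz vy; lia.
have [x nzx [Rx qx]] := simple_pole.
have [f Hf] := apery_ex; have [g Hg] := apery_dual Hf.
have [c [m vE]] := apery_class Hf (2 * N%:Z - 1 - d%:Z - b).
have [nzf Rf _ _] := Hf c.
have m0 : m < 0.
  rewrite ltNge; apply/negP => m0; apply: none; exists (x ^+ `|m|%N *: f c); split.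
  - exact: scale_neq0 (expf_neq0 _ nzx) nzf.
  - by apply: regularZ => //; apply: regular0X.
  - by rewrite (tot_valZ pv tot (expf_neq0 _ nzx) nzf) (dvalX (place_val p0)) qx vE; nia.
have nzg := dual_neq0 Hg c.
exists (x ^+ (`|m|%N).-1 *: g c); split.
- exact: scale_neq0 (expf_neq0 _ nzx) nzg.
- rewrite -[g c]mulr1 scalerAr; apply: coregularM; first exact: (dual_coregular Hf Hg).
  by apply: regular_alg; apply: regular0X.
- rewrite (tot_valZ pv tot (expf_neq0 _ nzx) nzg) (dvalX (place_val p0)) qx.
  by rewrite (dual_val Hf Hg) vE; nia.
Qed.

End Regular.

(** * Symmetric numerical semigroups *)

Section SymmetricSemigroup.

Variable H : nat -> Prop.
Hypotheses (H0 : H 0%N) (HD : forall a b, H a -> H b -> H (a + b)%N).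

(** As a set of integers, so that a reflection acts on it. *)
Definition int_semigroup (b : int) : Prop := 0 <= b /\ H `|b|%N.

Let h a := `[< H a >].
Let hP a : reflect (H a) (h a) := asboolP _.

Let size_filter_iota (P : pred nat) m :
  size [seq a <- iota 0 m | P a] = (\sum_(a < m) P a)%N.
Proof.
rewrite size_filter -sum1_count big_mkcond -{1}[m]subn0 -/(index_iota 0 m) big_mkord.
by apply: eq_bigr => a _; case: (P a).
Qed.

Let sum_rev m (P : pred nat) : (\sum_(a < m.+1) P (m - a)%N = \sum_(a < m.+1) P a)%N.
Proof. by rewrite [RHS](reindex_inj rev_ord_inj) /=; apply: eq_bigr => a _; rewrite subSS. Qed.

Let count_gaps m : (\sum_(a < m.+1) h a + \sum_(a < m.+1) ~~ h a = m.+1)%N.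
Proof.
rewrite -big_split /= (eq_bigr (fun=> 1%N)) => [|a _]; last by case: (h a).
by rewrite sum1_card card_ord.
Qed.

(** The condition on the largest gap says that reflection exchanges the
    semigroup and its complement: it always maps one into the other, and the
    count makes it onto. *)
Lemma symmetric_semigroup_iff : symmetric_semigroup H <->
  exists phi, forall b, int_semigroup b <-> ~ int_semigroup (phi - b).
Proof.
split=> [[gs [sgs gsP lgs]]|[phi Hphi]].
  case E : gs => [|g gs'].
    have Hall a : H a.
      case: a => [//|a]; apply: contrapT => nH.
      by have : a.+1 \in gs by [apply/gsP]; rewrite E.
    exists (-1) => b; rewrite /int_semigroup; case: (lerP 0 b) => b0.
      by split=> // _ []; lia.
    by split=> [[]//|]; case; split=> //; lia.
  set m := last 0%N gs in lgs.
  have sz : (0 < size gs)%N by rewrite E.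
  have mgs : m \in gs by rewrite /m E /= mem_last.
  have nHm : ~ H m by case/gsP: mgs.
  have gs_le a : a \in gs -> (a <= m)%N.
    move=> ags; rewrite /m -nth_last -(nth_index 0%N ags).
    have sl : sorted leq gs by apply: sub_sorted sgs => x y; apply: ltnW.
    apply: (sorted_leq_nth leq_trans leqnn 0%N sl); rewrite ?inE ?index_mem //.
      by rewrite prednK.
    by rewrite -ltnS prednK // index_mem.
  have H_gt a : (m < a)%N -> H a.
    move=> lt; apply: contrapT => nH; have : a \in gs by apply/gsP; split=> //; lia.
    by move/gs_le; lia.
  have sizeE : size gs = (\sum_(a < m.+1) ~~ h a)%N.
    rewrite -(size_filter_iota (fun a => ~~ h a)); apply: perm_size; apply: uniq_perm.
    - exact: (sorted_uniq ltn_trans ltnn).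
    - by rewrite filter_uniq ?iota_uniq.
    move=> a; rewrite mem_filter mem_iota add0n ltnS.
    apply/idP/andP => [ags|[/hP nH _]].
      by split; [apply/hP; case/gsP: (ags) | apply: gs_le].
    by apply/gsP; split=> //; case: a nH => // /(_ H0).
  have pair a : (a <= m)%N -> (h a + h (m - a) <= 1)%N.
    move=> le; case: hP => // Ha; case: hP => // Hma; case: nHm.
    by rewrite -(subnKC le); apply: HD.
  have pair1 a : (a <= m)%N -> (h a + h (m - a) = 1)%N.
    have : (\sum_(a < m.+1) (1 - (h a + h (m - a))) = 0)%N.
      have : (\sum_(a < m.+1) (1 - (h a + h (m - a))) + \sum_(a < m.+1) (h a + h (m - a)) = m.+1)%N.
        rewrite -big_split /= (eq_bigr (fun=> 1%N)) => [|b _].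
          by rewrite sum1_card card_ord.
        by rewrite subnK // pair // -ltnS.
      rewrite big_split /= (sum_rev m h); set X := (\sum_(a < m.+1) (1 - _))%N.
      have := count_gaps m; rewrite -sizeE; set Y := (\sum_(a < m.+1) h a)%N.
      by clearbody X Y => E1 E2; lia.
    move/eqP; rewrite sum_nat_eq0 => /forallP Hz le.
    by have := Hz (Ordinal (_ : a < m.+1)%N) => /(_ le) /=; have := pair a le; lia.
  exists m%:Z => b; rewrite /int_semigroup.
  case: (lerP 0 b) => b0; last first.
    split=> [[]//|]; case; split; first by lia.
    by apply: H_gt; lia.
  case: (lerP b m%:Z) => bm; last first.
    split=> [_ []|_]; first by lia.
    by split=> //; apply: H_gt; lia.
  have le : (`|b| <= m)%N by lia.
  have -> : `|m%:Z - b|%N = (m - `|b|)%N by lia.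
  have := pair1 _ le; case: hP => Hb; case: hP => Hmb // _.
    by split=> [_ []|].
  by split=> [[]//|]; case; split=> //; lia.
have HZ0 : int_semigroup 0 by split.
have phi_ge : -1 <= phi.
  have [H1 _] : int_semigroup (phi - -1); last by lia.
  by apply: contrapT => /(Hphi (-1)).2 [].
case: (eqVneq phi (-1)) => [phiE|ne].
  exists [::]; split=> // a; split=> // [[a0 nH]]; case: nH.
  have [_ +] : int_semigroup a%:Z by apply/Hphi => -[]; lia.
  by [].
pose m := `|phi|%N; have phiE : phi = m%:Z by lia.
have hrev a : (a <= m)%N -> h a = ~~ h (m - a).
  move=> le; apply/idP/idP => [/hP Ha|/hP nH].
    have /Hphi Hn : int_semigroup a%:Z by [].
    by apply/hP => Hma; apply: Hn; split; [lia | rewrite phiE (_ : `|_|%N = m - a)%N //; lia].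
  apply/hP; have [] // : int_semigroup a%:Z.
  apply/Hphi => -[_]; rewrite phiE (_ : `|_|%N = m - a)%N //; lia.
have nhm : ~~ h m by have := hrev 0%N (leq0n m); rewrite subn0 => <-; apply/hP.
exists [seq a <- iota 0 m.+1 | ~~ h a]; split.
- exact: (sorted_filter ltn_trans _ (iota_ltn_sorted _ _)).
- move=> a; rewrite mem_filter mem_iota add0n ltnS; split=> [/andP[/hP nH _]|[a0 nH]].
    by split=> //; case: a nH => // /(_ H0).
  apply/andP; split; first exact/hP.
  rewrite leqNgt; apply/negP => lt; apply: nH.
  by have [] : int_semigroup a%:Z by [apply/Hphi => -[]; lia].
- rewrite -addn1 iotaD filter_cat add0n /= nhm cats1 last_rcons size_rcons.
  have := count_gaps m; rewrite (eq_bigr (fun a : 'I_m.+1 => (~~ h (m - a)) : nat)).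
    rewrite (sum_rev m (fun a => ~~ h a)) -(size_filter_iota (fun a => ~~ h a)) -addn1 iotaD.
    by rewrite filter_cat add0n /= nhm cats1 size_rcons; lia.
  by move=> a _; rewrite hrev // -ltnS.
Qed.

End SymmetricSemigroup.

(** * Symmetry and the different *)

Lemma lies_over_inj (k : closedFieldType) (F : fieldExtType (ratfun k)) (w : F -> int) q q' e e' :
  is_place (@cst0 k) q -> is_place (@cst0 k) q' ->
  lies_over (in_alg F) w q e -> lies_over (in_alg F) w q' e' -> q =1 q'.
Proof.
move=> pq pq' [e0 wq] [e'0 wq'].
have E f : e%:Z * q f = e'%:Z * q' f by rewrite -wq -wq'.
have [f _ qf] := place_unif pq; have [f' _ qf'] := place_unif pq'.
have h1 := E f; have h2 := E f'; rewrite qf in h1; rewrite qf' in h2.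
have h3 : 0 < q' f by nia.
have h4 : 0 < q f' by nia.
have ee : e%:Z = e'%:Z by nia.
move=> z; apply: (mulfI (_ : e%:Z != 0)); first by lia.
by rewrite E ee.
Qed.

(** In characteristic [p], ['X^(p ^ n) - 1] is a power of ['X - 1]. *)
Lemma root_of_unity_char (k : fieldType) (p n N : nat) (c : k) :
  p \in [pchar k] -> N = (p ^ n)%N -> c ^+ N = 1 -> c = 1.
Proof.
move=> char_k -> cN; apply/eqP; rewrite -subr_eq0.
have : (c - 1) ^+ (p ^ n) = 0.
  have pN : [pchar k].-nat (p ^ n)%N by rewrite pnatX pnatE ?(pcharf_prime char_k) ?char_k.
  have := exprDn_pchar (c - 1) 1 pN; rewrite subrK cN expr1n => E.
  by apply: (addIr 1); rewrite -E add0r.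
by move/eqP; rewrite expf_eq0 => /andP[].
Qed.

Section Symmetry.

Variables (k : closedFieldType) (p n s : nat).
Variables (F : splittingFieldType (ratfun k)).
Variables (Q : 'I_s -> ratfun k -> int) (P : 'I_s -> F -> int) (delta : 'I_s -> nat).
Local Notation K := (ratfun k).
Local Notation N := (\dim {:F}).
Hypotheses (char_k : p \in [pchar k]) (galF : galois 1%AS {:F}).
Hypothesis degF : N = (p ^ n)%N.
Hypothesis Q_place : forall i, is_place (@cst0 k) (Q i).
Hypothesis Q_inj : forall i i', Q i =1 Q i' -> i = i'.
Hypothesis Q_ram : forall q, is_place (@cst0 k) q ->
  (ramified F q <-> exists i, q =1 Q i).
Hypothesis P_place : forall i, is_place (@cst k F) (P i).
Hypothesis P_total : forall i, totally_ramified (P i) (Q i).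
Hypothesis delta_diff : forall i, different_exponent (P i) (Q i) (delta i).

Variables (i i0 : 'I_s).
Hypothesis i0i : i0 != i.

Local Notation v := (P i).
Local Notation reg := (@regular k F (Q i)).
Local Notation coreg := (@coregular k F (Q i)).
Let pv := P_place i.
Let vv := place_val pv.
Let q0 := Q i.
Let p0 := Q_place i.

Let Q_neq j j' : j != j' -> ~ Q j =1 Q j'.
Proof. by move=> ne E; case/eqP: ne; apply: Q_inj. Qed.

(** [v] is the only place above [Q i]. *)
Lemma regular_places z :
  reg z <-> (forall u, is_place (@cst k F) u -> ~ u =1 v -> vge u 0 z).
Proof.
split=> [Rz u pu nu|Hz q pq nq].
  have [q [e [pq uq]]] := place_restrict pu.
  apply: (icl_vge pu uq); apply: Rz => // E; apply: nu => y.
  rewrite (funext E) in uq; apply/esym.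
  exact: (tot_unique galF pv (P_total i) pu uq).
have [w [e [pw wq]]] := place_over F pq.
apply/(icl_iff galF z pw wq) => t; rewrite -gal_vge; apply: Hz; first exact: gal_place.
move=> E; apply: nq; apply: (lies_over_inj pq p0 (gal_lies_over t wq)).
by rewrite (funext E); apply: P_total.
Qed.

Lemma weierstrass_regular a : weierstrass_semigroup v a <->
  exists y, [/\ y != 0, reg y & v y = - a%:Z].
Proof.
have pole0 (u : F -> int) y : y != 0 -> pole_order u y = 0%N <-> vge u 0 y.
  by move=> nz; rewrite /pole_order vgeE //; case: ltrP => h; split=> //; lia.
split=> [[y [nzy ya yreg]]|[y [nzy Ry vy]]].
  have Ry : reg y by apply/regular_places => u pu nu; apply/pole0 => //; apply: yreg.
  exists y; split=> //; have := regular_le0 galF pv p0 (P_total i) Ry nzy.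
  by move: ya; rewrite /pole_order; case: ltrP => h; lia.
exists y; split=> //.
  by rewrite /pole_order vy; case: ltrP => h; lia.
by move=> u pu nu; apply/pole0 => //; apply: (regular_places y).1.
Qed.

Lemma int_weierstrass b : int_semigroup (weierstrass_semigroup v) b <->
  exists y, [/\ y != 0, reg y & v y = - b].
Proof.
split=> [[b0 /weierstrass_regular[y [nzy Ry vy]]]|[y [nzy Ry vy]]].
  by exists y; split=> //; rewrite vy; lia.
have le := regular_le0 galF pv p0 (P_total i) Ry nzy.
split; first by lia.
by apply/weierstrass_regular; exists y; split=> //; rewrite vy; lia.
Qed.

Lemma int_weierstrass0 : int_semigroup (weierstrass_semigroup v) 0.
Proof.
apply/int_weierstrass; exists 1; rewrite oner_neq0 (dval1 vv) oppr0; split=> //.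
by rewrite -(rmorph1 (@cst k F)); apply: regular_cst.
Qed.

Lemma weierstrass_symmetric : symmetric_semigroup (weierstrass_semigroup v) <->
  exists phi, forall b, int_semigroup (weierstrass_semigroup v) b <->
    ~ int_semigroup (weierstrass_semigroup v) (phi - b).
Proof.
apply: symmetric_semigroup_iff; first by case: int_weierstrass0.
move=> a b /weierstrass_regular[y [nzy Ry vy]] /weierstrass_regular[z [nzz Rz vz]].
apply/weierstrass_regular; exists (y * z); split; first exact: mulf_neq0.
  exact: regularM.
by rewrite dvalM // vy vz; lia.
Qed.

Lemma coregular_val b : (exists z, [/\ z != 0, coreg z & v z = b]) <->
  ~ int_semigroup (weierstrass_semigroup v) (b + 1 + (delta i)%:Z - 2 * N%:Z).
Proof.
rewrite (coregular_gap galF pv p0 (P_total i) (delta_diff i) (Q_place i0) (Q_neq i0i)).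
rewrite int_weierstrass; split=> H [y [nzy Ry vy]]; apply: H; exists y; split=> //;
  by rewrite vy; lia.
Qed.

(** When the exponents are multiples of [N] the canonical divisors supported at
    the ramified places come from [k(x)], so that multiplication by a function
    exchanges regular and coregular functions. *)
Lemma divisible_symmetric : (forall j, j != i -> N %| delta j)%N ->
  symmetric_semigroup (weierstrass_semigroup v).
Proof.
move=> dvd; apply/weierstrass_symmetric.
have /boolp.choice[h Hh] : forall j, exists h : K, h != 0 /\ (j != i ->
    [/\ Q j h = 1, Q i h = -1 & forall q, is_place (@cst0 k) q -> ~ q =1 Q j ->
      ~ q =1 Q i -> q h = 0]).
  move=> j; have [->|ne] := eqVneq j i; first by exists 1; split; rewrite ?oner_neq0.
  by have [h [nzh h1 h2 h3]] := place_sep (Q_place j) p0 (Q_neq ne); exists h.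
pose u j : K := if j == i then 1 else h j ^+ (delta j %/ N).
have nzu j : u j != 0.
  rewrite /u; case: ifP => _; first by rewrite oner_eq0.
  by apply: expf_neq0; case: (Hh j).
pose c := \prod_(j <- enum 'I_s) u j.
have nzc : c != 0 by rewrite prodf_seq_neq0; apply/allP => j _; apply: nzu.
have qc q : is_place (@cst0 k) q -> q c = \sum_(j <- enum 'I_s) q (u j).
  by move=> pq; apply: (dval_prod (place_val pq)) => j _; exact: nzu.
have qu q j : is_place (@cst0 k) q -> ~ q =1 Q i -> ~ q =1 Q j -> q (u j) = 0.
  move=> pq nqi nqj; rewrite /u; case: (eqVneq j i) => [_|ne].
    exact: (dval1 (place_val pq)).
  by rewrite (dvalX (place_val pq)); case: (Hh j) => _ /(_ ne)[_ _ ->]; rewrite ?mulr0.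
have coregE z : coreg z <-> reg (c *: z).
  have main q : is_place (@cst0 k) q -> ~ q =1 Q i ->
      (complementary_module q z <-> integral_closure q (c *: z)).
    move=> pq nq; have [[j Ej]|nQ] := pselect (exists j, q =1 Q j).
      have ne : j != i by apply/eqP => E; apply: nq; rewrite -E.
      rewrite (funext Ej) (diff_complementary galF (P_place j) (Q_place j) (P_total j) (delta_diff j)).
      rewrite (tot_icl galF (P_place j) (P_total j)).
      have Qc : Q j c = (delta j %/ N)%:Z.
        rewrite (qc _ (Q_place j)) big_enum /= (bigD1 j) //= big1 => [|j' ne'].
          rewrite addr0 /u (negPf ne) (dvalX (place_val (Q_place j))).
          by case: (Hh j) => _ /(_ ne)[-> _ _]; rewrite mulr1.
        by apply: qu; [apply: Q_place | apply: Q_neq | apply: Q_neq; rewrite eq_sym].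
      rewrite (tot_vgeZE (P_place j) (P_total j) _ _ nzc) Qc sub0r -PoszM mulnC.
      by rewrite divnK ?dvd.
    have unr : ~ ramified F q by move=> /(Q_ram pq).
    have q_c : q c = 0.
      rewrite (qc _ pq); apply: big1 => j _; apply: (qu _ _ pq nq) => E.
      by apply: nQ; exists j.
    rewrite (icl_unitZ galF pq _ nzc q_c); split.
      exact: unr_complementary.
    exact: icl_complementary.
  split=> [Cz q pq nq|Rz q pq nq].
    by apply/(main q pq nq); apply: Cz.
  by apply/(main q pq nq); apply: Rz.
have gap b : int_semigroup (weierstrass_semigroup v) b <->
    exists z, [/\ z != 0, coreg z & v z = - b - N%:Z * Q i c].
  rewrite int_weierstrass; split=> [[y [nzy Ry vy]]|[z [nzz Cz vz]]].
    exists (c^-1 *: y); split.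
    - exact: scale_neq0 (invr_neq0 nzc) nzy.
    - by apply/coregE; rewrite scalerA divff // scale1r.
    - by rewrite (tot_valZ pv (P_total i) (invr_neq0 nzc) nzy) (dvalV (place_val p0)) vy; lia.
  exists (c *: z); split; first exact: scale_neq0.
    exact/coregE.
  by rewrite (tot_valZ pv (P_total i) nzc nzz) vz; lia.
exists ((delta i)%:Z + 1 - 2 * N%:Z - N%:Z * Q i c) => b.
rewrite gap coregular_val.
by rewrite (_ : - b - _ + _ + _ - _ = (delta i)%:Z + 1 - 2 * N%:Z - N%:Z * Q i c - b) //; lia.
Qed.

(** If the semigroup is symmetric, the valuations of coregular functions are
    those of the multiples of [z0] by regular functions, where [z0] is a
    coregular function of largest valuation; by descent on the pole order [z0]
    then generates the coregular functions. A conjugate of [z0] does too, so it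
    is a constant multiple of [z0]; the constant is a root of unity of order a
    power of [p], that is, [1]. *)
Lemma symmetric_generator : symmetric_semigroup (weierstrass_semigroup v) ->
  exists f : K, [/\ f != 0, coreg f%:A & forall z, coreg z -> reg (z / f%:A)].
Proof.
case/weierstrass_symmetric => phi Hphi.
pose b0 := phi - 1 - (delta i)%:Z + 2 * N%:Z.
have valP b : (exists z, [/\ z != 0, coreg z & v z = b]) <->
    int_semigroup (weierstrass_semigroup v) (b0 - b).
  have e : phi - (b0 - b) = b + 1 + (delta i)%:Z - 2 * N%:Z by rewrite /b0; lia.
  by rewrite coregular_val -e; apply: iff_sym; apply: Hphi.
have [z0 [nz0 Cz0 vz0]] : exists z, [/\ z != 0, coreg z & v z = b0].
  by apply/valP; rewrite subrr; apply: int_weierstrass0.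
have gen (z : F) : coreg z -> reg (z / z0).
  have [m] : exists m : nat, vge v (b0 + 1 - m%:Z) z.
    by exists `|(b0 + 1 - v z)%R|%N; apply: vge_le (vge_val v z); lia.
  elim: m z => [|m IH] z vz Cz.
    have -> : z = 0.
      apply/eqP; apply: contraT => nzz; have [] : int_semigroup (weierstrass_semigroup v) (b0 - v z).
        by apply/valP; exists z.
      by move: vz; rewrite vgeE //; lia.
    by rewrite mul0r -(rmorph0 (@cst k F)); apply: regular_cst.
  have [->|nzz] := eqVneq z 0.
    by rewrite mul0r -(rmorph0 (@cst k F)); apply: regular_cst.
  have /int_weierstrass[y [nzy Ry vy]] : int_semigroup (weierstrass_semigroup v) (b0 - v z).
    by apply/valP; exists z.
  have nzx : z0 * y != 0 by apply: mulf_neq0.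
  have vx : v (z0 * y) = v z by rewrite dvalM // vz0 vy opprB subrKC.
  have [|c vc] := @place_residue _ _ _ (z / (z0 * y)) pv.
    by rewrite vgeE ?mulf_neq0 ?invr_neq0 // dvalM ?invr_neq0 // dvalV // vx subrr.
  have Ryc : reg (y * cst F c) by apply: regularM => //; apply: regular_cst.
  have := IH (z - z0 * (y * cst F c)) _ _.
  have -> : (z - z0 * (y * cst F c)) / z0 = z / z0 - y * cst F c.
    by rewrite mulrBl; congr (_ - _); rewrite mulrAC divff // mul1r.
  move=> IHz; rewrite -[z / z0](subrK (y * cst F c)) -[X in _ + X]opprK.
  apply: regularB => //; last first.
    rewrite -[- _]sub0r; apply: regularB => //.
    by rewrite -(rmorph0 (@cst k F)); apply: regular_cst.
  apply: IHz.
    have -> : z - z0 * (y * cst F c) = (z0 * y) * (z / (z0 * y) - cst F c).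
      by rewrite mulrBr (mulrC _ (z / _)) divfK // mulrA.
    rewrite vge_mull //; apply: vge_le vc; rewrite vx.
    by move: vz; rewrite vgeE //; lia.
  by apply: coregularB => //; apply: coregularM.
have prop (t : gal_of {:F}) : exists c, t z0 = cst F c * z0.
  have Ct : reg (t z0 / z0) by apply: gen; apply: coregular_gal.
  have nzt : t z0 / z0 != 0 by rewrite mulf_neq0 ?invr_neq0 ?gal_neq0.
  have [|c E] := regular_const_cst galF pv p0 (P_total i) Ct.
    by rewrite vgeE // dvalM ?invr_neq0 ?gal_neq0 // dvalV // (tot_gal t z0 pv (P_total i)) subrr.
  by exists c; rewrite -E divfK.
have fix0 (t : gal_of {:F}) : t z0 = z0.
  have [c E] := prop t.
  have pow m : (t ^+ m)%g z0 = cst F (c ^+ m) * z0.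
    elim: m => [|m IH]; first by rewrite expg0 gal_id expr0 rmorph1 mul1r.
    by rewrite expgSr galMv IH rmorphM /= gal_cst E exprSr rmorphM mulrA.
  have : (t ^+ #|'Gal({:F} / 1%AS)|)%g = 1%g by apply: expg_cardG; apply: mem_gal1.
  have := galois_dim galF; rewrite dimv1 divn1 => <- tN.
  have := pow N; rewrite tN gal_id -[X in X = _]mul1r => /(mulIf nz0)/esym.
  rewrite -(rmorph1 (@cst k F)) => /fmorph_inj/(root_of_unity_char char_k degF) c1.
  by rewrite E c1 rmorph1 mul1r.
have [f fE] := fixed_alg galF fix0; exists f; rewrite -fE; split=> //.
by rewrite -(alg_neq0 F) -fE.
Qed.

(** At [P j] coregular means of valuation at least [- delta j]. The generator [f]
    reaches that bound, and as an element of [k(x)] it has a valuation divisible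
    by [N] there. *)
Lemma symmetric_divisible : symmetric_semigroup (weierstrass_semigroup v) ->
  forall j, j != i -> (N %| delta j)%N.
Proof.
case/symmetric_generator => f [nzf Cf genf] j ne.
have pj := P_place j; have vj := place_val pj; have nq := Q_neq ne.
have diffj := diff_complementary galF pj (Q_place j) (P_total j) (delta_diff j).
have le1 : - (delta j)%:Z <= N%:Z * Q j f.
  have := (diffj _).1 (Cf _ (Q_place j) nq).
  by rewrite vgeE ?alg_neq0 // (tot_alg (P_total j)).
have [y nzy vy] := place_attains (- (delta j)%:Z) pj.
have [a [nza qa Ha]] := regular_localize galF (Q_place i) y (Q_place j) nq.
have Cay : coreg (a *: y).
  move=> q pq nqi; have [E|nqj] := pselect (q =1 Q j); last first.
    by apply: icl_complementary => //; apply: Ha.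
  have -> : a *: y = y * a%:A by rewrite -scalerAr mulr1.
  rewrite (funext E); apply: complementaryM => //.
    by apply/diffj; rewrite vgeE // vy.
  by apply: icl_alg; rewrite // vgeE // qa.
have /(tot_icl galF pj (P_total j)) := genf _ Cay _ (Q_place j) nq.
have nzay : a *: y != 0 by exact: scale_neq0.
have nzfA : f%:A != 0 :> F by rewrite alg_neq0; exact: nzf.
rewrite vgeE ?mulf_neq0 ?invr_neq0 // dvalM ?invr_neq0 // dvalV //.
rewrite (tot_valZ pj (P_total j) nza nzy) qa vy (tot_alg (P_total j)) => le2.
have E : (delta j)%:Z = N%:Z * - Q j f.
  by move: le1 le2; move: (N) (delta j) (Q j f) => b c u; clear; lia.
have : (N%:Z %| (delta j)%:Z)%Z by rewrite E dvdz_mulr.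
by rewrite dvdzE.
Qed.

End Symmetry.

(** * Ramification in a cyclic extension of degree [p ^ n] *)

Section WildRamification.

Variables (k : closedFieldType) (p n : nat) (F : splittingFieldType (ratfun k)).
Local Notation K := (ratfun k).
Local Notation N := (\dim {:F}).
Hypotheses (char_k : p \in [pchar k]) (galF : galois 1%AS {:F}).
Hypothesis degF : N = (p ^ n.+1)%N.

Variables (w : F -> int) (q : K -> int) (d : nat).
Hypotheses (pw : is_place (@cst k F) w) (pq : is_place (@cst0 k) q).
Hypothesis tot : totally_ramified w q.
Hypothesis diff : different_exponent w q d.
Let vw := place_val pw.

Variable t : F.
Hypotheses (nzt : t != 0) (wt : w t = 1).

Let p_pr : prime p. Proof. exact: pcharf_prime char_k. Qed.
Let p_gt1 : (1 < p)%N. Proof. exact: prime_gt1. Qed.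

Lemma gal_fix_unif (s : gal_of {:F}) : s t = t -> s = 1%g.
Proof.
move=> st; apply/eqP/gal_eqP => z _; rewrite gal_id.
have [a -> _] := tot_powers pw tot nzt wt z; rewrite rmorph_sum; apply: eq_bigr => j _.
by rewrite /= linearZ /= rmorphXn /= st.
Qed.

Lemma card_galois : #|'Gal({:F} / 1%AS)%g| = N.
Proof. by rewrite -(galois_dim galF) dimv1 divn1. Qed.

Section OneAutomorphism.

Variable s : gal_of {:F}.
Hypothesis s1 : s != 1%g.

(** The lower ramification number of [s]. *)
Definition ram_num : int := w (s t - t) - 1.

Lemma ram_moves : s t - t != 0.
Proof. by rewrite subr_eq0; apply: contra s1 => /eqP/gal_fix_unif->. Qed.

(** The ramification is wild: the multiplier of [s] on the cotangent line is a
    root of unity of order a power of [p]. *)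
Lemma ram_num_gt0 : 1 <= ram_num.
Proof.
have nzst : s t != 0 by rewrite gal_neq0.
have [|c wc] := @place_residue _ _ w (s t / t) pw.
  by rewrite vgeE ?mulf_neq0 ?invr_neq0 // dvalM ?invr_neq0 // dvalV // (tot_gal _ _ pw tot) subrr.
have {wc} sE : vge w 2 (s t - cst F c * t).
  have -> : s t - cst F c * t = t * (s t / t - cst F c) by rewrite mulrBr mulrCA divff // mulr1 (mulrC t).
  by rewrite vge_mull // wt.
have vge_gal (u : gal_of {:F}) m z : vge w m z -> vge w m (u z).
  by rewrite /vge fmorph_eq0 (tot_gal u z pw tot).
have vge_cst e z m : vge w m z -> vge w m (cst F e * z).
  by move=> wz; rewrite -[m]add0r; apply: vgeM => //; rewrite /vge (place_cst _ pw) lexx orbT.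
have pow m : vge w 2 ((s ^+ m)%g t - cst F (c ^+ m) * t).
  elim: m => [|m IH].
    by rewrite expg0 gal_id expr0 rmorph1 mul1r subrr vge0.
  have -> : (s ^+ m.+1)%g t - cst F (c ^+ m.+1) * t =
      s ((s ^+ m)%g t - cst F (c ^+ m) * t) + cst F (c ^+ m) * (s t - cst F c * t).
    by rewrite expgSr galMv rmorphB rmorphM /= gal_cst exprSr rmorphM /=; ring.
  by apply: vgeD => //; [apply: vge_gal | apply: vge_cst].
have := pow #|'Gal({:F} / 1%AS)%g|; rewrite expg_cardG ?mem_gal1 // gal_id card_galois.
have -> : t - cst F (c ^+ N) * t = cst F (1 - c ^+ N) * t.
  by rewrite rmorphB rmorph1 mulrBl mul1r.
move=> w2; have c1 : c ^+ N = 1.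
  apply/eqP; rewrite eq_sym -subr_eq0; apply: contraT => nz.
  have nzc : cst F (1 - c ^+ N) != 0 by rewrite fmorph_eq0.
  by move: w2; rewrite vgeE ?mulf_neq0 // dvalM // (place_cst _ pw) wt.
have {c1} c1 := root_of_unity_char char_k degF c1.
rewrite c1 rmorph1 mul1r in sE.
have : 2 <= w (s t - t) by rewrite -vgeE ?ram_moves.
by rewrite /ram_num lerBrDr.
Qed.

Lemma ram_vge0 z : vge w 0 z -> vge w (ram_num + 1) (s z - z).
Proof.
move=> wz; have [a zE Ha] := tot_powers pw tot nzt wt z.
rewrite {1 2}zE rmorph_sum -sumrB; apply: vge_sum => // j _.
rewrite /= linearZ /= -scalerBr rmorphXn /= subrXX.
have [->|nz] := eqVneq (a j) 0; first by rewrite scale0r vge0.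
have qa : vge q 0 (a j).
  have le := Ha _ wz j nz; rewrite vgeE //; have := ltn_ord j.
  by move: (nat_of_ord j) le => j' le lt; nia.
rewrite (tot_vgeZE pw tot _ _ nz) -[s t - t in X in vge _ _ X]mulr1 -mulrA mul1r.
rewrite vge_mull ?ram_moves //.
apply: (@vge_le _ _ 0); first by move: qa; rewrite vgeE // /ram_num; have := dim_gt0 tot; nia.
apply: vge_sum => // l _; rewrite -[0](addr0 0); apply: vgeM => //.
  by rewrite -(mulr0 (j.-1 - l)%N%:Z) vgeX // vgeE ?gal_neq0 // (tot_gal _ _ pw tot) wt.
by rewrite -(mulr0 l%:Z) vgeX // vgeE // wt.
Qed.

Lemma ram_powers a : vge w (a%:Z + ram_num) (s (t ^+ a) - t ^+ a).
Proof.
case: a => [|a]; first by rewrite expr0 rmorph1 subrr vge0.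
rewrite rmorphXn /= subrXX vge_mull ?ram_moves //.
rewrite (_ : a.+1%:Z + ram_num - w (s t - t) = a%:Z); last by rewrite /ram_num; lia.
apply: vge_sum => // l _; have := ltn_ord l; rewrite ltnS => le.
rewrite vgeE ?mulf_neq0 ?expf_neq0 ?gal_neq0 // dvalM ?expf_neq0 ?gal_neq0 //.
by rewrite !dvalX // (tot_gal _ _ pw tot) wt; lia.
Qed.

Lemma ram_scale f z : s (f *: z) - f *: z = f *: (s z - z).
Proof. by rewrite linearZ scalerBr. Qed.

(** Scaling by [k(x)] commutes with [s], which reduces a question on an element of
    any valuation to one of valuation that of some [t ^+ a]. *)
Lemma scale_nonneg m : exists2 f : K, f != 0 & 0 <= m + N%:Z * q f.
Proof.
have [f nzf qf] := place_attains `|m|%N%:Z pq; exists f => //; rewrite qf.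
by have := dim_gt0 tot; nia.
Qed.

(** By the twisted Leibniz rule for [s - 1], applied to [t ^+ a] and an integral
    cofactor. *)
Lemma ram_vge m z : vge w m z -> vge w (m + ram_num) (s z - z).
Proof.
have [f nzf m0] := scale_nonneg m => wz.
have : vge w (m + N%:Z * q f) (f *: z).
  by rewrite (tot_vgeZE pw tot _ _ nzf); apply: vge_le wz; lia.
case E : (m + N%:Z * q f) m0 => [a|//] _ wfz.
suff : vge w (a%:Z + ram_num) (f *: (s z - z)).
  by rewrite (tot_vgeZE pw tot _ _ nzf); apply: vge_le; lia.
rewrite -ram_scale; move: (f *: z) wfz => {wz}y wy.
have -> : s y - y = s (t ^+ a) * (s (y / t ^+ a) - y / t ^+ a) + (s (t ^+ a) - t ^+ a) * (y / t ^+ a).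
  rewrite mulrBr -rmorphM !(mulrC _ (y / t ^+ a)) divfK ?expf_neq0 // mulrBr divfK ?expf_neq0 //.
  by rewrite addrA subrK.
have wy' : vge w 0 (y / t ^+ a).
  by rewrite mulrC vge_mull ?invr_neq0 ?expf_neq0 // dvalV // dvalX // wt mulr1 opprK add0r.
apply: vgeD => //.
  rewrite vge_mull ?gal_neq0 ?expf_neq0 // (tot_gal _ _ pw tot) dvalX // wt.
  by apply: vge_le (ram_vge0 wy'); lia.
by rewrite -[X in vge w X]addr0; apply: vgeM => //; apply: ram_powers.
Qed.

Lemma nat_neq0 (a : nat) : ~~ (p %| a)%N -> (a%:R != 0 :> F) /\ w a%:R = 0.
Proof.
move=> pa; rewrite -(rmorph_nat (@cst k F)) (place_cst _ pw) fmorph_eq0.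
by rewrite -(dvdn_pcharf char_k).
Qed.

(** The jump is exact on elements of valuation prime to [p], because the
    derivative of [t ^+ a] does not vanish for [a] prime to [p]. *)
Lemma ram_exact z : z != 0 -> ~~ (p%:Z %| w z)%Z ->
  s z - z != 0 /\ w (s z - z) = w z + ram_num.
Proof.
move=> nzz pz; have [f nzf m0] := scale_nonneg (w z).
have nzfz : f *: z != 0 by exact: scale_neq0.
have wfz : w (f *: z) = w z + N%:Z * q f by rewrite (tot_valZ pw tot nzf nzz) addrC.
case E : (w z + N%:Z * q f) m0 => [a|//] _.
have pa : ~~ (p %| a)%N.
  apply: contra pz => pa; have -> : w z = a%:Z - N%:Z * q f by rewrite -E addrK.
  rewrite rpredB ?dvdz_mulr ?dvdzE //= degF dvdn_exp //.
suff : f *: (s z - z) != 0 /\ w (f *: (s z - z)) = a%:Z + ram_num.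
  rewrite scaler_eq0 negb_or nzf /= => -[nz]; rewrite (tot_valZ pw tot nzf nz) => h.
  by split; [exact: nz | move: h wfz E; clear; lia].
rewrite -ram_scale; move: (f *: z) nzfz wfz => y nzy; rewrite {}E => wy {z nzz pz nzf f}.
case: a pa wy => [|a] pa wy; first by rewrite dvdn0 in pa.
have [|c wc] := @place_residue _ _ w (y / t ^+ a.+1) pw.
  rewrite vgeE ?mulf_neq0 ?invr_neq0 ?expf_neq0 // dvalM ?invr_neq0 ?expf_neq0 // dvalV // dvalX //.
  by rewrite wy wt mulr1 subrr.
have nzta : t ^+ a.+1 != 0 by rewrite expf_neq0.
pose y' := y - cst F c * t ^+ a.+1.
have wy' : vge w (a.+1%:Z + 1) y'.
  have -> : y' = t ^+ a.+1 * (y / t ^+ a.+1 - cst F c).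
    by rewrite /y' mulrBr mulrCA divff // mulr1 (mulrC (t ^+ a.+1)).
  by rewrite vge_mull // dvalX // wt mulr1; apply: vge_le wc; lia.
have nzc : cst F c != 0.
  by apply/eqP => c0; move: wy'; rewrite /y' c0 mul0r subr0 vgeE // wy gerDl.
pose S := \sum_(l < a.+1) s t ^+ (a - l) * t ^+ l.
have SE : s (t ^+ a.+1) - t ^+ a.+1 = (s t - t) * S by rewrite rmorphXn /= subrXX.
have ram0 := ram_num_gt0.
have [r [rE nzr wr]] : exists r : F, [/\ r = a.+1%:R, r != 0 & w r = 0].
  by have [nza wa] := nat_neq0 pa; exists a.+1%:R.
have nzat : r * t ^+ a != 0 by rewrite mulf_neq0 ?expf_neq0.
have wat : w (r * t ^+ a) = a%:Z by rewrite dvalM ?expf_neq0 // wr dvalX // wt mulr1 add0r.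
have [nzS wS] : S != 0 /\ w S = a%:Z.
  have -> : S = r * t ^+ a + \sum_(l < a.+1) (s t ^+ (a - l) * t ^+ l - t ^+ a).
    by rewrite sumrB sumr_const card_ord -mulr_natl -rE addrC subrK.
  have [] := @vge_add_dom _ _ vw _ (\sum_(l < a.+1) (s t ^+ (a - l) * t ^+ l - t ^+ a)) nzat.
    rewrite wat; apply: vge_sum => // l _; have := ltn_ord l; rewrite ltnS => le.
    have -> : s t ^+ (a - l) * t ^+ l - t ^+ a = t ^+ l * (s (t ^+ (a - l)) - t ^+ (a - l)).
      by rewrite mulrBr -exprD subnKC // rmorphXn /= mulrC.
    rewrite vge_mull ?expf_neq0 // dvalX // wt.
    have le' : a%:Z + 1 - l%:Z * 1 <= (a - l)%N%:Z + ram_num by move: ram0 le; clear; lia.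
    exact: vge_le le' (ram_powers _).
  by move=> nz ->.
have -> : s y - y = cst F c * ((s t - t) * S) + (s y' - y').
  by rewrite -SE /y' rmorphB rmorphM /= gal_cst; ring.
have nz1 : cst F c * ((s t - t) * S) != 0 by rewrite !mulf_neq0 ?ram_moves.
have w1 : w (cst F c * ((s t - t) * S)) = a.+1%:Z + ram_num.
  rewrite (dvalM vw nzc (mulf_neq0 ram_moves nzS)) (dvalM vw ram_moves nzS).
  by rewrite (place_cst c pw) wS /ram_num; move: (w (s t - t)) => u; clear; lia.
have wy'' : vge w (w (cst F c * ((s t - t) * S)) + 1) (s y' - y').
  have := ram_vge wy'; rewrite w1; apply: vge_le; move: ram_num => u; clear; lia.
by have [nz2 ->] := vge_add_dom vw nz1 wy''; rewrite w1.
Qed.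

End OneAutomorphism.

(** Hilbert's formula for the different, from Euler's formula for the traces of
    [t ^+ j / f^`() t], where [f] is the minimal polynomial of [t]. *)
Let f' := \prod_(s : gal_of {:F} | s != 1%g) (t - s t).

Let nzf' : f' != 0.
Proof.
apply/prodf_neq0 => s s1; rewrite -oppr_eq0 opprB; exact: ram_moves.
Qed.

Let gal_f' (s : gal_of {:F}) : s f' = \prod_(u : gal_of {:F} | u != s) (s t - u t).
Proof.
rewrite rmorph_prod [RHS](reindex_inj (mulIg s)) /=; apply: eq_big => [u|u _].
  by rewrite -(inj_eq (mulIg s)) mul1g.
by rewrite rmorphB galMv.
Qed.

Let cardG : #|{: gal_of {:F}}| = N.
Proof. by rewrite -card_galois; apply: eq_card => s; rewrite mem_gal1. Qed.

Let count_others (s : gal_of {:F}) :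
  count (fun u => u != s) (index_enum (gal_of {:F})) = N.-1.
Proof.
rewrite -sum1_count (eq_bigl (fun u => u \in predC1 s)) //.
by rewrite sum1_card cardC1 cardG.
Qed.

Let sum_lagrange j : (j < N)%N ->
  \sum_(s : gal_of {:F}) (s t ^+ j / s f') *: \prod_(u : gal_of {:F} | u != s) ('X - (u t)%:P) = 'X^j.
Proof.
move=> ltj; apply/eqP; rewrite -subr_eq0; apply: contraT => nz.
set D := _ - _ in nz.
have szp (s : gal_of {:F}) : size (\prod_(u : gal_of {:F} | u != s) ('X - (u t)%:P)) = N.
  rewrite -big_filter size_prod_XsubC size_filter count_others.
  by rewrite prednK // (dim_gt0 tot).
have szD : (size D <= N)%N.
  rewrite (leq_trans (size_polyD _ _)) // geq_max size_polyN size_polyXn ltj andbT.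
  apply: (leq_trans (size_sum _ _ _)); apply/bigmax_leqP => s _.
  by rewrite (leq_trans (size_scale_leq _ _)) ?szp.
have rootD (u : gal_of {:F}) : root D (u t).
  rewrite /root /D hornerD hornerN hornerXn horner_sum (bigD1 u) //= [X in _ + X - _]big1.
    rewrite addr0 hornerZ horner_prod.
    rewrite (eq_bigr (fun v : gal_of {:F} => u t - v t)) => [|v _]; last by rewrite hornerXsubC.
    by rewrite -gal_f' divfK ?gal_neq0 // subrr.
  move=> s su; rewrite hornerZ horner_prod (bigD1 u) 1?eq_sym //= hornerXsubC subrr.
  by rewrite mul0r mulr0.
pose rs := [seq u t | u : gal_of {:F}].
have urs : uniq rs.
  rewrite map_inj_uniq ?enum_uniq // => u v uv.
  have E : (u * v^-1)%g t = t by rewrite galMv uv galVK.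
  by have /eqP := gal_fix_unif E; rewrite -eq_mulgV1 => /eqP.
have ars : all (root D) rs by apply/allP => _ /mapP[u _ ->]; apply: rootD.
have := max_poly_roots nz ars urs.
by rewrite size_map -cardE cardG ltnNge szD.
Qed.

Let trace_euler j : (j < N)%N -> trace galF (t ^+ j / f') = (j == N.-1)%:R.
Proof.
move=> ltj; apply: (alg_inj (F := F)); rewrite trace_sum.
have := congr1 (fun r : {poly F} => r`_N.-1) (sum_lagrange ltj).
rewrite coef_sum coefXn eq_sym => E.
have -> : ((j == N.-1)%:R : K)%:A = (j == N.-1)%:R :> F.
  by case: eqP; rewrite ?scale1r ?scale0r.
rewrite -E; apply: eq_bigr => s _; rewrite coefZ rmorphM fmorphV rmorphXn /=.
set r := \prod_(u | _) _.
have mr : r \is monic by apply: monic_prod => u _; apply: monicXsubC.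
have sr : size r = N.
  rewrite /r -big_filter size_prod_XsubC size_filter count_others.
  by rewrite prednK // (dim_gt0 tot).
by have := monicP mr; rewrite /lead_coef sr => ->; rewrite mulr1.
Qed.

Lemma different_val : d%:Z = w f'.
Proof.
have N0 := dim_gt0 tot; apply/eqP; rewrite eq_le; apply/andP; split.
  have [f nzf qf] := place_attains (-1) pq.
  pose z := f *: (t ^+ N.-1 / f').
  have nzz : z != 0 by apply: scale_neq0 => //; rewrite mulf_neq0 ?invr_neq0 ?expf_neq0.
  have wz : w z = - w f' - 1.
    rewrite (tot_valZ pw tot nzf) ?mulf_neq0 ?invr_neq0 ?expf_neq0 // qf.
    rewrite dvalM ?invr_neq0 ?expf_neq0 // dvalV // dvalX // wt.
    by move: N0; move: (w f') (N) => a b; clear; lia.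
  rewrite leNgt; apply/negP => lt.
  have : vge q 0 (trace galF z).
    by apply: (diff_trace galF pw pq tot diff); rewrite vgeE // wz;
      move: lt; move: (w f') => a; clear; lia.
  by rewrite traceZ trace_euler ?ltn_predL // eqxx mulr1 vgeE // qf.
have : complementary_module q f'^-1.
  apply/(complementaryP galF pq) => y /(tot_icl galF pw tot) wy.
  have [a yE Ha] := tot_powers pw tot nzt wt y.
  rewrite yE mulr_sumr trace_lsum; apply: (vge_sum (place_val pq)) => j _.
  rewrite -scalerAr traceZ mulrC [_^-1 * _]mulrC trace_euler ?ltn_ord //.
  case: eqP => _; last by rewrite mul0r vge0.
  rewrite mul1r; apply/vgeP => nz; have le := Ha _ wy j nz.
  by move: (nat_of_ord j) (ltn_ord j) le => j' lt; move: (q (a j)) => c; move: N0 lt; move: (N) => M; clear; nia.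
move/(diff_complementary galF pw pq tot diff).
by rewrite vgeE ?invr_neq0 // dvalV //; lia.
Qed.

Lemma hilbert_different :
  d%:Z = \sum_(s : gal_of {:F} | s != 1%g) (ram_num s + 1).
Proof.
rewrite different_val /f' -big_filter dval_prod // => [|s]; last first.
  rewrite mem_filter => /andP[s1 _]; rewrite -oppr_eq0 opprB; exact: ram_moves.
rewrite big_filter; apply: eq_bigr => s _.
by rewrite /ram_num subrK -dvalN // opprB.
Qed.

End WildRamification.

(** * Congruences between ramification numbers *)

Section Sen.

Variables (k : closedFieldType) (p n : nat) (F : splittingFieldType (ratfun k)).
Local Notation K := (ratfun k).
Local Notation N := (\dim {:F}).
Hypotheses (char_k : p \in [pchar k]) (galF : galois 1%AS {:F}).
Hypothesis degF : N = (p ^ n.+1)%N.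

Variables (w : F -> int) (q : K -> int).
Hypotheses (pw : is_place (@cst k F) w) (pq : is_place (@cst0 k) q).
Hypothesis tot : totally_ramified w q.

Variable t : F.
Hypotheses (nzt : t != 0) (wt : w t = 1).

Variable sigma : gal_of {:F}.
Hypothesis gen : 'Gal({:F} / 1%AS)%g = <[sigma]>%g.

Let vw := place_val pw.
Let p_pr : prime p. Proof. exact: pcharf_prime char_k. Qed.
Let p_gt1 : (1 < p)%N. Proof. exact: prime_gt1. Qed.
Let p_gt0 : (0 < p)%N. Proof. exact: prime_gt0. Qed.

Local Notation sig m := (sigma ^+ m)%g.

Let order_sigma : #[sigma]%g = N.
Proof. by rewrite /order -gen card_galois. Qed.

Let sig_eq1 m : (sig m == 1%g) = (N %| m)%N.
Proof. by rewrite -order_sigma order_dvdn. Qed.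

Let sig_id m z : (N %| m)%N -> sig m z = z.
Proof. by rewrite -sig_eq1 => /eqP->; rewrite gal_id. Qed.

Let sigD m m' z : sig (m + m') z = sig m' (sig m z).
Proof. by rewrite expgD galMv. Qed.

Definition ram_exp (m : nat) : int := ram_num w t (sig m).

Let sig_neq1 m : ~~ (N %| m)%N -> sig m != 1%g.
Proof. by rewrite sig_eq1. Qed.

Let ram_exp_vge m a z : ~~ (N %| m)%N -> vge w a z -> vge w (a + ram_exp m) (sig m z - z).
Proof. by move=> nm; apply: (ram_vge char_k galF degF pw pq tot nzt wt (sig_neq1 nm)). Qed.

Let ram_exp_gt0 m : ~~ (N %| m)%N -> 1 <= ram_exp m.
Proof. by move=> nm; apply: (ram_num_gt0 char_k galF degF pw tot nzt wt (sig_neq1 nm)). Qed.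

Let sig_t_neq m : ~~ (N %| m)%N -> sig m t - t != 0.
Proof. by move=> nm; apply: (ram_moves pw tot nzt wt (sig_neq1 nm)). Qed.

Let sig_t_val m : w (sig m t - t) = 1 + ram_exp m.
Proof. by rewrite /ram_exp /ram_num [1 + _]addrC subrK. Qed.

Let sig_vge m a z : vge w a z -> vge w a (sig m z).
Proof. by rewrite /vge fmorph_eq0 (tot_gal _ _ pw tot). Qed.

(** [sigma ^+ m'] is a power of [sigma ^+ m]. *)
Lemma ram_exp_mono m m' : ~~ (N %| m)%N -> ~~ (N %| m')%N ->
  (logn p m <= logn p m')%N -> ram_exp m <= ram_exp m'.
Proof.
move=> nm nm' le.
have m0 : (0 < m)%N by rewrite lt0n; apply: contra nm => /eqP->.
have [r rE] : exists r, sig m' = (sig m ^+ r)%g.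
  pose a := logn p m; have [u cu mE] : exists2 u, coprime p u & m = (u * p ^ a)%N.
    by have [u cu mE] := pfactor_coprime p_pr m0; exists u.
  have : generator <[sigma]>%g (sig u).
    by rewrite generator_coprime order_sigma degF coprime_pexpl.
  move/eqP => su; have /cycleP[r0 sE] : sigma \in <[sig u]>%g by rewrite -su cycle_id.
  have dvd : (p ^ a %| m')%N by apply: dvdn_trans (pfactor_dvdnn p m'); rewrite dvdn_exp2l.
  exists (r0 * (m' %/ p ^ a))%N; rewrite mE -{1}(divnK dvd).
  by rewrite {1}sE -!expgM; congr (_ ^+ _)%g; ring.
have H r' : vge w (1 + ram_exp m) ((sig m ^+ r')%g t - t).
  elim: r' => [|r' IH]; first by rewrite expg0 gal_id subrr vge0.
  have -> : (sig m ^+ r'.+1)%g t - t = sig m ((sig m ^+ r')%g t - t) + (sig m t - t).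
    by rewrite expgSr galMv rmorphB addrA subrK.
  apply: vgeD => //; first exact: sig_vge.
  by rewrite -sig_t_val vge_val.
have := H r; rewrite -rE vgeE ?sig_t_neq // sig_t_val.
by move: (ram_exp m) (ram_exp m') => x y; clear; lia.
Qed.

(** The jumps of the ramification filtration: [ram_exp m] only depends on the
    [p]-adic valuation of [m]. *)
Definition ram_jump (j : nat) : int := ram_exp (p ^ j).

Let dvd_log m j : (0 < m)%N -> (p ^ j %| m)%N = (j <= logn p m)%N.
Proof. exact: pfactor_dvdn. Qed.

Let not_dvdN m : (0 < m)%N -> (logn p m < n.+1)%N -> ~~ (N %| m)%N.
Proof. by move=> m0 lt; rewrite degF dvd_log // -ltnNge. Qed.

Lemma ram_exp_jump m : ~~ (N %| m)%N -> ram_exp m = ram_jump (logn p m).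
Proof.
move=> nm; have m0 : (0 < m)%N by rewrite lt0n; apply: contra nm => /eqP->.
have lt : (logn p m < n.+1)%N by rewrite ltnNge -dvd_log // -degF.
have pn : ~~ (N %| p ^ logn p m)%N.
  by apply: not_dvdN; rewrite ?expn_gt0 ?p_gt0 // pfactorK.
by apply/eqP; rewrite eq_le !ram_exp_mono ?pfactorK.
Qed.

(** An element of valuation [a] on which the effect of [sigma ^+ e] is known for
    every [a]: in the quotient of its image by itself all factors but two cancel,
    leaving that of [sigma ^+ (e * a)] on [t]. *)
Let xprod e a := \prod_(l < a) sig (e * l) t.

Let xprod_neq0 e a : xprod e a != 0.
Proof. by apply/prodf_neq0 => l _; rewrite gal_neq0. Qed.

Let xprod_val e a : w (xprod e a) = a%:Z.
Proof.
rewrite /xprod; elim: a => [|a IH]; first by rewrite big_ord0 dval1.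
have nzp : \prod_(l < a) sig (e * l) t != 0 by apply: (xprod_neq0 e a).
by rewrite big_ord_recr /= dvalM ?gal_neq0 // IH (tot_gal _ _ pw tot) wt; lia.
Qed.

Let xprod_sig e a : sig e (xprod e a) - xprod e a = xprod e a * ((sig (e * a) t - t) / t).
Proof.
have E : sig e (xprod e a) * t = xprod e a * sig (e * a) t.
  rewrite /xprod rmorph_prod /=.
  transitivity (\prod_(l < a.+1) sig (e * l) t); last by rewrite big_ord_recr.
  rewrite big_ord_recl /= muln0 expg0 gal_id mulrC; congr (_ * _).
  by apply: eq_bigr => l _; rewrite -sigD; congr ((sigma ^+ _)%g _); rewrite /bump; lia.
apply: (mulIf nzt); rewrite mulrBl E -mulrA divfK //; ring.
Qed.

Let xprod_fix e a : (N %| e * a)%N -> sig e (xprod e a) - xprod e a = 0.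
Proof. by move=> dv; rewrite xprod_sig sig_id // subrr mul0r mulr0. Qed.

Let xprod_jump e a : ~~ (N %| e * a)%N -> sig e (xprod e a) - xprod e a != 0 /\
  w (sig e (xprod e a) - xprod e a) = a%:Z + ram_exp (e * a).
Proof.
move=> nd; have nz := sig_t_neq nd; rewrite xprod_sig.
have nzq : (sig (e * a) t - t) / t != 0 by rewrite mulf_neq0 ?invr_neq0.
split; first exact: mulf_neq0.
rewrite dvalM // xprod_val dvalM ?invr_neq0 // dvalV // wt sig_t_val.
by move: (ram_exp (e * a)) => u; clear; lia.
Qed.

Local Notation pd l x := ((p ^ l)%N%:Z %| x)%Z.

Let pd_le l l' x : (l <= l')%N -> pd l' x -> pd l x.
Proof. by move=> le; apply: dvdz_trans; rewrite dvdzE /= dvdn_exp2l. Qed.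

Let pdN l x : (l <= n.+1)%N -> pd l (N%:Z * x).
Proof. by move=> le; apply: dvdz_mulr; rewrite degF dvdzE /= dvdn_exp2l. Qed.

Let pd_log l m : (0 < m)%N -> pd l m%:Z = (l <= logn p m)%N.
Proof. by move=> m0; rewrite dvdzE /= dvd_log. Qed.

Definition jump_congr (j : nat) : Prop :=
  forall l l', (l <= l')%N -> (l' < j)%N -> pd l.+1 (ram_jump l' - ram_jump l).

(** Were the two sums equal, the congruence between the jumps would make the
    number with the smaller [p]-adic valuation too divisible. *)
Let jump_distinct j m m' : jump_congr j -> (0 < m)%N -> (0 < m')%N ->
  (logn p m < j)%N -> (logn p m' < j)%N -> m != m' ->
  m%:Z + ram_jump (logn p m) != m'%:Z + ram_jump (logn p m').
Proof.
move=> Cj; wlog le : m m' / (logn p m <= logn p m')%N => [IH|] m0 m'0 lm lm' ne.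
  have [le|/ltnW le] := leqP (logn p m) (logn p m'); first exact: IH.
  by rewrite eq_sym; apply: IH => //; rewrite eq_sym.
apply/eqP => E; move: le; rewrite leq_eqVlt => /predU1P[eql|lt].
  by case/eqP: ne; move: E; rewrite eql; move: (ram_jump _) => u; clear; lia.
have : pd (logn p m).+1 m%:Z.
  have -> : m%:Z = m'%:Z + (ram_jump (logn p m') - ram_jump (logn p m)).
    by move: E; move: (ram_jump _) (ram_jump _) => u u'; clear; lia.
  by apply: rpredD; [rewrite pd_log | apply: Cj => //; apply: ltnW].
by rewrite pd_log // ltnn.
Qed.

(** The valuations that [sigma - 1] can produce below a bound [V]. An element is
    expanded in the [xprod 1 m]; the terms with [m] divisible by [p ^ j] are moved
    beyond [V], and the others to valuations which are pairwise distinct by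
    [jump_distinct], so that the smallest one survives. *)
Let descent j (V : int) c (m0 : nat) z : jump_congr j -> (j <= n)%N -> (0 < m0)%N ->
  V <= m0%:Z + ram_jump j -> V - m0%:Z <= c%:Z -> vge w m0%:Z z ->
  vge w V (sigma z - z) \/ exists m, [/\ (m0 <= m)%N, (logn p m < j)%N,
    sigma z - z != 0 & w (sigma z - z) = m%:Z + ram_jump (logn p m)].
Proof.
move=> Cj jn; have sig1 : sig 1 = sigma by rewrite expg1.
have n1 : ~~ (N %| 1)%N by rewrite dvdn1 degF -(expn0 p) eqn_exp2l.
elim: c m0 z => [|c IH] m0 z m00 Vm0 le wz.
  left; rewrite -sig1; apply: vge_le (ram_exp_vge n1 wz); have := ram_exp_gt0 n1.
  by move: (ram_exp 1) le => u; clear; lia.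
pose x := xprod 1 m0; have nzx : x != 0 := xprod_neq0 1 m0.
have wx : w x = m0%:Z := xprod_val 1 m0.
have [|e we] := @place_residue _ _ w (z / x) pw.
  by rewrite mulrC vge_mull ?invr_neq0 // dvalV // wx opprK add0r.
pose z' := z - cst F e * x.
have wz' : vge w m0.+1%:Z z'.
  have -> : z' = x * (z / x - cst F e).
    by rewrite /z' mulrBr mulrCA divff // mulr1 (mulrC x).
  by rewrite vge_mull // wx; apply: vge_le we; clear; lia.
have zE : sigma z - z = cst F e * (sigma x - x) + (sigma z' - z').
  by rewrite /z' rmorphB rmorphM /= gal_cst; ring.
have Vm1 : V <= m0.+1%:Z + ram_jump j by move: Vm0; move: (ram_jump j) => u; clear; lia.
have le' : V - m0.+1%:Z <= c%:Z by move: le; clear; lia.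
have {}IH := IH m0.+1 z' isT Vm1 le' wz'.
have [ce|nze] := eqVneq (cst F e) 0.
  rewrite zE ce mul0r add0r; case: IH => [|[m [lem lm nz wE]]]; first by left.
  by right; exists m; split=> //; apply: ltnW.
have [big|small] : vge w V (cst F e * (sigma x - x)) \/
    [/\ (logn p m0 < j)%N, cst F e * (sigma x - x) != 0 &
      w (cst F e * (sigma x - x)) = m0%:Z + ram_jump (logn p m0)].
- have [dv|nd] := boolP (N %| 1 * m0)%N.
    by left; rewrite -sig1 xprod_fix // mulr0 vge0.
  have [nzd wd] := xprod_jump nd; rewrite -/x sig1 in nzd wd.
  have nzp : cst F e * (sigma x - x) != 0 by rewrite mulf_neq0.
  have wp : w (cst F e * (sigma x - x)) = m0%:Z + ram_exp m0.
    by rewrite dvalM // (place_cst e pw) wd mul1n add0r.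
  rewrite mul1n in nd.
  have [lt|ge] := ltnP (logn p m0) j.
    by right; split=> //; rewrite wp ram_exp_jump.
  left; rewrite vgeE // wp; apply: (le_trans Vm0); rewrite lerD2l.
  apply: ram_exp_mono => //; last by rewrite pfactorK.
  by apply: not_dvdN; rewrite ?expn_gt0 ?p_gt0 // pfactorK.
- case: IH => [big'|[m [lem lm nz wE]]]; first by left; rewrite zE; apply: vgeD.
  have [leV|ltV] := lerP V (w (sigma z' - z')).
    by left; rewrite zE; apply: vgeD => //; rewrite vgeE.
  right; exists m; split=> //; first exact: ltnW.
    rewrite zE addrC; apply: (vge_add_dom vw nz _).1.
    by apply: vge_le big; rewrite lezD1.
  rewrite zE addrC -wE; apply: (vge_add_dom vw nz _).2.
  by apply: vge_le big; rewrite lezD1.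
case: small => lm0 nzp wp.
case: IH => [big'|[m [lem lm nz wE]]].
  have [leV|ltV] := lerP V (w (cst F e * (sigma x - x))).
    by left; rewrite zE; apply: vgeD => //; rewrite vgeE.
  have dom : vge w (w (cst F e * (sigma x - x)) + 1) (sigma z' - z').
    by apply: vge_le big'; rewrite lezD1.
  right; exists m0; split=> //; first by rewrite zE; apply: (vge_add_dom vw nzp dom).1.
  by rewrite zE (vge_add_dom vw nzp dom).2.
right; have ne : m0 != m by rewrite neq_ltn lem.
have := jump_distinct Cj m00 (leq_trans m00 (ltnW lem)) lm0 lm ne.
rewrite -wp -wE neq_lt => /orP[lt|lt].
  have dom : vge w (w (cst F e * (sigma x - x)) + 1) (sigma z' - z').
    by rewrite vgeE // lezD1.
  exists m0; split=> //; first by rewrite zE; apply: (vge_add_dom vw nzp dom).1.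
  by rewrite zE (vge_add_dom vw nzp dom).2.
have dom : vge w (w (sigma z' - z') + 1) (cst F e * (sigma x - x)).
  by rewrite vgeE // lezD1.
exists m; split=> //; first exact: ltnW.
  by rewrite zE addrC; apply: (vge_add_dom vw nz dom).1.
by rewrite zE addrC (vge_add_dom vw nz dom).2.
Qed.

(** The inductive step of Sen's theorem. If the congruence failed, some
    [sigma ^+ e - 1] would send an element of suitable valuation [a] to one of
    valuation [a + ram_jump j], which by [descent] and the choice of [a] is not
    reached by [sigma - 1] from elements of valuation greater than [a]. *)
Let sen_step j : (0 < j <= n)%N -> jump_congr j -> pd j (ram_jump j - ram_jump j.-1).
Proof.
case/andP=> j0 jn Cj; apply: contraT => npd.
(* [a] is positive, and [a + ram_jump j] is [ram_jump j.-1] modulo [N]. *)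
pose dd := ram_jump j.-1 - ram_jump j; pose M := `|dd|%N.+1.
pose a := `|(dd + N%:Z * M%:Z)%R|%N.
have pos : 0 < dd + N%:Z * M%:Z.
  have : forall (u : int) (c : nat), (0 < c)%N -> 0 < u + c%:Z * `|u|%N.+1%:Z.
    by clear; move=> u c; nia.
  by apply; apply: dim_gt0 tot.
have aE : a%:Z = dd + N%:Z * M%:Z by rewrite /a gtz0_abs.
have a0 : (0 < a)%N by rewrite -ltz_nat aE.
have sj : (logn p a < j)%N.
  rewrite ltnNge -pd_log //; apply: contra npd => pa.
  have -> : ram_jump j - ram_jump j.-1 = N%:Z * M%:Z - a%:Z by rewrite aE /dd; ring.
  by apply: rpredB => //; apply: pdN; lia.
(* The least power [e] of [p] for which [sigma ^+ (e * a)] has jump index [j]. *)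
pose e := (p ^ (j - logn p a))%N.
have le : logn p (e * a) = j.
  by rewrite lognM ?expn_gt0 ?p_gt0 // pfactorK // subnK // ltnW.
have ea0 : (0 < e * a)%N by rewrite muln_gt0 expn_gt0 p_gt0.
have nea : ~~ (N %| e * a)%N by apply: not_dvdN; rewrite ?le.
have [nzx wx] := xprod_jump nea; rewrite ram_exp_jump // le in wx.
set x := xprod e a in nzx wx.
(* [sigma ^+ e - 1] is [sigma - 1] composed with [T]. *)
pose T z := \sum_(l < e) sig l z.
have TE z : sigma (T z) - T z = sig e z - z.
  rewrite rmorph_sum -sumrB /=.
  rewrite (eq_bigr (fun l : 'I_e => sig l.+1 z - sig l z)) => [|l _].
    by rewrite -(big_mkord xpredT (fun l => sig l.+1 z - sig l z)) telescope_sumr ?expg0 ?gal_id.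
  by rewrite expgSr galMv.
have wT : vge w a.+1%:Z (T x).
  have -> : T x = \sum_(l < e) (sig l x - x).
    rewrite sumrB sumr_const card_ord -mulr_natl.
    have -> : e%:R = 0 :> F.
      rewrite -(rmorph_nat (@cst k F)) -(rmorph0 (@cst k F)); congr (cst F _).
      by apply/eqP; rewrite -(dvdn_pcharf char_k) /e -(subnSK sj) expnS dvdn_mulr.
    by rewrite mul0r subr0.
  apply: vge_sum => // l _; have [dv|nd] := boolP (N %| l)%N.
    by rewrite sig_id // subrr vge0.
  apply: vge_le (ram_exp_vge nd (vge_val w x)); rewrite xprod_val.
  by have := ram_exp_gt0 nd; move: (ram_exp l) => u; clear; lia.
have := @descent j (a.+1%:Z + ram_jump j) `|ram_jump j|%N a.+1 (T x) Cj jn isT (lexx _) _ wT.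
rewrite TE; case=> [|wV|[m [lem lm nz]]].
- by move: (ram_jump j) => u; clear; lia.
- by move: wV; rewrite vgeE // wx; move: (ram_jump j) => u; clear; lia.
rewrite wx aE => E.
have m0 : (0 < m)%N by apply: leq_trans lem.
have : pd (logn p m).+1 m%:Z.
  have -> : m%:Z = (ram_jump j.-1 - ram_jump (logn p m)) + N%:Z * M%:Z.
    move: E; rewrite /dd; move: (ram_jump j) (ram_jump j.-1) (ram_jump _) (N%:Z * M%:Z).
    by move=> u1 u2 u3 u4; clear; lia.
  have lj : (logn p m <= j.-1)%N by rewrite -ltnS prednK.
  by apply: rpredD; [apply: Cj; rewrite ?prednK | apply: pdN; apply: leq_trans lm (leqW jn)].
by rewrite pd_log // ltnn.
Qed.

Lemma sen j : (j <= n.+1)%N -> jump_congr j.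
Proof.
elim: j => [|j IH] jn l l' ll' l'j; first by [].
have Cj := IH (ltnW jn).
have [lt|ge] := ltnP l' j; first exact: Cj.
have -> : l' = j by lia.
have [lt|ge'] := ltnP l j; last by rewrite (_ : l = j) ?subrr ?dvdz0 //; lia.
have -> : ram_jump j - ram_jump l =
    (ram_jump j - ram_jump j.-1) + (ram_jump j.-1 - ram_jump l) by ring.
apply: rpredD; last by apply: Cj; lia.
by apply: (@pd_le _ j) => //; apply: sen_step => //; lia.
Qed.

(** Among the positive numbers below [p ^ r] exactly [(p - 1) * p ^ (r.-1 - j)]
    have [p]-adic valuation [j]. *)
Let sum_by_log r (g : nat -> int) :
  \sum_(0 <= m < p ^ r) (if m == 0%N then 0 else g (logn p m)) =
  \sum_(0 <= j < r) ((p - 1) * p ^ (r.-1 - j))%N%:Z * g j.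
Proof.
elim: r g => [|r IH] g; first by rewrite expn0 big_nat1 eqxx big_geq.
have inner i : \sum_(i * p <= j < i.+1 * p) (if j == 0%N then 0 else g (logn p j)) =
    (if i == 0%N then 0 else g (logn p i).+1) + (p - 1)%N%:Z * g 0%N.
  have -> : (i.+1 * p = p + i * p)%N by rewrite mulSn.
  rewrite -{1}[(i * p)%N]add0n big_addn addnK big_ltn // add0n; congr (_ + _).
    rewrite muln_eq0 -[(p == 0)%N]negbK -lt0n p_gt0 orbF; case: eqP => // /eqP i0.
    by move: i0; rewrite -lt0n => i0; rewrite lognM // (logn_prime p p_pr) eqxx addn1.
  rewrite big_nat_cond (eq_bigr (fun=> g 0%N)) => [|j /andP[/andP[j0 jp] _]].
    by rewrite -big_nat_cond sumr_const_nat -mulr_natl natz.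
  rewrite addn_eq0 -[(j == 0)%N]negbK -lt0n j0 /=; congr g; apply/eqP.
  rewrite -leqn0 leqNgt logn_gt0 mem_primes p_pr /= negb_and; apply/orP; right.
  by rewrite dvdn_addl ?dvdn_mull // gtnNdvd.
rewrite expnSr big_nat_mul (eq_bigr _ (fun i _ => inner i)) big_split /= (IH (fun j => g j.+1)).
rewrite sumr_const_nat subn0 big_nat_recl // addrC; congr (_ + _).
  by rewrite subn0 -mulr_natr natz PoszM; ring.
apply: eq_bigr => j _; congr ((_ * _)%N%:Z * _).
by rewrite subnS predn_sub; congr (p ^ _)%N; lia.
Qed.

Variable d : nat.
Hypothesis diff : different_exponent w q d.

Lemma different_jumps :
  d%:Z = \sum_(0 <= j < n.+1) ((p - 1) * p ^ (n - j))%N%:Z * (ram_jump j + 1).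
Proof.
rewrite -(sum_by_log n.+1 (fun j => ram_jump j + 1)) -degF.
rewrite (hilbert_different char_k galF degF pw pq tot diff nzt wt) big_mkord.
have inj : injective (fun m : 'I_N => sig m).
  move=> m m' /eqP; rewrite eq_expg_mod_order order_sigma !modn_small // => /eqP/val_inj.
  by [].
have cardG : #|{: gal_of {:F}}| = N.
  by rewrite -(card_galois galF); apply: eq_card => s; rewrite mem_gal1.
have bij : bijective (fun m : 'I_N => sig m).
  by apply: inj_card_bij => //; rewrite cardG card_ord.
rewrite big_mkcond (reindex (fun m : 'I_N => sig m)) /=; last exact: onW_bij.
apply: eq_bigr => m _; rewrite sig_eq1.
have [->|m0] := eqVneq (m : nat) 0%N; first by rewrite dvdn0.
have nm : ~~ (N %| m)%N by rewrite gtnNdvd // lt0n.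
by rewrite nm -ram_exp_jump.
Qed.

(** Modulo [p ^ j.+1] the jump of index [j] can be replaced by the last one. So
    if [p ^ n.+1] divides the last jump plus one, it divides each term of
    [different_jumps]; conversely, if it is known to be divisible by
    [p ^ l], then all terms but the last are divisible by [p ^ l.+1], and the last
    has a coefficient prime to [p]. *)
Lemma different_dvd : (N %| d)%N = pd n.+1 (ram_jump n + 1).
Proof.
have Cn := sen (leqnn n.+1); have dE := different_jumps.
rewrite degF; have -> : (p ^ n.+1 %| d)%N = pd n.+1 d%:Z by [].
have pd_mul a b x : pd a x -> pd (b + a) ((p ^ b)%N%:Z * x).
  by rewrite expnD PoszM; apply: dvdz_mul.
have jump j l : (j <= n)%N -> pd l (ram_jump n + 1) -> (l <= j.+1)%N -> pd l (ram_jump j + 1).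
  move=> jn pl lj; have -> : ram_jump j + 1 = (ram_jump n + 1) - (ram_jump n - ram_jump j) by ring.
  by apply: rpredB => //; apply: (pd_le lj); apply: Cn.
apply/idP/idP => [pdd|pn]; last first.
  rewrite dE big_nat_cond; apply: rpred_sum => j /andP[/andP[_ jn] _].
  rewrite PoszM -mulrA; apply: dvdz_mull.
  have -> : n.+1 = ((n - j) + j.+1)%N by lia.
  apply: pd_mul; apply: jump; [exact: jn | by apply: pd_le pn; lia | by []].
suff : forall l, (l <= n.+1)%N -> pd l (ram_jump n + 1) by apply.
elim=> [|l IH] ln; first by rewrite expn0 dvd1z.
have {}IH := IH (ltnW ln).
have : pd l.+1 ((p - 1)%N%:Z * (ram_jump n + 1)).
  move: pdd; rewrite dE big_nat_recr //= subnn expn0 muln1 => pdd.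
  have rest : pd l.+1 (\sum_(0 <= j < n) ((p - 1) * p ^ (n - j))%N%:Z * (ram_jump j + 1)).
    rewrite big_nat_cond; apply: rpred_sum => j /andP[/andP[_ jn] _].
    rewrite PoszM -mulrA; apply: dvdz_mull.
    apply: (@pd_le _ ((n - j) + minn l j.+1)); first by lia.
    apply: pd_mul; apply: jump; [by lia | | by lia].
    by apply: pd_le IH; lia.
  set S := \sum_(0 <= j < n) _ in pdd rest.
  rewrite -[X in pd _ X](addKr S) addrC; apply: rpredB => //.
  by apply: pd_le pdd.
by rewrite Gauss_dvdzr // coprimezE /= coprimeXl // subn1 coprimenP.
Qed.

End Sen.

(** * The last ramification number and Artin-Schreier generators *)

Section LastJump.

Variables (k : closedFieldType) (p n : nat) (F : splittingFieldType (ratfun k)).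
Local Notation K := (ratfun k).
Local Notation N := (\dim {:F}).
Hypotheses (char_k : p \in [pchar k]) (galF : galois 1%AS {:F}).
Hypothesis degF : N = (p ^ n.+1)%N.

Variables (w : F -> int) (q : K -> int).
Hypotheses (pw : is_place (@cst k F) w) (pq : is_place (@cst0 k) q).
Hypothesis tot : totally_ramified w q.

Variable t : F.
Hypotheses (nzt : t != 0) (wt : w t = 1).

Variables (L : {subfield F}) (y B : F) (lam : nat).
Hypotheses (degL : \dim_L {:F} = p) (genL : <<L; y>>%VS = {:F}%VS).
Hypotheses (yB : y ^+ p - y = B) (BL : B \in L).
Hypothesis lam_coprime : lam = 0%N \/ coprime lam p.
Hypothesis pole_B : forall (u : subvs_of L -> int) e,
  is_place (@cst k (subvs_of L)) u -> lies_over vsval w u e ->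
  u (vsproj L B) = - lam%:Z.

Let vw := place_val pw.
Let p_pr : prime p. Proof. exact: pcharf_prime char_k. Qed.
Let p_gt1 : (1 < p)%N. Proof. exact: prime_gt1. Qed.

Let galL : galois L {:F}.
Proof. by apply: galoisS galF; rewrite sub1v subvf. Qed.

Let cardL : #|'Gal({:F} / L)%g| = p.
Proof. by rewrite -galois_dim. Qed.

Variable tau : gal_of {:F}.
Hypotheses (tauL : tau \in 'Gal({:F} / L)%g) (tau1 : tau != 1%g).

Let tau_fix z : z \in L -> tau z = z.
Proof. exact: fixed_gal (subvf L) tauL. Qed.

Let val_moved z : z != 0 -> ~~ (p%:Z %| w z)%Z ->
  tau z - z != 0 /\ w (tau z - z) = w z + ram_num w t tau.
Proof. exact: (ram_exact char_k galF degF pw pq tot nzt wt tau1). Qed.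

(** By [ram_exact] an automorphism that fixes [L] moves every element of
    valuation prime to [p]. *)
Let val_subfield z : z \in L -> z != 0 -> (p%:Z %| w z)%Z.
Proof.
move=> zL nzz; apply: contraT => pz.
by have [/eqP[]] := val_moved nzz pz; rewrite tau_fix // subrr.
Qed.

(** [L] has elements of valuation [p], the norm of [t] for instance, and none of
    valuation prime to [p]. *)
Lemma restrict_subfield : exists2 u : subvs_of L -> int,
  is_place (@cst k (subvs_of L)) u & lies_over vsval w u p.
Proof.
pose nt := galNorm L {:F} t.
have ntL : nt \in L.
  have fE : fixedField 'Gal({:F} / L)%g = L by apply/galois_fixedField.
  have : nt \in fixedField 'Gal({:F} / L)%g by apply: galNorm_fixedField; rewrite memvf.
  by rewrite fE.
have wnt : w nt = p%:Z.
  rewrite /nt /galNorm -big_filter (dval_prod vw) => [|s _]; last by rewrite gal_neq0.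
  rewrite big_filter (eq_bigr (fun=> 1)) => [|s _]; last by rewrite (tot_gal _ _ pw tot).
  by rewrite sumr_const cardL natz.
have nznt : nt != 0 by apply/prodf_neq0 => s _; rewrite gal_neq0.
have vL : valuation (fun z : subvs_of L => w (vsval z)).
  exact: (@valuation_comp _ _ (vsval : {rmorphism subvs_of L -> F}) w vw).
have cL a : w (vsval (@cst k (subvs_of L) a)) = 0.
  by rewrite linearZ rmorph1 -[RHS](place_cst a pw) /cst.
have nzL (z : subvs_of L) : (vsval z != 0) = (z != 0).
  congr (~~ _); exact: (fmorph_eq0 (vsval : {rmorphism subvs_of L -> F})).
pose ntl := Subvs ntL.
have [|d [u [d0 pu wE]]] := @normalize_valuation _ _ (@cst k (subvs_of L))
    (fun z : subvs_of L => w (vsval z)) vL cL.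
  exists ntl; first by rewrite -nzL.
  by rewrite /= wnt eqz_nat -lt0n ltnW.
have [z nzz uz] := place_unif pu.
have pd : (p %| d)%N.
  have : (p%:Z %| w (vsval z))%Z by apply: val_subfield; rewrite ?subvsP // nzL.
  by rewrite wE uz mulr1.
have dp : (d %| p)%N.
  have : (d%:Z %| w (vsval ntl))%Z by rewrite wE dvdz_mulr.
  by rewrite /= wnt.
exists u => //; have <- : d = p by apply/eqP; rewrite eqn_dvd dp pd.
by split.
Qed.

Let charF : p \in [pchar F].
Proof. exact: (rmorph_pchar (@cst k F) char_k). Qed.

Let a := tau y - y.

Let nza : a != 0.
Proof.
apply: contra tau1; rewrite subr_eq0 => /eqP ty; apply/gal_eqP => z _.
have : z \in <<L; y>>%VS by rewrite genL memvf.
move=> /Fadjoin_polyP[m mL ->]; rewrite gal_id.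
rewrite -horner_map /= ty; congr (_.[y]); apply/polyP=> j; rewrite coef_map /=.
by apply: tau_fix; apply: (polyOverP mL).
Qed.

Let wa : w a = 0.
Proof.
have aX : a ^+ p = a.
  have -> : a ^+ p = tau y ^+ p - y ^+ p := rmorphB (pFrobenius_aut charF) _ _.
  rewrite -rmorphXn /=.
  have -> : y ^+ p = B + y by rewrite -yB subrK.
  by rewrite rmorphD /= tau_fix // opprD addrACA subrr add0r.
have := dvalX vw a p; rewrite aX; move: p_gt1; move: (w a) => u; clear; nia.
Qed.

(** [tau] moves [y] by a nonzero element [a] of the prime field, hence by a unit.
    So [y] has a pole, an integral element being moved by a nonunit; its order is
    then [lam], and as this is prime to [p], [ram_exact] gives
    [0 = - lam + ram_num]. *)
Lemma last_ram_num : ram_num w t tau = lam%:Z.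
Proof.
have [u pu wu] := restrict_subfield.
have wB : w B = - (p%:Z * lam%:Z).
  by rewrite -(vsprojK BL) wu.2 (pole_B pu wu) mulrN.
have : ~~ vge w 0 y.
  apply/negP => /(ram_vge0 char_k galF degF pw tot nzt wt tau1).
  rewrite -/a vgeE // wa; have := ram_num_gt0 char_k galF degF pw tot nzt wt tau1.
  by move: (ram_num w t tau) => r; clear; lia.
rewrite vgeN_lt => /andP[nzy wy0].
have nzyp : y ^+ p != 0 by rewrite expf_neq0.
have wyp : w (y ^+ p) = p%:Z * w y by rewrite dvalX.
have wyB : w B = p%:Z * w y.
  rewrite -yB -wyp; apply: (vge_add_dom vw nzyp _).2.
  rewrite (vgeN vw) vgeE // wyp; move: p_gt1 wy0; move: (w y) => x; clear; nia.
have wy : w y = - lam%:Z.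
  by move: wyB; rewrite wB; move: p_gt1; move: (w y) => x; clear; nia.
have cop : coprime lam p by case: lam_coprime => // l0; move: wy0; rewrite wy l0.
have [|_] := val_moved nzy.
  by rewrite wy rpredN dvdzE /= -prime_coprime // coprime_sym.
by rewrite -/a wa wy; move: (ram_num w t tau) => r; clear; lia.
Qed.

End LastJump.

Section LastJumpCyclic.

Variables (k : closedFieldType) (p n : nat) (F : splittingFieldType (ratfun k)).
Local Notation K := (ratfun k).
Local Notation N := (\dim {:F}).
Hypotheses (char_k : p \in [pchar k]) (galF : galois 1%AS {:F}).
Hypothesis cycF : cyclic 'Gal({:F} / 1%AS).
Hypothesis degF : N = (p ^ n.+1)%N.

Variables (w : F -> int) (q : K -> int) (d : nat).
Hypotheses (pw : is_place (@cst k F) w) (pq : is_place (@cst0 k) q).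
Hypothesis tot : totally_ramified w q.
Hypothesis diff : different_exponent w q d.

Variables (L : {subfield F}) (y B : F) (lam : nat).
Hypotheses (degL : \dim_L {:F} = p) (genL : <<L; y>>%VS = {:F}%VS).
Hypotheses (yB : y ^+ p - y = B) (BL : B \in L).
Hypothesis lam_coprime : lam = 0%N \/ coprime lam p.
Hypothesis pole_B : forall (u : subvs_of L -> int) e,
  is_place (@cst k (subvs_of L)) u -> lies_over vsval w u e ->
  u (vsproj L B) = - lam%:Z.

(** [lam] is the last jump, since a generator of the Galois group over [L] is a
    power of [sigma] of exponent divisible by [p ^ n] exactly. *)
Lemma different_dvd_pole_order :
  (N %| d)%N <-> (lam%:Z = -1 %[mod (p ^ n.+1)%N%:Z])%Z.
Proof.
have p_pr := pcharf_prime char_k; have p_gt0 := prime_gt0 p_pr.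
have [t nzt wt] := place_unif pw.
have [sigma gen] := cyclicP cycF.
have [tau tauL tau1] : exists2 tau, tau \in 'Gal({:F} / L)%g & tau != 1%g.
  apply/trivgPn; rewrite -cardG_gt1 -galois_dim ?degL ?prime_gt1 //.
  by apply: galoisS galF; rewrite sub1v subvf.
have tauP : (tau ^+ p)%g = 1%g.
  have <- : #|'Gal({:F} / L)%g| = p.
    by rewrite -galois_dim // ; apply: galoisS galF; rewrite sub1v subvf.
  exact: expg_cardG.
have [m tauE] : exists m, tau = (sigma ^+ m)%g.
  by apply/cycleP; rewrite -gen mem_gal1.
have order_sigma : #[sigma]%g = N by rewrite /order -gen card_galois.
have nm : ~~ (N %| m)%N by rewrite -order_sigma order_dvdn -tauE.
have logm : logn p m = n.
  have m0 : (0 < m)%N by rewrite lt0n; apply: contra nm => /eqP->.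
  have lt : (logn p m < n.+1)%N by rewrite ltnNge -pfactor_dvdn // -degF.
  have : (N %| m * p)%N by rewrite -order_sigma order_dvdn expgM -tauE tauP.
  rewrite degF pfactor_dvdn ?muln_gt0 ?m0 ?p_gt0 // lognM //.
  by rewrite (logn_prime p p_pr) eqxx addn1 ltnS => le; apply/eqP; rewrite eqn_leq le -ltnS lt.
have := last_ram_num char_k galF degF pw pq tot nzt wt degL genL yB BL
          lam_coprime pole_B tauL tau1.
rewrite tauE -/(ram_exp w t sigma m) (ram_exp_jump char_k galF degF pw tot nzt wt gen nm) logm => jn.
rewrite (different_dvd char_k galF degF pw pq tot nzt wt gen diff) jn.
by split=> [dv|/eqP]; [apply/eqP|]; rewrite eqz_mod_dvd opprK.
Qed.

End LastJumpCyclic.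

(** * The criterion for symmetry *)

(** The two sides differ by a sum of remainders, which vanishes only if each of
    them does. *)
Lemma sum_divn (I : finType) (P : pred I) (f : I -> nat) c :
  (\sum_(i | P i) f i = c * \sum_(i | P i) (f i %/ c))%N <->
  (forall i, P i -> c %| f i)%N.
Proof.
have E : (\sum_(i | P i) f i = c * (\sum_(i | P i) f i %/ c) + \sum_(i | P i) f i %% c)%N.
  by rewrite big_distrr -big_split; apply: eq_bigr => i _; rewrite /= mulnC -divn_eq.
split=> [H i Pi|H]; last first.
  by rewrite big_distrr; apply: eq_bigr => i Pi; rewrite /= mulnC divnK ?H.
have /eqP : (\sum_(i | P i) f i %% c = 0)%N by move: E; rewrite H; lia.
by rewrite sum_nat_eq0 => /forallP/(_ i); rewrite Pi.
Qed.

Theorem lemma44 (k : closedFieldType) (p n s g : nat)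
    (F : splittingFieldType (ratfun k))
    (Q : 'I_s -> ratfun k -> int) (P : 'I_s -> F -> int) (delta : 'I_s -> nat)
    (char_k : p \in [pchar k])
    (galF : galois 1%AS {:F}) (cycF : cyclic 'Gal({:F} / 1%AS))
    (degF : \dim {:F} = (p ^ n)%N)
    (genusF : is_genus F g) (g_ge2 : (2 <= g)%N)
    (s_ge2 : (2 <= s)%N)
    (Q_place : forall i, is_place (@cst0 k) (Q i))
    (Q_inj : forall i i', Q i =1 Q i' -> i = i')
    (Q_ram : forall q, is_place (@cst0 k) q ->
               (ramified F q <-> exists i, q =1 Q i))
    (P_place : forall i, is_place (@cst k F) (P i))
    (P_total : forall i, totally_ramified (P i) (Q i))
    (delta_diff : forall i, different_exponent (P i) (Q i) (delta i))
    (i : 'I_s) :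
  (symmetric_semigroup (weierstrass_semigroup (P i)) <->
     (\sum_(i' < s | i' != i) delta i' =
      p ^ n * \sum_(i' < s | i' != i) (delta i' %/ p ^ n))%N) /\
  (forall (L : nat -> {subfield F}) (y B : nat -> F) (lam : 'I_s -> nat -> nat),
     standard_form p n P L y B lam ->
     ((\sum_(i' < s | i' != i) delta i' =
       p ^ n * \sum_(i' < s | i' != i) (delta i' %/ p ^ n))%N <->
      (forall i' : 'I_s, i' != i ->
         ((lam i' n)%:Z = -1 %[mod (p ^ n)%N%:Z])%Z))).
Proof.
split.
  have [i0 i0i] : exists i0 : 'I_s, i0 != i.
    have /card_gt1P[a [b [_ _ ab]]] : (1 < #|'I_s|)%N by rewrite card_ord.
    have [ai|] := eqVneq a i; last by exists a.
    by exists b; rewrite -ai eq_sym.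
  split=> [sym|/sum_divn dv].
    apply/sum_divn => j ji; rewrite -degF.
    exact: (symmetric_divisible char_k galF degF Q_place Q_inj P_place P_total
              delta_diff i0i sym ji).
  apply: (divisible_symmetric char_k galF degF Q_place Q_inj Q_ram P_place P_total
            delta_diff i0i) => j ji.
  by rewrite degF; apply: dv.
move=> L y B lam std.
have dvdE i' : (p ^ n %| delta i')%N <-> ((lam i' n)%:Z = -1 %[mod (p ^ n)%N%:Z])%Z.
  case: n degF std => [|m] degF' std.
    by rewrite expn0 dvd1n; split=> // _; apply/eqP; rewrite eqz_mod_dvd dvd1z.
  have top : L m.+1 = {:F}%VS :> {vspace F} by rewrite (sf_top std).
  rewrite -degF'.
  have degL : \dim_(L m) {:F} = p by rewrite -top (sf_degree std).
  have genL : <<L m; y m.+1>>%VS = {:F}%VS by rewrite (sf_gen std) // top.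
  rewrite degF' -[X in (X %| _)%N]degF'.
  apply: (different_dvd_pole_order char_k galF cycF degF' (P_place i') (Q_place i')
            (P_total i') (delta_diff i') degL genL (sf_eq std (ltnSn m))
            (sf_B std (ltnSn m)) (sf_lam std i' (ltnSn m))).
  by move=> u e; apply: (sf_pole std (ltnSn m)).
by split=> [/sum_divn dv i' i'i|H]; [apply/dvdE/dv | apply/sum_divn => i' i'i; apply/dvdE/H].
Qed.
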